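(* For every composition $\alpha$ one has $$\widetilde{\mathrm{Ch}}^*(\Theta(R_\alpha))=[\tilde P_\alpha]\quad\text{in }\widetilde{\mathcal K}.$$ Moreover, the following squares of Hopf algebra homomorphisms commute: $$\mathrm{Ind}_{\mathcal H}^{\mathcal{HC}}\circ \mathrm{Ch}^*=\widetilde{\mathrm{Ch}}^*\circ\Theta:\ \mathrm{NSym}\to\widetilde{\mathcal K},\qquad \widetilde{\mathrm{Ch}}\circ\widetilde\chi\circ\widetilde{\mathrm{Ch}}^*=\pi:\ \mathrm{Peak}\to\mathrm{Peak}^*,$$ where $\widetilde\chi:\widetilde{\mathcal K}\to\widetilde{\mathcal G}$ is the Cartan map $[P]\mapsto[P]$ and $\pi$ is the restriction to $\mathrm{Peak}$ of the forgetful map. In particular, under the identification $\widetilde{\mathrm{Ch}}:\widetilde{\mathcal G}\cong\mathrm{Peak}^*$, the image of $\widetilde\chi$ is $\Omega$.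
   Context: $\mathbb K$ is an algebraically closed field of characteristic $0$; all Hopf algebras and Grothendieck groups below are taken with scalars extended to $\mathbb K$. Combinatorics. A composition $\alpha=(\alpha_1,\dots,\alpha_r)\vDash n$ has length $\ell(\alpha)=r$ and descent set $D(\alpha)=\{\alpha_1,\alpha_1+\alpha_2,\dots,\alpha_1+\cdots+\alpha_{r-1}\}\subseteq[n-1]$. Refinement order: $\alpha\le\beta$ iff $D(\beta)\subseteq D(\alpha)$. For $w\in\mathfrak S_n$, $D(w)=\{i\in[n-1]:w(i)>w(i+1)\}$, and $\mathfrak D_\alpha=\{w\in\mathfrak S_n:D(w)=D(\alpha)\}$. A peak set in $[n]$ is $P\subseteq[2,n-1]$ with $i\in P\Rightarrow i-1\notin P$. $P(\alpha)=\{x\in[2,n-1]:x-1\notin D(\alpha),x\in D(\alpha)\}$. Hopf algebras. $\mathrm{NSym}$ is the free associative algebra on $H_n$ ($n\ge1$), $H_0=1$, $\Delta(H_n)=\sum_k H_k\otimes H_{n-k}$. $E_n$ is defined by $\sum_{i=0}^n(-1)^iE_iH_{n-i}=\delta_{n,0}$; $H_\beta=H_{\beta_1}\cdots H_{\beta_r}$; $R_\alpha=\sum_{\beta\ge\alpha}(-1)^{\ell(\beta)-\ell(\alpha)}H_\beta$. $\mathrm{QSym}$ is the algebra of quasisymmetric functions, with fundamental basis $F_\alpha=\sum x_{i_1}\cdots x_{i_n}$ (sum over $i_1\le\cdots\le i_n$ with $i_k<i_{k+1}$ if $k\in D(\alpha)$), dual to NSym via $\langle R_\alpha,F_\beta\rangle=\delta_{\alpha\beta}$.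 $\Lambda$ is the algebra of symmetric functions; the forgetful map is $\pi:\mathrm{NSym}\to\Lambda$, $H_n\mapsto h_n$. $\Omega\subseteq\Lambda$ is the subalgebra generated by the $q_n$, where $\sum_n q_nz^n=\prod_i\frac{1+x_iz}{1-x_iz}$. Put $Q_n=\sum_{k=0}^nE_kH_{n-k}$; $\mathrm{Peak}$ is the Hopf subalgebra of NSym generated by the $Q_n$, with basis $\Xi_P=\sum_{P(\alpha)=P}R_\alpha$ ($P$ a peak set). $\Theta:\mathrm{NSym}\to\mathrm{Peak}$ is the Hopf algebra epimorphism $H_n\mapsto Q_n$. $\mathrm{Peak}^*\subseteq\mathrm{QSym}$ is the Hopf subalgebra with basis $K_P=2^{|P|+1}\sum_{\alpha\vDash n,\,P\subseteq D(\alpha)\triangle(D(\alpha)+1)}F_\alpha$ ($P$ a peak set in $[n]$), where $D+1=\{x+1:x\in D\}$ and $\triangle$ is symmetric difference; it is the graded dual of Peak via $[\Xi_P,K_Q]=\delta_{P,Q}$. One has $\pi(Q_n)=q_n$ and $\Omega\subseteq\mathrm{Peak}^*$, so $\pi$ restricts to $\mathrm{Peak}\to\Omega\subseteq\mathrm{Peak}^*$. Algebras. The 0-Hecke algebra $\mathcal H_n$ is generated by $T_1,\dots,T_{n-1}$ with $T_i^2=-T_i$, $T_iT_j=T_jT_i$ for $|i-j|>1$, $T_iT_{i+1}T_i=T_{i+1}T_iT_{i+1}$. The 0-Hecke-Clifford superalgebra $\mathcal{HC}_n$ is generated by even $T_1,\dots,T_{n-1}$ satisfying these relations and odd $c_1,\dots,c_n$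 with $c_i^2=-1$, $c_ic_j=-c_jc_i$ ($i\ne j$), $T_ic_j=c_jT_i$ ($j\neq i,i+1$), $T_ic_i=c_{i+1}T_i$, $(T_i+1)c_{i+1}=c_i(T_i+1)$. Modules. For $\alpha\vDash n$, $S_\alpha=\mathbb K\eta_\alpha$ is the simple $\mathcal H_n$-module with $T_i\eta_\alpha=-\eta_\alpha$ if $i\in D(\alpha)$ and $0$ otherwise; $P_\alpha$ is its projective cover; $\tilde S_\alpha=\mathrm{Ind}_{\mathcal H_n}^{\mathcal{HC}_n}S_\alpha$, $\tilde P_\alpha=\mathrm{Ind}_{\mathcal H_n}^{\mathcal{HC}_n}P_\alpha$. Grothendieck groups. $\mathcal K=\bigoplus_nK_0(\mathcal H_n\text{-pmod})$, $\mathcal G=\bigoplus_n K_0(\mathcal H_n\text{-mod})$; $\widetilde{\mathcal K}=\bigoplus_nK_0(\mathcal{HC}_n\text{-pmod})$, $\widetilde{\mathcal G}=\bigoplus_nK_0(\mathcal{HC}_n\text{-mod})$, where mod (pmod) means finitely generated (projective) supermodules in the Clifford case, relations come from short exact sequences with even maps, and $[M]=[\Pi M]$ for the parity change $\Pi$. They are graded Hopf algebras with product given by induction along $\mathcal{HC}_m\otimes\mathcal{HC}_n\subseteq\mathcal{HC}_{m+n}$ (resp. $\mathcal H_m\otimes\mathcal H_n\subseteq\mathcal H_{m+n}$) and coproduct by restriction. $\mathrm{Ind}_{\mathcal H}^{\mathcal{HC}}=\bigoplus_n\mathrm{Ind}_{\mathcal H_n}^{\mathcal{HC}_n}$. Pairing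 $\widetilde{\mathcal K}\times\widetilde{\mathcal G}$: $\langle[P],[M]\rangle=\dim_{\mathbb K}\mathrm{Hom}_{\mathcal{HC}_n}(P,M)$ (all morphisms, even and odd) when $P,M$ are both over the same $\mathcal{HC}_n$, and $0$ otherwise. Known isomorphisms of graded Hopf algebras: $\mathrm{Ch}^*:\mathrm{NSym}\to\mathcal K$, $R_\alpha\mapsto[P_\alpha]$ (Krob–Thibon), and $\widetilde{\mathrm{Ch}}:\widetilde{\mathcal G}\to\mathrm{Peak}^*$, $[\tilde S_\alpha]\mapsto K_{P(\alpha)}$ (Bergeron–Hivert–Thibon). The Hopf isomorphism $\widetilde{\mathrm{Ch}}^*:\mathrm{Peak}\to\widetilde{\mathcal K}$ is the adjoint defined by $[F,\widetilde{\mathrm{Ch}}([M])]=\langle\widetilde{\mathrm{Ch}}^*(F),[M]\rangle$ for $F\in\mathrm{Peak}$, $[M]\in\widetilde{\mathcal G}$.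
   Formalization: In degree n=0 the basis element K_∅ of Peak* is taken to be 1 instead of 2^{|P|+1}=2, since the unit class [S̃_∅] must go to the unit under the algebra map Ch̃. *)

(* Defs.v *)
From HB Require Import structures.
From mathcomp Require Import all_boot all_order all_algebra.
From mathcomp Require Import boolp.
From mathcomp Require Import finmap monalg mpoly.

Set Implicit Arguments.
Unset Strict Implicit.
Unset Printing Implicit Defensive.

Import GRing.Theory.

(* monalg uses the same notation for its own type of polynomials.             *)
Notation "{ 'mpoly' T [ n ] }" := (mpoly n T) : type_scope.

Local Open Scope ring_scope.

Section Span.
Context {K : fieldType} {V : lmodType K}.
Variable S : V -> Prop.

Inductive span : V -> Prop :=
| span0 : span 0
| spanS a v w : S v -> span w -> span (a *: v + w).

Definition spanb : V -> bool := fun v => `[< span v >].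

Lemma spanbP v : reflect (span v) (v \in spanb).
Proof. exact: asboolP. Qed.

Lemma span_gen v : S v -> span v.
Proof. by move=> Sv; rewrite -[v]scale1r -[_ *: v]addr0; apply: spanS span0. Qed.

Lemma spanb_submod : submod_closed spanb.
Proof.
split=> [|a u v /spanbP su /spanbP sv]; first exact/spanbP/span0.
apply/spanbP; elim: su => [|b u1 u2 Su1 _ IH]; first by rewrite scaler0 add0r.
by rewrite scalerDr scalerA -addrA; apply: spanS.
Qed.

HB.instance Definition _ := GRing.isSubmodClosed.Build K V spanb spanb_submod.

Record subspan := SubSpan { spval :> V; _ : spval \in spanb }.
HB.instance Definition _ := [isSub for spval].
HB.instance Definition _ := [Choice of subspan by <:].
HB.instance Definition _ := [SubChoice_isSubLmodule of subspan by <:].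

Definition span_zmod := Algebra.ZmodClosed.clone V spanb _.

Definition quotspan := Quotient.quot span_zmod.
HB.instance Definition _ := GRing.Zmodule.on quotspan.

Definition qproj : V -> quotspan := \pi_(Quotient.quot span_zmod)%qT.

Lemma qprojK (x : quotspan) : qproj (repr x) = x.
Proof. exact: reprK. Qed.

Lemma qproj_eq u v : qproj u = qproj v <-> span (u - v).
Proof.
split=> [/eqP|suv].
  by rewrite -[_ == _]Quotient.idealrBE => /spanbP.
by apply/eqP; rewrite -[_ == _]Quotient.idealrBE; apply/spanbP.
Qed.

Lemma qprojD : {morph qproj : u v / u + v}.
Proof. by move=> u v; rewrite /qproj raddfD. Qed.

Definition quotspan_scale (a : K) (x : quotspan) : quotspan :=
  qproj (a *: repr x).

Lemma quotspan_scaleE a v : quotspan_scale a (qproj v) = qproj (a *: v).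
Proof.
apply/qproj_eq/spanbP; rewrite -scalerBr; apply: rpredZ.
by apply/spanbP/qproj_eq; rewrite qprojK.
Qed.

Fact quotspan_scaleA a b v :
  quotspan_scale a (quotspan_scale b v) = quotspan_scale (a * b) v.
Proof. by rewrite -[v]qprojK !quotspan_scaleE scalerA. Qed.

Fact quotspan_scale1 : left_id 1 quotspan_scale.
Proof. by move=> v; rewrite -[v]qprojK quotspan_scaleE scale1r. Qed.

Fact quotspan_scaleDr : right_distributive quotspan_scale +%R.
Proof.
move=> a u v; rewrite -[u]qprojK -[v]qprojK -qprojD !quotspan_scaleE.
by rewrite scalerDr qprojD.
Qed.

Fact quotspan_scaleDl v : {morph quotspan_scale^~ v : a b / a + b}.
Proof.
by move=> a b; rewrite -[v]qprojK !quotspan_scaleE scalerDl qprojD.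
Qed.

HB.instance Definition _ := GRing.Zmodule_isLmodule.Build K quotspan
  quotspan_scaleA quotspan_scale1 quotspan_scaleDr quotspan_scaleDl.

Fact qproj_is_linear : linear qproj.
Proof. by move=> a u v; rewrite qprojD -quotspan_scaleE. Qed.

HB.instance Definition _ := GRing.isLinear.Build K V quotspan _ qproj
  qproj_is_linear.

End Span.

Arguments subspan {K V} S.
Arguments quotspan {K V} S.
Arguments span {K V} S.
Arguments qproj {K V} S.
Arguments SubSpan {K V S}.
Arguments spval {K V S} _.

(* The smallest linear (bilinear) relation containing a prescription r; it is  *)
(* the graph of the linear (bilinear) map extending r whenever there is one.   *)
Section Extension.
Context {K : fieldType} {U V W : lmodType K}.

Inductive lin_ext (r : U -> W -> Prop) : U -> W -> Prop :=
| LinBase u w : r u w -> lin_ext r u w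
| LinComb a u u' w w' : lin_ext r u w -> lin_ext r u' w' ->
    lin_ext r (a *: u + u') (a *: w + w').

Inductive bilin_ext (r : U -> V -> W -> Prop) : U -> V -> W -> Prop :=
| BilinBase u v w : r u v w -> bilin_ext r u v w
| BilinLeft a u u' v w w' : bilin_ext r u v w -> bilin_ext r u' v w' ->
    bilin_ext r (a *: u + u') v (a *: w + w')
| BilinRight a u v v' w w' : bilin_ext r u v w -> bilin_ext r u v' w' ->
    bilin_ext r u (a *: v + v') (a *: w + w').

Fixpoint tens_ext (r : U -> V -> W -> Prop) (s : seq (U * V)) (w : W) : Prop :=
  if s is (u, v) :: s' then
    exists w1 w2, [/\ bilin_ext r u v w1, tens_ext r s' w2 & w = w1 + w2]
  else w = 0.

Definition is_bilinear (f : U -> V -> W) : Prop :=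
  (forall v, linear (f^~ v)) /\ (forall u, linear (f u)).

End Extension.

(* The structure maps are recorded by their graphs, and a tensor in V (x) V by *)
(* a list s of pairs standing for the sum of the v (x) v' over (v, v') in s.   *)
(* A bialgebra morphism of Hopf algebras commutes with the antipodes.          *)
Section Bialgebra.
Variable K : fieldType.

Record bialg (V : lmodType K) := Bialg {
  bmul : V -> V -> V -> Prop;
  bone : V -> Prop;
  bcomul : V -> seq (V * V) -> Prop;
  bcounit : V -> K -> Prop
}.

Definition tmap (V W : Type) (f : V -> W) (s : seq (V * V)) : seq (W * W) :=
  [seq (f p.1, f p.2) | p <- s].

Definition hopf_morph (V W : lmodType K) (BV : bialg V) (BW : bialg W)
    (f : V -> W) : Prop :=
  [/\ linear f,
      forall x y z, bmul BV x y z -> bmul BW (f x) (f y) (f z),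
      forall x, bone BV x -> bone BW (f x),
      forall x s, bcomul BV x s -> bcomul BW (f x) (tmap f s)
    & forall x a, bcounit BV x a -> bcounit BW (f x) a].

Definition hopf_iso (V W : lmodType K) (BV : bialg V) (BW : bialg W)
    (f : V -> W) : Prop :=
  exists g : W -> V,
    [/\ cancel f g, cancel g f, hopf_morph BV BW f & hopf_morph BW BV g].

Definition bialg_sub (V : lmodType K) (B : bialg V) (S : V -> Prop) :
    bialg (subspan S) :=
  {| bmul x y z := bmul B (spval x) (spval y) (spval z);
     bone x := bone B (spval x);
     bcomul x s := bcomul B (spval x) (tmap spval s);
     bcounit x := bcounit B (spval x) |}.

End Bialgebra.

Section Compositions.
Local Open Scope nat_scope.

Definition is_comp (al : seq nat) : bool := all (leq 1) al.

Definition descs (al : seq nat) : seq nat :=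
  take (size al).-1 (scanl addn 0 al).

Fixpoint comps (n : nat) : seq (seq nat) :=
  if n is m.+1 then
    [seq 1 :: al | al <- comps m] ++
    [seq (head 0 al).+1 :: behead al | al <- comps m & al != [::]]
  else [:: [::]].

Lemma mem_comps n al : (al \in comps n) = is_comp al && (sumn al == n).
Proof.
elim: n al => [|n IH] al.
  by rewrite inE; case: al => [|[|a] al] //=; rewrite addSn andbF.
rewrite mem_cat; apply/orP/idP => [[/mapP[be]|/mapP[be]]|].
- by rewrite IH => /andP[cb /eqP <-] -> /=; rewrite cb eqxx.
- rewrite mem_filter IH; case: be => [|[|b] be] //= /andP[cb /eqP <-] -> /=.
  by rewrite cb addSn eqxx.
case: al => [|[|[|a]] al] //= /andP[cal]; rewrite !addSn eqSS => sal.
  by left; apply/mapP; exists al; rewrite // IH; apply/andP.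
right; apply/mapP; exists (a.+1 :: al) => //.
by rewrite mem_filter IH /= cal addSn.
Qed.

Lemma uniq_comps n : uniq (comps n).
Proof.
elim: n => //= n IH; rewrite cat_uniq; apply/and3P; split.
- by rewrite map_inj_uniq // => al be [].
- apply/hasPn => al /mapP[be]; rewrite mem_filter => /andP[nz].
  rewrite mem_comps => /andP[cb _] ->; apply/mapP => -[ga _].
  by case: be nz cb => [|[|b] be].
rewrite map_inj_in_uniq ?filter_uniq // => al be.
rewrite !mem_filter; case: al => // a al _; case: be => // b be _ /=.
by case=> -> ->.
Qed.

(* Subsets of [n - 1] are sets of elements of 'I_n, each standing for itself.  *)
Definition is_peakset n (P : {set 'I_n}) : bool :=
  [forall x in P, (2 <= x) && [forall y in P, y.+1 != x]].

Definition peaks n (al : seq nat) : {set 'I_n} :=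
  [set x : 'I_n | [&& 2 <= x, x.-1 \notin descs al & val x \in descs al]].

End Compositions.

(* Words in the positive integers are the monomials in the H_n, n >= 1.        *)
Section NSym.
Variable K : fieldType.

Definition part := {k : nat | (0 < k)%N}.

Definition nsym : lalgType K := {malg K[{fmonom part}]}.

Definition ncoef (w : {fmonom part}) (x : nsym) : K := monalg.mcoeff w x.

Definition Hn (n : nat) : nsym :=
  if insub n is Some k then << fmu (k : part) >> else 1.

(* The algebra morphism defined on the free algebra by H_n |-> f n, n >= 1.    *)
Definition nsym_lift (A : lalgType K) (f : nat -> A) (x : nsym) : A :=
  \sum_(w <- monalg.msupp x) ncoef w x *: \prod_(k <- (w : seq part)) f (val k).

Fixpoint En_seq (n : nat) : seq nsym :=
  if n is m.+1 then
    rcons (En_seq m)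
      (\sum_(i < m.+1) (-1) ^+ (m + i) *: ((En_seq m)`_i * Hn (m.+1 - i)))
  else [:: 1].

Definition En (n : nat) : nsym := (En_seq n)`_n.

Lemma size_En_seq n : size (En_seq n) = n.+1.
Proof. by elim: n => //= n IH; rewrite size_rcons IH. Qed.

Lemma nth_En_seq m n : (n <= m)%N -> (En_seq m)`_n = En n.
Proof.
elim: m => [|m IH]; first by case: n.
rewrite leq_eqVlt => /predU1P[-> //|lt_nm].
by rewrite /= nth_rcons size_En_seq lt_nm IH.
Qed.

Lemma Hn0 : Hn 0 = 1.
Proof. by rewrite /Hn insubF. Qed.

Lemma En_rec n :
  \sum_(i < n.+1) (-1) ^+ i *: (En i * Hn (n - i)) = (n == 0%N)%:R.
Proof.
case: n => [|n]; first by rewrite big_ord1 /= expr0 scale1r Hn0 mulr1.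
rewrite big_ord_recr /= subnn Hn0 mulr1 {2}/En /= nth_rcons size_En_seq ltnn.
rewrite eqxx scaler_sumr -big_split big1 //= => i _.
rewrite nth_En_seq ?leq_ord // scalerA -exprD addSn exprS mulN1r.
rewrite addnA addnn exprD -mul2n exprM sqrrN !expr1n mul1r scaleNr subrr //.
Qed.

Definition Hprod (be : seq nat) : nsym := \prod_(k <- be) Hn k.

Definition Rn (al : seq nat) : nsym :=
  \sum_(be <- comps (sumn al) | all (mem (descs al)) (descs be))
    (-1) ^+ (size al - size be) *: Hprod be.

Definition Qn (n : nat) : nsym := \sum_(k < n.+1) En k * Hn (n - k).

(* The subalgebra generated by the Q_n is the span of their products.          *)
Definition peak_gen (x : nsym) : Prop :=
  exists s : seq nat, x = \prod_(k <- s) Qn k.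

Definition peak : lmodType K := subspan peak_gen.

Definition Xi n (P : {set 'I_n}) : nsym :=
  \sum_(al <- comps n | peaks n al == P) Rn al.

Lemma theta_subproof (x : nsym) : nsym_lift Qn x \in spanb peak_gen.
Proof.
apply: rpred_sum => w _; apply/rpredZ/spanbP/span_gen.
by exists [seq val k | k <- (w : seq part)]; rewrite big_map.
Qed.

Definition theta (x : nsym) : peak := SubSpan (nsym_lift Qn x) (theta_subproof x).

(* Delta(H_w) for a word w, Delta being multiplicative.                        *)
Definition Hcomul (w : seq nat) : seq (nsym * nsym) :=
  foldr (fun k s => [seq (Hn i * p.1, Hn (k - i) * p.2) | i <- iota 0 k.+1, p <- s])
    [:: (1, 1)] w.

(* The coefficient at u (x) v of the tensor represented by s.                  *)
Definition tcoef (s : seq (nsym * nsym)) (u v : {fmonom part}) : K :=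
  \sum_(p <- s) ncoef u p.1 * ncoef v p.2.

Definition nsym_bialg : bialg nsym :=
  {| bmul x y z := z = x * y;
     bone x := x = 1;
     bcomul x s := forall u v, tcoef s u v =
       \sum_(w <- monalg.msupp x)
          ncoef w x * tcoef (Hcomul [seq val k | k <- (w : seq part)]) u v;
     bcounit x a := a = ncoef mone x |}.

Definition peak_bialg : bialg peak := bialg_sub nsym_bialg peak_gen.

End NSym.

(* A power series of bounded degree in x_1, x_2, ... is given by its           *)
(* truncations, the polynomials obtained by setting x_i = 0 for i > N.         *)
Section QSym.
Variable K : fieldType.

Definition qseries := forall N : nat, {mpoly K[N]}.

HB.instance Definition _ := gen_eqMixin qseries.
HB.instance Definition _ := gen_choiceMixin qseries.

Definition qzero : qseries := fun N => 0.
Definition qone : qseries := fun N => 1.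
Definition qadd (f g : qseries) : qseries := fun N => f N + g N.
Definition qopp (f : qseries) : qseries := fun N => - f N.
Definition qmul (f g : qseries) : qseries := fun N => f N * g N.
Definition qscale (a : K) (f : qseries) : qseries := fun N => a *: f N.

Fact qaddA : associative qadd.
Proof. by move=> f g h; apply: functional_extensionality_dep => N; apply: addrA. Qed.
Fact qaddC : commutative qadd.
Proof. by move=> f g; apply: functional_extensionality_dep => N; apply: addrC. Qed.
Fact qadd0 : left_id qzero qadd.
Proof. by move=> f; apply: functional_extensionality_dep => N; apply: add0r. Qed.
Fact qaddN : left_inverse qzero qopp qadd.
Proof. by move=> f; apply: functional_extensionality_dep => N; apply: addNr. Qed.

HB.instance Definition _ := GRing.isZmodule.Build qseries qaddA qaddC qadd0 qaddN.

Fact qscaleA a b f : qscale a (qscale b f) = qscale (a * b) f.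
Proof. by apply: functional_extensionality_dep => N; apply: scalerA. Qed.
Fact qscale1 : left_id 1 qscale.
Proof. by move=> f; apply: functional_extensionality_dep => N; apply: scale1r. Qed.
Fact qscaleDr : right_distributive qscale +%R.
Proof.
by move=> a f g; apply: functional_extensionality_dep => N; apply: scalerDr.
Qed.
Fact qscaleDl f : {morph qscale^~ f : a b / a + b}.
Proof.
by move=> a b; apply: functional_extensionality_dep => N; apply: scalerDl.
Qed.

HB.instance Definition _ := GRing.Zmodule_isLmodule.Build K qseries
  qscaleA qscale1 qscaleDr qscaleDl.

Definition Fn (al : seq nat) : qseries := fun N =>
  \sum_(t : {ffun 'I_(sumn al) -> 'I_N} |
      [forall j : 'I_(sumn al), forall k : 'I_(sumn al), (val k == j.+1) ==>
         (if j.+1 \in descs al then (t j < t k)%N else (t j <= t k)%N)]%N)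
    \prod_j 'X_(t j).

(* In degree 0 the factor 2 ^ (|P| + 1) is replaced by 1, so that the basis    *)
(* element of the empty composition is the unit of the algebra.                *)
Definition Kn n (P : {set 'I_n}) : qseries :=
  (if n is 0 then 1 else 2 ^+ #|P|.+1 : K) *:
  \sum_(al <- comps n |
      [forall x in P, (val x \in descs al) (+) (val x \in map succn (descs al))])
    Fn al.

Definition peakd_gen (f : qseries) : Prop :=
  exists n (P : {set 'I_n}), is_peakset P /\ f = Kn P.

Definition peakd : lmodType K := subspan peakd_gen.

Definition hn (n : nat) : qseries := fun N =>
  \sum_(m : 'X_{1..N < n.+1} | mdeg m == n) 'X_[m].

(* Modulo z ^ (n + 1), 1 / (1 - x z) is the sum of the x ^ k z ^ k, k <= n.    *)
Definition qn (n : nat) : qseries := fun N =>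
  (\prod_(i < N) ((1 + 'X_i *: 'X) * \sum_(k < n.+1) 'X_i ^+ k *: 'X^k)
     : {poly {mpoly K[N]}})`_n.

Definition forgetful (x : nsym K) : qseries := fun N =>
  nsym_lift (fun n => hn n N) x.

(* The subalgebra generated by the q_n is the span of their products.          *)
Definition omega (f : qseries) : Prop :=
  span (fun g => exists s : seq nat, g = foldr qmul qone (map qn s)) f.

(* The coproduct is f |-> f(x_1, x_2, ..., y_1, y_2, ...).                     *)
Definition qsym_bialg : bialg qseries :=
  {| bmul f g h := h = qmul f g;
     bone f := f = qone;
     bcomul f s := forall N M, f (N + M)%N =
       \sum_(p <- s) (p.1 N \mPo [tuple 'X_(lshift M i) | i < N])
                   * (p.2 M \mPo [tuple 'X_(rshift N i) | i < M]);
     bcounit f a := f 0%N = a%:MP |}.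

Definition peakd_bialg : bialg peakd := bialg_sub qsym_bialg peakd_gen.

End QSym.

(* A superalgebra given by generators and relations; the relations are a       *)
(* condition on families of elements of rings indexed by the generators.       *)
Record salg := SAlg {
  sgen : finType;
  sodd : sgen -> bool;
  srel : forall R : pzRingType, (sgen -> R) -> Prop
}.

Section Algebras.

Definition stens_rel (A B : salg) (R : pzRingType) (x : sgen A + sgen B -> R) :=
  [/\ srel (x \o inl), srel (x \o inr)
    & forall a b, x (inl a) * x (inr b) =
        (-1) ^+ (sodd a && sodd b) * (x (inr b) * x (inl a))].

Definition stens (A B : salg) : salg :=
  {| sgen := (sgen A + sgen B)%type;
     sodd g := match g with inl a => sodd a | inr b => sodd b end;
     srel := @stens_rel A B |}.

(* T i and c i stand for T_{i+1} and c_{i+1}.                                  *)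
Definition hecke_rel n (R : pzRingType) (T : 'I_n.-1 -> R) : Prop :=
  [/\ forall i, T i * T i = - T i,
      forall i j : 'I_n.-1, (i.+1 < j)%N -> T i * T j = T j * T i
    & forall i j : 'I_n.-1, val j = i.+1 -> T i * T j * T i = T j * T i * T j].

Definition clifford_rel n (R : pzRingType) (T : 'I_n.-1 -> R) (c : 'I_n -> R) :=
  [/\ forall j, c j * c j = -1,
      forall i j, i != j -> c i * c j = - (c j * c i),
      forall (i : 'I_n.-1) (j : 'I_n), val j != val i -> val j != i.+1 ->
        T i * c j = c j * T i,
      forall (i : 'I_n.-1) (j k : 'I_n), val j = val i -> val k = i.+1 ->
        T i * c j = c k * T i
    & forall (i : 'I_n.-1) (j k : 'I_n), val j = val i -> val k = i.+1 ->
        (T i + 1) * c k = c j * (T i + 1)].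

Definition hecke (n : nat) : salg :=
  {| sgen := 'I_n.-1; sodd := fun=> false; srel := @hecke_rel n |}.

Definition heckeC (n : nat) : salg :=
  {| sgen := ('I_n.-1 + 'I_n)%type;
     sodd g := match g with inl _ => false | inr _ => true end;
     srel R x := hecke_rel (fun i => x (inl i)) /\
                 clifford_rel (fun i => x (inl i)) (fun j => x (inr j)) |}.

Definition hincl n (i : sgen (hecke n)) : sgen (heckeC n) := inl i.

Fact emb_lproof m k (i : 'I_m.-1) : (i < (m + k).-1)%N.
Proof. by case: m i => [[]|m i] //=; rewrite ltn_addr. Qed.

Fact emb_rproof m k (i : 'I_k.-1) : (m + i < (m + k).-1)%N.
Proof. by case: k i => [[]|k i] //=; rewrite addnS ltn_add2l. Qed.

Definition embT m k (g : 'I_m.-1 + 'I_k.-1) : 'I_(m + k).-1 :=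
  match g with
  | inl i => Ordinal (emb_lproof k i)
  | inr i => Ordinal (emb_rproof m i)
  end.

Record tower := Tower {
  talg : nat -> salg;
  temb : forall m k, sgen (stens (talg m) (talg k)) -> sgen (talg (m + k))
}.

Definition hecke_tower : tower := {| talg := hecke; temb := embT |}.

Definition heckeC_emb m k (g : sgen (stens (heckeC m) (heckeC k))) :
    sgen (heckeC (m + k)) :=
  match g with
  | inl (inl i) => inl (embT (inl i))
  | inl (inr j) => inr (lshift k j)
  | inr (inl i) => inl (embT (inr i))
  | inr (inr j) => inr (rshift m j)
  end.

Definition heckeC_tower : tower := {| talg := heckeC; temb := heckeC_emb |}.

End Algebras.

(* Finitely generated supermodules over a finite dimensional superalgebra, up  *)
(* to isomorphism: K ^ sdim with homogeneous standard basis, acting on columns. *)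
(* Modules over an ordinary algebra are the supermodules that are purely even. *)
Section Modules.
Variable K : fieldType.

Record smod (A : salg) := SMod {
  sdim : nat;
  spar : 'I_sdim -> bool;
  sact : sgen A -> 'M[K]_sdim;
  _ : forall a i j, sact a i j != 0 -> spar i = spar j (+) sodd a;
  _ : srel sact
}.

Arguments spar {A} s.
Arguments sact {A} s.

Section Homs.
Variables (A : salg).
Implicit Types (M N P : smod A).

Definition is_even M : Prop := forall i, spar M i = false.

(* Homomorphisms are all linear maps commuting with the action, not only the   *)
(* even ones, and no sign is put on the odd ones.                              *)
Definition intertw (B : salg) (phi : sgen A -> sgen B) M (N : smod B)
    (f : 'M[K]_(sdim N, sdim M)) : Prop :=
  forall a, f *m sact M a = sact N (phi a) *m f.

Definition evenmap (B : salg) M (N : smod B) (f : 'M[K]_(sdim N, sdim M)) : Prop :=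
  forall i j, f i j != 0 -> spar N i = spar M j.

Definition hom M N (f : 'M[K]_(sdim N, sdim M)) : Prop :=
  @intertw A id M N f.

Definition ehom M N (f : 'M[K]_(sdim N, sdim M)) : Prop :=
  @hom M N f /\ @evenmap A M N f.

Definition homdim M N : nat :=
  \dim (\bigcap_(a : sgen A)
    lker (linfun (fun f : 'M[K]_(sdim N, sdim M) =>
                    f *m sact M a - sact N a *m f)))%VS.

End Homs.

Arguments intertw {A B} phi M N f.
Arguments evenmap {A B} M N f.
Arguments hom {A} M N f.
Arguments ehom {A} M N f.

Definition mxinj m n (f : 'M[K]_(m, n)) : Prop :=
  injective (fun v : 'cV[K]_n => f *m v).
Definition mxsurj m n (f : 'M[K]_(m, n)) : Prop :=
  forall w : 'cV[K]_m, exists v : 'cV[K]_n, w = f *m v.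

Section Classes.
Variable A : salg.
Implicit Types (M N P : smod A).

Definition short_exact M1 M2 M3 (f : 'M[K]_(sdim M2, sdim M1))
    (g : 'M[K]_(sdim M3, sdim M2)) : Prop :=
  [/\ ehom M1 M2 f, ehom M2 M3 g, mxinj f, mxsurj g
    & forall v : 'cV[K]_(sdim M2), g *m v = 0 <-> exists u, v = f *m u].

Definition projective P : Prop :=
  forall M N (p : 'M[K]_(sdim N, sdim M)) (f : 'M[K]_(sdim N, sdim P)),
    ehom M N p -> mxsurj p -> ehom P N f -> exists2 g, ehom P M g & p *m g = f.

Definition proj_cover M P : Prop :=
  projective P /\ exists p : 'M[K]_(sdim M, sdim P), [/\ ehom P M p, mxsurj p
    & forall X (g : 'M[K]_(sdim P, sdim X)), ehom X P g -> mxsurj (p *m g) -> mxsurj g].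

Fact shift_subproof M a i j : sact M a i j != 0 ->
  ~~ spar M i = ~~ spar M j (+) sodd a.
Proof. by case: M i j => d par act grd rel i j /= /grd ->; rewrite addNb. Qed.

Fact sact_rel M : srel (sact M).
Proof. by case: M. Qed.

Definition parity_shift M : smod A :=
  SMod (@shift_subproof M) (sact_rel M).

(* R is the restriction of N along phi : A -> B, up to isomorphism.            *)
Definition restriction (B : salg) (phi : sgen A -> sgen B) (R : smod A)
    (N : smod B) : Prop :=
  exists f : 'M[K]_(sdim N, sdim R),
    [/\ intertw phi R N f, evenmap R N f, mxinj f & mxsurj f].

(* N is B (x)_A M, by the universal property of extension of scalars.          *)
Definition induced (B : salg) (phi : sgen A -> sgen B) M (N : smod B) : Prop :=
  exists j : 'M[K]_(sdim N, sdim M),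
    [/\ intertw phi M N j, evenmap M N j
      & forall (L : smod B) (f : 'M[K]_(sdim L, sdim M)), intertw phi M L f ->
          exists! g : 'M[K]_(sdim L, sdim N), hom N L g /\ g *m j = f].

(* X is the outer tensor product of M and N: phi sends e_i (x) e_j, encoded as *)
(* an elementary matrix, into X, and (a (x) b)(u (x) v) = (-1)^(|b||u|) au (x) bv. *)
Definition outer (B : salg) M (N : smod B) (X : smod (stens A B)) : Prop :=
  exists phi : 'M[K]_(sdim M, sdim N) -> 'cV[K]_(sdim X),
    [/\ linear phi, bijective phi,
        forall a Y, phi (sact M a *m Y) = sact X (inl a) *m phi Y,
        forall b Y,
          phi (diag_mx (\row_i (-1) ^+ (sodd b && spar M i)) *m Y *m (sact N b)^T)
          = sact X (inr b) *m phi Y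
      & forall i j k, phi (delta_mx i j) k 0 != 0 ->
          spar X k = spar M i (+) spar N j].

End Classes.

Definition simple_act n (al : seq nat) (i : 'I_n.-1) : 'M[K]_1 :=
  (if i.+1 \in descs al then -1 else 0)%:M.

Fact simple_grd n al (a : sgen (hecke n)) (i j : 'I_1) :
  simple_act al a i j != 0 -> (fun=> false) i = (fun=> false) j (+) sodd a.
Proof. by []. Qed.

Fact simple_rel n al : hecke_rel (@simple_act n al).
Proof.
rewrite /simple_act; split=> [i|i j _|i j _].
- by case: ifP => _; rewrite -[LHS]scalar_mxM -raddfN ?mulrNN ?mulr1 ?mul0r ?oppr0 ?opprK.
- by case: ifP => _; case: ifP => _; rewrite ?raddf0 ?mul0r ?mulr0.
by case: ifP => _; case: ifP => _; rewrite ?raddf0 ?mul0r ?mulr0 ?mul0r.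
Qed.

Definition simple_mod n (al : seq nat) : smod (hecke n) :=
  SMod (@simple_grd n al) (@simple_rel n al).

End Modules.

Arguments short_exact {K A} M1 M2 M3 f g.

(* The Grothendieck group, with scalars extended to K, of the direct sum over  *)
(* i : I of the categories of modules over A i that belong to the class C.     *)
Section Grothendieck.
Variable K : fieldType.

Definition smod_class := forall A : salg, smod K A -> Prop.

Section Groth.
Variables (I : Type) (A : I -> salg) (C : smod_class).

Record gobj := GObj { gidx : I; gmod : smod K (A gidx); _ : C gmod }.

HB.instance Definition _ := gen_eqMixin gobj.
HB.instance Definition _ := gen_choiceMixin gobj.

Inductive groth_rel : {malg K[gobj]} -> Prop :=
| GrothExact i (M1 M2 M3 : smod K (A i)) (h1 : C M1) (h2 : C M2) (h3 : C M3)
    f g : short_exact M1 M2 M3 f g ->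
    groth_rel (<< GObj h2 >> - (<< GObj h1 >> + << GObj h3 >>))
| GrothShift i (M : smod K (A i)) (h : C M) (h' : C (parity_shift M)) :
    groth_rel (<< GObj h' >> - << GObj h >>).

Definition groth : lmodType K := quotspan groth_rel.

Definition gcls i (M : smod K (A i)) (h : C M) : groth :=
  qproj groth_rel << GObj h >>.

End Groth.

Section TowerBialgebra.
Variables (T : tower) (C : smod_class).

Local Notation A := (talg T).
Local Notation A2 := (fun p : nat * nat => stens (A p.1) (A p.2)).
Local Notation G1 := (groth A C).
Local Notation G2 := (groth A2 C).
Local Notation cls2 m k h := (@gcls (nat * nat) A2 C (m, k) _ h).

Inductive gmul_base : G1 -> G1 -> G1 -> Prop :=
| GMul m k (M : smod K (A m)) (N : smod K (A k)) (X : smod K (stens (A m) (A k)))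
    (L : smod K (A (m + k))) (hM : C M) (hN : C N) (hL : C L) :
    outer M N X -> induced (@temb T m k) X L ->
    gmul_base (gcls hM) (gcls hN) (gcls hL).

Inductive gouter_base : G1 -> G1 -> G2 -> Prop :=
| GOuter m k (M : smod K (A m)) (N : smod K (A k))
    (X : smod K (stens (A m) (A k))) (hM : C M) (hN : C N) (hX : C X) :
    outer M N X -> gouter_base (gcls hM) (gcls hN) (cls2 m k hX).

Inductive gres_part : gobj A C -> nat -> nat -> G2 -> Prop :=
| GResPart m k (M : smod K (A (m + k))) (R : smod K (stens (A m) (A k)))
    (hM : C M) (hR : C R) :
    restriction (@temb T m k) R M -> gres_part (GObj hM) m k (cls2 m k hR).

Inductive gres_base : G1 -> G2 -> Prop :=
| GRes n (M : smod K (A n)) (hM : C M) (y : nat -> G2) :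
    (forall m, (m <= n)%N -> gres_part (GObj hM) m (n - m) (y m)) ->
    gres_base (gcls hM) (\sum_(m < n.+1) y m).

Inductive gcounit_base : G1 -> K^o -> Prop :=
| GCounit n (M : smod K (A n)) (hM : C M) :
    gcounit_base (gcls hM) (if n == 0%N then (sdim M)%:R else 0).

(* The coproduct of x is s when both have the same image in the Grothendieck   *)
(* group of the tensor products A m (x) A k.                                   *)
Definition groth_bialg : bialg G1 :=
  {| bmul := bilin_ext gmul_base;
     bone u := exists (M : smod K (A 0)) (hM : C M), sdim M = 1%N /\ u = gcls hM;
     bcomul x s := exists2 y, lin_ext gres_base x y & tens_ext gouter_base s y;
     bcounit := lin_ext gcounit_base |}.

End TowerBialgebra.

Definition pmod_class : smod_class := fun A M => is_even M /\ projective M.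
Definition smod_all : smod_class := fun A M => True.
Definition spmod_class : smod_class := fun A M => projective M.

Definition K0 : lmodType K := groth hecke pmod_class.
Definition K0s : lmodType K := groth heckeC spmod_class.
Definition G0s : lmodType K := groth heckeC smod_all.

Definition K0_bialg : bialg K0 := groth_bialg hecke_tower pmod_class.
Definition K0s_bialg : bialg K0s := groth_bialg heckeC_tower spmod_class.
Definition G0s_bialg : bialg G0s := groth_bialg heckeC_tower smod_all.

Definition pcls n (P : smod K (hecke n)) (h : pmod_class P) : K0 := gcls h.
Definition spcls n (P : smod K (heckeC n)) (h : spmod_class P) : K0s := gcls h.
Definition scls n (M : smod K (heckeC n)) : G0s := gcls (I : smod_all M).

End Grothendieck.

(* Classes of projective covers and of induced modules do not depend on the    *)
(* chosen representatives, so these properties quantify over all of them.      *)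
Section Maps.
Variable K : fieldType.

Definition is_Chs (Chs : nsym K -> K0 K) : Prop :=
  hopf_iso (nsym_bialg K) (K0_bialg K) Chs /\
  forall al, is_comp al ->
  forall (P : smod K (hecke (sumn al))) (hP : pmod_class P),
    proj_cover (simple_mod K _ al) P -> Chs (Rn K al) = pcls hP.

Definition is_Cht (Cht : G0s K -> peakd K) : Prop :=
  hopf_iso (G0s_bialg K) (peakd_bialg K) Cht /\
  forall al, is_comp al ->
  forall M : smod K (heckeC (sumn al)),
    induced (@hincl _) (simple_mod K _ al) M ->
    spval (Cht (scls M)) = Kn K (peaks (sumn al) al).

Definition is_hom_pairing (b : K0s K -> G0s K -> K^o) : Prop :=
  [/\ is_bilinear b,
      forall n (P M : smod K (heckeC n)) (hP : spmod_class P),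
        b (spcls hP) (scls M) = (homdim P M)%:R
    & forall n m (P : smod K (heckeC n)) (hP : spmod_class P)
        (M : smod K (heckeC m)), n <> m -> b (spcls hP) (scls M) = 0].

Definition is_peak_pairing (b : peak K -> peakd K -> K^o) : Prop :=
  [/\ is_bilinear b,
      forall n (P Q : {set 'I_n}) x y, is_peakset P -> is_peakset Q ->
        spval x = Xi K P -> spval y = Kn K Q -> b x y = (P == Q)%:R
    & forall n m (P : {set 'I_n}) (Q : {set 'I_m}) x y,
        n <> m -> is_peakset P -> is_peakset Q ->
        spval x = Xi K P -> spval y = Kn K Q -> b x y = 0].

Definition is_Chts (bP : peak K -> peakd K -> K^o) (bG : K0s K -> G0s K -> K^o)
    (Cht : G0s K -> peakd K) (Chts : peak K -> K0s K) : Prop :=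
  hopf_iso (peak_bialg K) (K0s_bialg K) Chts /\
  forall x n (M : smod K (heckeC n)), bP x (Cht (scls M)) = bG (Chts x) (scls M).

Definition is_Ind (Ind : K0 K -> K0s K) : Prop :=
  forall n (P : smod K (hecke n)) (hP : pmod_class P)
    (N : smod K (heckeC n)) (hN : spmod_class N),
    induced (@hincl n) P N -> Ind (pcls hP) = spcls hN.

Definition is_Cartan (chi : K0s K -> G0s K) : Prop :=
  forall n (P : smod K (heckeC n)) (hP : spmod_class P),
    chi (spcls hP) = scls P.

End Maps.

(* Main.v *)
(* Ind, theta, chi and the forgetful map are multiplicative, so both squares can
   be checked on generators.  As Ch^* H_n = [S_(n)], the first square reduces to
   Ch~^*(Q_n) = [S~_(n)], which the perfect pairing detects: Q_n = 2 Xi_0, every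
   K_P is the characteristic of some S~_al with P(al) = P, and Hom(S~_(n), S~_al)
   is the space of the T-invariant vectors of S~_al, which vanishes as soon as al
   has a peak and has dimension 2 for al = (n).  The second square then reduces to
   K_0 = q_n.  Compatibility of Ind and chi with the coproduct is not checked on
   modules: it is read off from the squares, the other sides of which are explicit
   maps of Hopf algebras. *)

From HB Require Import structures.
Require Import Defs.
From mathcomp Require Import all_boot all_algebra.
From mathcomp Require Import boolp.
From mathcomp Require Import finmap monalg ring zify.
Import GRing.Theory.

Set Implicit Arguments.
Unset Strict Implicit.
Unset Printing Implicit Defensive.
Local Open Scope ring_scope.

(** * Monoid algebras and their tensor products *)

(** The work lies in the multiplicativity of Ind. The universal property of induction settles
    transitivity, but it neither provides an induced module nor shows that induction respects outer
    products; hence an explicit model, the sums of c_J (x) v_J over subsets J, on which the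
    relations are checked by hand. In it a tensor of two induced modules is visibly induced from the
    tensor, the Koszul sign being the parity of J because the 0-Hecke modules in question are purely
    even. The generators are accessible because S_(n) is its own projective cover: the T_i + 1 are
    idempotents satisfying the braid relations. The dimension 2 comes from the invariant vectors 1
    and c_1, the 2 in Q_n = 2 Xi_0 from E_k H_(n-k) being the sum of two neighbouring hook ribbons,
    so that each hook occurs twice. As for K_0 = q_n, twice the sum of all F_al weighs a weakly
    increasing sequence by 2 to the number of its distinct values, and so does the product of the (1
    + x_i z) / (1 - x_i z). *)

Section MonoidAlgebra.
Variable K : fieldType.

Section LinearExtension.
Variables (G : choiceType) (V : lmodType K).
Implicit Types (h : G -> V) (x : {malg K[G]}).

Definition mlin h x : V := \sum_(k <- msupp x) mcoeff k x *: h k.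

Lemma mlinEw h x (d : {fset G}) : (msupp x `<=` d)%fset ->
  mlin h x = \sum_(k <- d) mcoeff k x *: h k.
Proof.
move=> le; rewrite /mlin (big_fset_incl _ le) //= => k _ /mcoeff_outdom ->.
by rewrite scale0r.
Qed.

Lemma mlin_linear h : linear (mlin h).
Proof.
move=> a x y; pose d := (msupp x `|` msupp y)%fset.
rewrite (@mlinEw _ _ d); last first.
  by apply: fsubset_trans (msuppD_le _ _) _; apply/fsetSU/msuppZ_le.
rewrite (@mlinEw _ x d) ?fsubsetUl // (@mlinEw _ y d) ?fsubsetUr //.
rewrite scaler_sumr -big_split; apply: eq_bigr => k _ /=.
by rewrite mcoeffD mcoeffZ scalerDl scalerA.
Qed.

HB.instance Definition _ h :=
  GRing.isLinear.Build K {malg K[G]} V _ (mlin h) (mlin_linear h).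

Lemma mlinU h k : mlin h << k >> = h k.
Proof. by rewrite /mlin msuppU oner_eq0 big_seq_fset1 mcoeffUU scale1r. Qed.

End LinearExtension.

Lemma malg_scale1U (G : choiceType) (a : K) (k : G) :
  << a *g k >> = a *: << k >> :> {malg K[G]}.
Proof. by apply/malgP => l; rewrite mcoeffZ !mcoeffU mulr_natr. Qed.

Lemma mlin_uniq (G : choiceType) (V : lmodType K) (f : {malg K[G]} -> V) :
  linear f -> f =1 mlin (fun k => f << k >>).
Proof.
move=> lf; pose F : {linear {malg K[G]} -> V} :=
  HB.pack f (GRing.isLinear.Build _ _ _ _ f lf).
move=> x; rewrite -[f]/(F : _ -> _) {1}[x]monalgE linear_sum; apply: eq_bigr.
by move=> k _; rewrite malg_scale1U linearZ.
Qed.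

Lemma malg_linear_ext (G : choiceType) (V : lmodType K) (f g : {malg K[G]} -> V) :
  linear f -> linear g -> (forall k, f << k >> = g << k >>) -> f =1 g.
Proof.
by move=> lf lg fg x; rewrite (mlin_uniq lf) (mlin_uniq lg); apply: eq_bigr => k _; rewrite fg.
Qed.

Section Product.
Variable G : monomType.
Implicit Types x y : {malg K[G]}.

Lemma malg_mulUU (k l : G) : << k >> * << l >> = << mmul k l >> :> {malg K[G]}.
Proof. by rewrite malgM_def fgmulUU mulr1. Qed.

(** An [lalgType] ties scaling to left factors only; K being commutative, the coefficients give the
    right factors too. *)
Lemma malg_scaleAr (a : K) x y : a *: (x * y) = x * (a *: y).
Proof.
apply/malgP => k; rewrite mcoeffZ (mcoeffMlw k (fsubset_refl _) (msuppZ_le a y)).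
rewrite mcoeffMl mulr_sumr; apply: eq_bigr => u _; rewrite mulr_sumr.
by apply: eq_bigr => v _; rewrite mcoeffZ mulrnAr mulrCA.
Qed.

Variable A : lalgType K.
Hypothesis scaleAr : forall (a : K) (x y : A), a *: (x * y) = x * (a *: y).

Lemma malg_bilinear_mul (f : {malg K[G]} -> A) : linear f ->
  (forall k l, f << mmul k l >> = f << k >> * f << l >>) ->
  {morph f : x y / x * y}.
Proof.
move=> lf fM x y; pose F : {linear {malg K[G]} -> A} :=
  HB.pack f (GRing.isLinear.Build _ _ _ _ f lf).
rewrite -[f]/(F : _ -> _).
apply: (@malg_linear_ext _ A (fun x => F (x * y)) (fun x => F x * F y)) => [||k].
- by move=> a u v; rewrite mulrDl -scalerAl linearP.
- by move=> a u v; rewrite linearP mulrDl -scalerAl.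
apply: (@malg_linear_ext _ A (fun y => F (<< k >> * y)) (fun y => F << k >> * F y)) => [||l].
- by move=> a u v; rewrite mulrDr -malg_scaleAr linearP.
- by move=> a u v; rewrite linearP mulrDr -scaleAr.
by rewrite malg_mulUU; apply: fM.
Qed.

End Product.

Section Tensor.
Variables G H : monomType.

(** The tensor product of two monoid algebras is taken to be the algebra of the product monoid:
    equality of tensors becomes equality of coefficients, the form in which [nsym_bialg] states its
    coproduct. *)
Definition pone : G * H := (mone, mone).
Definition pmul (x y : G * H) : G * H := (mmul x.1 y.1, mmul x.2 y.2).
Fact pmulA : associative pmul.
Proof. by move=> x y z; rewrite /pmul /= !mulmA. Qed.
Fact pmul1 : left_id pone pmul.
Proof. by case=> x y; rewrite /pmul /= !mul1m. Qed.
Fact pmul1r : right_id pone pmul.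
Proof. by case=> x y; rewrite /pmul /= !mulm1. Qed.
Fact punit x y : pmul x y = pone -> x = pone /\ y = pone.
Proof. by case: x y => [a b] [c d] [/unitm[-> ->] /unitm[-> ->]]. Qed.

HB.instance Definition _ := Choice_isMonomialDef.Build (G * H)%type
  pmulA pmul1 pmul1r punit.

Definition tens (x : {malg K[G]}) (y : {malg K[H]}) : {malg K[(G * H)%type]} :=
  mlin (fun u => mlin (fun v => << (u, v) >>) y) x.

Lemma tens_linl y : linear (tens^~ y).
Proof. exact: mlin_linear. Qed.

Lemma tens_linr x : linear (tens x).
Proof.
move=> a y z; rewrite /tens /mlin scaler_sumr -big_split; apply: eq_bigr => u _ /=.
by rewrite -/(mlin _ (a *: y + z)) linearP scalerDr !scalerA mulrC.
Qed.

Lemma tensUU u v : tens << u >> << v >> = << (u, v) >>.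
Proof. by rewrite /tens !mlinU. Qed.

Lemma mcoeff_tens x y u v :
  mcoeff (u, v) (tens x y) = mcoeff u x * mcoeff v y.
Proof.
pose c (G : choiceType) (k : G) (z : {malg K[G]}) : K^o := mcoeff k z.
have lc (G' : choiceType) (k : G') : linear (c G' k).
  by move=> a z t; rewrite /c mcoeffD mcoeffZ.
apply: (@malg_linear_ext _ K^o (fun x => c _ (u, v) (tens x y))
   (fun x => c _ u x * c _ v y)) => [||k].
- by move=> a z t; rewrite tens_linl lc.
- by move=> a z t; rewrite lc mulrDl -scalerAl.
apply: (@malg_linear_ext _ K^o (fun y => c _ (u, v) (tens << k >> y))
   (fun y => c _ u << k >> * c _ v y)) => [||l].
- by move=> a z t; rewrite tens_linr lc.
- by move=> a z t; rewrite lc mulrDr -scalerAr.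
by rewrite /c tensUU !mcoeffU xpair_eqE -natrM mulnb.
Qed.

Lemma tens_mul x y x' y' : tens x y * tens x' y' = tens (x * x') (y * y').
Proof.
apply: (@malg_linear_ext _ _ (fun x => tens x y * tens x' y')
   (fun x => tens (x * x') (y * y'))) => [||k].
- by move=> a z t; rewrite tens_linl mulrDl -scalerAl.
- by move=> a z t; rewrite mulrDl -scalerAl tens_linl.
apply: (@malg_linear_ext _ _ (fun y => tens << k >> y * tens x' y')
   (fun y => tens (<< k >> * x') (y * y'))) => [||l].
- by move=> a z t; rewrite tens_linr mulrDl -scalerAl.
- by move=> a z t; rewrite mulrDl -scalerAl tens_linr.
apply: (@malg_linear_ext _ _ (fun x' => tens << k >> << l >> * tens x' y')
   (fun x' => tens (<< k >> * x') (<< l >> * y'))) => [||k'].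
- by move=> a z t; rewrite tens_linl mulrDr -malg_scaleAr.
- by move=> a z t; rewrite mulrDr -malg_scaleAr tens_linl.
apply: (@malg_linear_ext _ _ (fun y' => tens << k >> << l >> * tens << k' >> y')
   (fun y' => tens (<< k >> * << k' >>) (<< l >> * y'))) => [||l'].
- by move=> a z t; rewrite tens_linr mulrDr -malg_scaleAr.
- by move=> a z t; rewrite mulrDr -malg_scaleAr tens_linr.
by rewrite !tensUU !malg_mulUU tensUU.
Qed.

Lemma tens_mull x x' y : tens x y * tens x' 1 = tens (x * x') y.
Proof. by rewrite tens_mul mulr1. Qed.

Lemma tens_mulr x y y' : tens x y * tens 1 y' = tens x (y * y').
Proof. by rewrite tens_mul mulr1. Qed.

Lemma tens_mul1 x y : tens 1 y * tens x 1 = tens x y.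
Proof. by rewrite tens_mul mulr1 mul1r. Qed.

Lemma tens_mul2 x y : tens x 1 * tens 1 y = tens x y.
Proof. by rewrite tens_mul mulr1 mul1r. Qed.

Lemma tens11 : tens 1 1 = 1.
Proof. exact: tensUU. Qed.

End Tensor.
Section TensorMap.
Variables (G H G' H' : monomType).
Variables (f : {malg K[G]} -> {malg K[G']}) (g : {malg K[H]} -> {malg K[H']}).
Hypotheses (lf : linear f) (lg : linear g).

Definition tensmap : {malg K[(G * H)%type]} -> {malg K[(G' * H')%type]} :=
  mlin (fun uv => tens (f << uv.1 >>) (g << uv.2 >>)).

Lemma tensmap_linear : linear tensmap. Proof. exact: mlin_linear. Qed.

Lemma tensmap_tens x y : tensmap (tens x y) = tens (f x) (g y).
Proof.
apply: (@malg_linear_ext _ _ (fun x => tensmap (tens x y)) (fun x => tens (f x) (g y)))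
  => [||k].
- by move=> a u v; rewrite tens_linl tensmap_linear.
- by move=> a u v; rewrite lf tens_linl.
apply: (@malg_linear_ext _ _ (fun y => tensmap (tens << k >> y))
   (fun y => tens (f << k >>) (g y))) => [||l].
- by move=> a u v; rewrite tens_linr tensmap_linear.
- by move=> a u v; rewrite lg tens_linr.
by rewrite tensUU /tensmap mlinU.
Qed.

Hypotheses (fM : {morph f : x y / x * y}) (gM : {morph g : x y / x * y}).

Lemma tensmapM : {morph tensmap : x y / x * y}.
Proof.
apply: (malg_bilinear_mul _ tensmap_linear) => [|[k l] [k' l']].
  exact: malg_scaleAr.
have ->: << mmul (k, l) (k', l') >> = tens (<< k >> * << k' >>) (<< l >> * << l' >>)
    :> {malg K[(G * H)%type]} by rewrite !malg_mulUU tensUU.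
by rewrite tensmap_tens fM gM /tensmap !mlinU tens_mul.
Qed.

End TensorMap.
End MonoidAlgebra.

(** * The coproduct of NSym and the map theta *)

Section Convolution.
Variable R : nzRingType.
Implicit Types a b c : nat -> R.

(** Sequences stand for power series in a central variable z over a ring that need not be
    commutative: [conv] is their product, [delta0] the series 1, and [alt] substitutes -z for z. *)
Definition conv a b n : R := \sum_(i < n.+1) a i * b (n - i)%N.
Definition delta0 n : R := (n == 0%N)%:R.
Definition alt a n : R := (-1) ^+ n * a n.

(** Low coefficients only see truncations, which lets associativity be borrowed from [{poly R}]. *)
Lemma conv_poly a b m n : (n < m)%N ->
  conv a b n = ((\poly_(i < m) a i) * (\poly_(i < m) b i))`_n.
Proof.
move=> lt_nm; rewrite coefM; apply: eq_bigr => i _.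
have le_im : (i < m)%N by apply: leq_trans lt_nm; rewrite ltnS leq_ord.
by rewrite !coef_poly le_im (leq_ltn_trans (leq_subr _ _) lt_nm).
Qed.

Lemma convA a b c : conv a (conv b c) = conv (conv a b) c.
Proof.
apply: funext => n; pose p (a : nat -> R) := \poly_(i < n.+1) a i.
have pE d d' m : (m < n.+1)%N -> conv d d' m = (p d * p d')`_m by exact: conv_poly.
transitivity ((p a * (p b * p c))`_n).
  rewrite coefM; apply: eq_bigr => i _; rewrite coef_poly ltn_ord -pE //.
  by rewrite ltnS leq_subr.
rewrite mulrA coefM; apply: eq_bigr => i _.
by rewrite -pE // coef_poly ltnS leq_subr.
Qed.

Lemma conv_comm a b : (forall i j, a i * b j = b j * a i) -> conv a b = conv b a.
Proof.
move=> ab; apply: funext => n; rewrite /conv (reindex_inj rev_ord_inj) /=.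
by apply: eq_bigr => i _; rewrite subSS subKn ?leq_ord.
Qed.

Lemma conv_swap a b c d : (forall i j, b i * c j = c j * b i) ->
  conv (conv a b) (conv c d) = conv (conv a c) (conv b d).
Proof. by move=> bc; rewrite -!convA [conv b _]convA (conv_comm bc) -convA. Qed.

Lemma conv_delta0l a : conv delta0 a = a.
Proof.
apply: funext => n; rewrite /conv big_ord_recl big1 ?addr0 ?mul1r ?subn0 //= => i _.
by rewrite mul0r.
Qed.

Lemma conv0 a b : conv a b 0 = a 0%N * b 0%N.
Proof. by rewrite /conv big_ord1. Qed.

Lemma alt_conv a b : alt (conv a b) = conv (alt a) (alt b).
Proof.
apply: funext => n; rewrite /alt /conv mulr_sumr; apply: eq_bigr => i _.
have xs m (x : R) : (-1) ^+ m * x = x * (-1) ^+ m by rewrite -signr_odd; case: (odd m); rewrite !(expr0, expr1, mul1r, mulr1, mulN1r, mulrN1).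
by rewrite -[RHS]mulrA [a i * (_ * _) in RHS]mulrA -xs !mulrA -exprD subnKC ?leq_ord.
Qed.

Lemma altK : involutive alt.
Proof.
by move=> a; apply: funext => n; rewrite /alt mulrA -exprD addnn -signr_odd odd_double mul1r.
Qed.

(** A series with constant term 1 cancels on the right: the last summand of coefficient n isolates a
    n, and strong induction removes the others. *)
Lemma conv_inv_uniq a a' b : b 0%N = 1 -> conv a b = conv a' b -> a = a'.
Proof.
move=> b0 ab; apply: funext => n; elim/ltn_ind: n => n IH.
have /(congr1 (fun f => f n)) := ab; rewrite /conv !big_ord_recr /= subnn b0 !mulr1.
by under eq_bigr => i _ do rewrite IH //; move/addrI.
Qed.

End Convolution.

Section ConvMorphism.
Variables (A B : nzRingType) (f : A -> B).
Hypotheses (fB : {morph f : x y / x - y}) (f1 : f 1 = 1) (fM : {morph f : x y / x * y}).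

Let F : {rmorphism A -> B} := HB.pack f (GRing.isAdditive.Build A B f fB)
   (GRing.isMultiplicative.Build A B f (conj fM f1)).

Lemma morph_conv (a b : nat -> A) : f \o conv a b = conv (f \o a) (f \o b).
Proof.
by apply: funext => n /=; rewrite -[f]/(F : _ -> _) rmorph_sum; apply: eq_bigr => i _; rewrite rmorphM.
Qed.

Lemma morph_alt (a : nat -> A) : f \o alt a = alt (f \o a).
Proof. by apply: funext => n /=; rewrite -[f]/(F : _ -> _) rmorphMsign. Qed.

Lemma morph_delta0 : f \o delta0 A = delta0 B.
Proof. by apply: funext => n /=; rewrite -[f]/(F : _ -> _) rmorph_nat. Qed.

(** Since E(-z) H(z) = 1 determines E, the image of E under a ring morphism is known once a left
    inverse of the image of H is. *)
Lemma morph_inv (e h : nat -> A) (e' : nat -> B) : h 0%N = 1 ->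
  conv (alt e) h = delta0 A -> conv (alt e') (f \o h) = delta0 B -> f \o e = e'.
Proof.
move=> h0 eh e'h; rewrite -[e']altK -[e]altK morph_alt; congr alt.
apply: (@conv_inv_uniq _ _ _ (f \o h)); first by rewrite /= h0.
by rewrite -morph_conv eh morph_delta0.
Qed.

End ConvMorphism.

(* [l] and [r] play the parts of x |-> x (x) 1 and x |-> 1 (x) x: the series of the
   H_n is group-like, hence so are its inverse and the series of the Q_n. *)
Section DividedPowers.
Variables (A B : nzRingType) (l r d : A -> B).
Hypotheses (lB : {morph l : x y / x - y}) (l1 : l 1 = 1) (lM : {morph l : x y / x * y}).
Hypotheses (rB : {morph r : x y / x - y}) (r1 : r 1 = 1) (rM : {morph r : x y / x * y}).
Hypotheses (dB : {morph d : x y / x - y}) (d1 : d 1 = 1) (dM : {morph d : x y / x * y}).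
Hypothesis rl : forall x y, r x * l y = l y * r x.
Variables (e h : nat -> A).
Hypotheses (h0 : h 0%N = 1) (eh : conv (alt e) h = delta0 A).
Hypothesis dh : d \o h = conv (l \o h) (r \o h).

Lemma divided_inv : d \o e = conv (l \o e) (r \o e).
Proof.
apply: (morph_inv dB d1 dM h0 eh); rewrite dh alt_conv -(morph_alt lB l1 lM).
(* The images of l and r commute, so the product regroups into l(E(-z) H(z)) times r(E(-z) H(z)),
   that is 1. *)
rewrite -(morph_alt rB r1 rM) conv_swap => [|i j]; last exact: rl.
rewrite -(morph_conv lB l1 lM) -(morph_conv rB r1 rM) eh.
by rewrite (morph_delta0 lB l1 lM) (morph_delta0 rB r1 rM) conv_delta0l.
Qed.

Lemma divided_conv : d \o conv e h = conv (l \o conv e h) (r \o conv e h).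
Proof.
rewrite (morph_conv dB d1 dM) divided_inv dh conv_swap => [|i j]; last exact: rl.
by rewrite (morph_conv lB l1 lM) (morph_conv rB r1 rM).
Qed.

End DividedPowers.

Section NSymMorphisms.
Variable K : fieldType.
Local Notation nsym := (nsym K).
Local Notation Hn := (Hn K).
Local Notation En := (En K).
Local Notation Qn := (Qn K).

Lemma nsym_word (w : {fmonom part}) :
  << w >> = \prod_(k <- (w : seq part)) Hn (val k) :> nsym.
Proof.
case: w => s; elim: s => [|k s IH] /=.
  by rewrite big_nil; congr << _ >>; apply/eqP; rewrite fmP fm1.
rewrite big_cons /= -IH /Defs.Hn valK malg_mulUU; congr << _ >>.
by apply/eqP; rewrite fmP fmM /= fmU.
Qed.

Section Lift.
Variable A : lalgType K.
Implicit Types (f : nat -> A) (x y : nsym).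

Lemma nsym_lift_linear f : linear (nsym_lift f).
Proof. exact: mlin_linear. Qed.

Lemma nsym_liftU f (w : {fmonom part}) :
  nsym_lift f << w >> = \prod_(k <- (w : seq part)) f (val k).
Proof. exact: mlinU. Qed.

Lemma nsym_lift1 f : nsym_lift f 1 = 1.
Proof. by rewrite nsym_liftU fm1 big_nil. Qed.

Lemma nsym_lift_H f n : f 0%N = 1 -> nsym_lift f (Hn n) = f n.
Proof.
move=> f0; rewrite /Defs.Hn; case: insubP => [k _ kn|].
  by rewrite nsym_liftU fmU big_seq1 kn.
by rewrite -eqn0Ngt => /eqP->; rewrite nsym_lift1 f0.
Qed.

Hypothesis scaleAr : forall (a : K) (x y : A), a *: (x * y) = x * (a *: y).

Lemma nsym_liftM f : {morph nsym_lift f : x y / x * y}.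
Proof.
apply: malg_bilinear_mul => //; first exact: nsym_lift_linear.
by move=> k l; rewrite 3!nsym_liftU fmM big_cat.
Qed.

Lemma nsym_lift_uniq (f : nsym -> A) : linear f -> f 1 = 1 ->
  {morph f : x y / x * y} -> f =1 nsym_lift (fun n => f (Hn n)).
Proof.
move=> lf f1 fM; apply: malg_linear_ext => // [|w].
  exact: nsym_lift_linear.
by rewrite nsym_liftU nsym_word (big_morph f fM f1).
Qed.

(** Freeness of NSym, in the form through which multiplicative maps on it are compared. Degree 0 is
    left out because H_0 is the unit. *)
Lemma nsym_morph_ext (f g : nsym -> A) : linear f -> linear g ->
  f 1 = 1 -> g 1 = 1 -> {morph f : x y / x * y} -> {morph g : x y / x * y} ->
  (forall n, (0 < n)%N -> f (Hn n) = g (Hn n)) -> f =1 g.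
Proof.
move=> lf lg f1 g1 fM gM fg x; rewrite (nsym_lift_uniq lf f1 fM).
rewrite (nsym_lift_uniq lg g1 gM); congr nsym_lift; apply: funext => -[|n].
  by rewrite Hn0 f1 g1.
exact: fg.
Qed.

End Lift.

Lemma conv_EH : conv (alt En) Hn = delta0 nsym.
Proof.
apply: funext => n; rewrite /delta0 -En_rec; apply: eq_bigr => i _.
rewrite /alt -mulrA -signr_odd -[in RHS]signr_odd.
by case: (odd i); rewrite ?expr1 ?expr0 ?mul1r ?scale1r // scaleN1r mulN1r.
Qed.

Lemma QnE : Qn = conv En Hn.
Proof. by []. Qed.

Lemma En0 : En 0 = 1.
Proof. by []. Qed.

Lemma Qn0 : Qn 0 = 1.
Proof. by rewrite QnE conv0 Hn0 En0 mulr1. Qed.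

Section Coproduct.
Local Notation nsym2 := {malg K[({fmonom part} * {fmonom part})%type]}.
Implicit Types a b : nat -> nsym.

Definition tensl a n : nsym2 := tens (a n) 1.
Definition tensr a n : nsym2 := tens 1 (a n).

Definition Delta : nsym -> nsym2 := nsym_lift (conv (tensl Hn) (tensr Hn)).

Lemma conv_tens a b n :
  conv (tensl a) (tensr b) n = \sum_(i < n.+1) tens (a i) (b (n - i)%N).
Proof. by rewrite /conv /tensl /tensr; under eq_bigr do rewrite tens_mul2. Qed.

Lemma Delta_linear : linear Delta.
Proof. exact: nsym_lift_linear. Qed.

Lemma Delta_sub x y : Delta (x - y) = Delta x - Delta y.
Proof. by rewrite addrC -scaleN1r Delta_linear scaleN1r addrC. Qed.

Lemma DeltaM : {morph Delta : x y / x * y}.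
Proof. by apply: nsym_liftM; apply: malg_scaleAr. Qed.

Lemma Delta1 : Delta 1 = 1.
Proof. exact: nsym_lift1. Qed.

Lemma Delta_H : Delta \o Hn = conv (tensl Hn) (tensr Hn).
Proof.
apply: funext => n; apply: nsym_lift_H.
by rewrite conv_tens big_ord1 Hn0 tens11.
Qed.

Lemma Delta_Q : Delta \o Qn = conv (tensl Qn) (tensr Qn).
Proof.
have tlB : {morph (fun x : nsym => tens x 1 : nsym2) : x y / x - y}.
  by move=> x y; rewrite addrC -scaleN1r tens_linl scaleN1r addrC.
have trB : {morph (fun x : nsym => tens 1 x : nsym2) : x y / x - y}.
  by move=> x y; rewrite addrC -scaleN1r tens_linr scaleN1r addrC.
apply: (divided_conv tlB _ _ trB _ _ Delta_sub Delta1 DeltaM _ (Hn0 K) conv_EH Delta_H).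
- exact: tens11.
- by move=> x y; exact: esym (tens_mull _ _ _).
- exact: tens11.
- by move=> x y; exact: esym (tens_mulr _ _ _).
by move=> x y; exact: etrans (tens_mul1 _ _) (esym (tens_mul2 _ _)).
Qed.

Definition tsum (s : seq (nsym * nsym)) : nsym2 := \sum_(p <- s) tens p.1 p.2.

Lemma tcoefE s u v : tcoef s u v = mcoeff (u, v) (tsum s).
Proof. by rewrite raddf_sum; apply: eq_bigr => p _ /=; rewrite mcoeff_tens. Qed.

Lemma tsum_Hcomul (w : seq nat) :
  tsum (Hcomul K w) = \prod_(k <- w) conv (tensl Hn) (tensr Hn) k.
Proof.
elim: w => [|k w IH]; first by rewrite big_nil /tsum big_seq1 tens11.
have ->: Hcomul K (k :: w) =
    [seq (Hn i * p.1, Hn (k - i)%N * p.2) | i <- iota 0 k.+1, p <- Hcomul K w] by [].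
rewrite big_cons -IH /tsum big_allpairs_dep conv_tens mulr_suml.
rewrite -[iota 0 k.+1]/(index_iota 0 k.+1) big_mkord; apply: eq_bigr => i _.
by rewrite mulr_sumr; apply: eq_bigr => p _; rewrite tens_mul.
Qed.

(** Pairs of words form a basis of the tensor square, so the coefficientwise condition is one
    equation in the algebra of pairs, free of the list chosen to represent the tensor. *)
Lemma nsym_bcomulE x s : bcomul (nsym_bialg K) x s <-> tsum s = Delta x.
Proof.
have DE u v : mcoeff (u, v) (Delta x) = \sum_(w <- msupp x)
    ncoef w x * tcoef (Hcomul K [seq val k | k <- (w : seq part)]) u v.
  rewrite raddf_sum; apply: eq_bigr => w _ /=.
  by rewrite mcoeffZ tcoefE tsum_Hcomul big_map.
split=> [xs|sx u v]; last by rewrite tcoefE sx DE.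
by apply/malgP => -[u v]; rewrite -tcoefE xs DE.
Qed.

(** Both (f (x) f) o Delta and Delta o f are algebra morphisms on a free algebra, so the generators
    decide. *)
Lemma Delta_natural (f : nsym -> nsym) : linear f -> f 1 = 1 ->
  {morph f : x y / x * y} ->
  (forall n, Delta (f (Hn n)) = \sum_(i < n.+1) tens (f (Hn i)) (f (Hn (n - i)%N))) ->
  forall x s, tsum s = Delta x -> tsum (tmap f s) = Delta (f x).
Proof.
move=> lf f1 fM fH x s sx.
pose ff : {linear nsym2 -> nsym2} :=
  HB.pack (tensmap f f) (GRing.isLinear.Build _ _ _ _ (tensmap f f) (tensmap_linear f f)).
have ->: tsum (tmap f s) = ff (tsum s).
  rewrite linear_sum /tsum big_map; apply: eq_bigr => p _.
  exact: esym (tensmap_tens lf lf _ _).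
rewrite sx.
apply: (@nsym_morph_ext nsym2 (fun x => tensmap f f (Delta x)) (fun x => Delta (f x))).
- by move=> a y z; rewrite Delta_linear tensmap_linear.
- by move=> a y z; rewrite lf Delta_linear.
- rewrite Delta1 -[X in tensmap f f X](tens11 K).
  by rewrite (tensmap_tens lf lf) f1; exact: tens11.
- by rewrite f1 Delta1.
- by move=> y z; rewrite DeltaM (tensmapM lf lf fM fM).
- by move=> y z; rewrite fM DeltaM.
move=> n _; have /(congr1 (fun g => g n)) /= -> := Delta_H.
rewrite fH conv_tens -[tensmap f f]/(ff : _ -> _) linear_sum; apply: eq_bigr => i _.
exact: tensmap_tens.
Qed.

End Coproduct.

Lemma theta_H n : nsym_lift Qn (Hn n) = Qn n.
Proof. by apply: nsym_lift_H; apply: Qn0. Qed.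

Lemma counitM : {morph @ncoef K mone : x y / x * y}.
Proof. by move=> x y; rewrite /ncoef rmorphM. Qed.

Lemma counit_H n : ncoef mone (Hn n) = (n == 0%N)%:R.
Proof.
rewrite /Defs.Hn; case: insubP => [k k_gt0 kn|]; last first.
  by rewrite -eqn0Ngt => /eqP->; rewrite /ncoef mcoeff1 eqxx.
rewrite /ncoef mcoeffU1 fm1_eq1; case: n k_gt0 {kn} => //.
Qed.

(** The counit sends the series H(z) to 1, hence its inverse E(-z), then E(z) and finally Q(z) =
    E(z) H(z). *)
Lemma counit_Q n : ncoef mone (Qn n) = (n == 0%N)%:R.
Proof.
pose eps : nsym -> K := ncoef mone.
have epsB x y : eps (x - y) = eps x - eps y by rewrite /eps /ncoef raddfB.
have eps1 : eps 1 = 1 by rewrite /eps /ncoef mcoeff1 eqxx.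
have epsH : eps \o Hn = delta0 K by apply: funext => m; apply: counit_H.
have epsE : eps \o En = delta0 K.
  apply: (morph_inv epsB eps1 counitM (Hn0 K) conv_EH); rewrite epsH -[RHS]conv_delta0l; congr conv.
  by apply: funext => -[|m]; rewrite /alt /delta0 ?mulr0 ?mul1r.
have /(congr1 (fun f => f n)) := morph_conv epsB eps1 counitM En Hn.
by rewrite epsE epsH conv_delta0l.
Qed.

(** The structure maps of [peak_bialg] are those of NSym read through [spval], so [theta] is handled
    as the endomorphism H_n |-> Q_n of NSym. *)
Theorem theta_hopf : hopf_morph (nsym_bialg K) (peak_bialg K) (@theta K).
Proof.
have lift_lin := @nsym_lift_linear nsym Qn.
have lift1 := @nsym_lift1 nsym Qn.
have liftM : {morph nsym_lift Qn : x y / x * y}.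
  by apply: nsym_liftM; apply: malg_scaleAr.
split=> [a x y|x y z ->|x ->|x s|x a ->].
- exact/val_inj/lift_lin.
- exact: liftM.
- exact: lift1.
- move=> /nsym_bcomulE xs; apply/nsym_bcomulE.
  have ->: tmap spval (tmap (@theta K) s) = tmap (nsym_lift Qn) s.
    by rewrite /tmap -map_comp.
  apply: (Delta_natural lift_lin lift1 liftM) xs => n.
  rewrite theta_H; have /(congr1 (fun g => g n)) /= -> := Delta_Q.
  by rewrite conv_tens; apply: eq_bigr => i _; rewrite 2!theta_H.
have lmc : linear (@ncoef K mone : nsym -> K^o).
  by move=> b y z; rewrite /ncoef mcoeffD mcoeffZ.
have mc1 : ncoef mone (1 : nsym) = 1 by rewrite /ncoef mcoeff1 eqxx.
apply: (@nsym_morph_ext K^o (@ncoef K mone) (fun x => ncoef mone (nsym_lift Qn x))) => //.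
- by move=> b y z; rewrite lift_lin lmc.
- by rewrite lift1.
- exact: counitM.
- by move=> y z; rewrite liftM counitM.
by move=> n _; rewrite theta_H counit_H counit_Q.
Qed.

End NSymMorphisms.

(** * Ribbons and the peak basis *)

Section DescentBits.
Local Open Scope nat_scope.
Implicit Types b : bitseq.

(** A composition of n + 1 is encoded by n bits telling which of 1, ..., n are descents. The order
    of the list follows that of [comps], so that [comps_bits] is an equality of lists. *)
Fixpoint bits n : seq bitseq :=
  if n is m.+1 then map (cons true) (bits m) ++ map (cons false) (bits m) else [:: [::]].

(* The composition whose first part is at least [m], with [nth false b i] telling
   whether [m + i] is a descent. *)
Fixpoint bitcomp m b : seq nat :=
  match b with
  | [::] => [:: m]
  | true :: b' => m :: bitcomp 1 b'
  | false :: b' => bitcomp m.+1 b'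
  end.

Lemma mem_bits n b : (b \in bits n) = (size b == n).
Proof.
elim: n b => [|n IH] [|c b] //.
  rewrite mem_cat; apply/norP; split; by apply/mapP => -[].
rewrite mem_cat eqSS -IH; apply/orP/idP => [[]/mapP[b' b'n [_ ->]] //|bn].
by case: c; [left|right]; apply: map_f.
Qed.

Lemma size_bits n b : b \in bits n -> size b = n.
Proof. by rewrite mem_bits => /eqP. Qed.

Lemma bitcompS m b :
  bitcomp m.+1 b = (head 0 (bitcomp m b)).+1 :: behead (bitcomp m b).
Proof. by elim: b m => [|[] b IH] m //=; rewrite IH. Qed.

Lemma bitcomp_nil m b : (bitcomp m b == [::]) = false.
Proof. by elim: b m => [|[] b IH] m //=. Qed.

Lemma comps_bits n : comps n.+1 = map (bitcomp 1) (bits n).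
Proof.
elim: n => // n IH; rewrite [LHS]/= -/(comps n.+1) IH map_cat -!map_comp; congr (_ ++ _).
rewrite (@eq_in_filter _ _ predT) ?filter_predT -?map_comp; last first.
  by move=> _ /mapP[b _ ->]; rewrite bitcomp_nil.
by apply: eq_map => b; exact: esym (bitcompS 1 b).
Qed.

Lemma size_bitcomp m b : size (bitcomp m b) = (count id b).+1.
Proof. by elim: b m => [|[] b IH] m //=; rewrite IH. Qed.

Lemma sumn_bitcomp m b : sumn (bitcomp m b) = m + size b.
Proof. by elim: b m => [|[] b IH] m //=; rewrite IH ?addnS ?add1n. Qed.

Lemma bitcomp_is_comp b : is_comp (bitcomp 1 b).
Proof.
suff: forall m, 0 < m -> is_comp (bitcomp m b) by exact.
elim: b => [|[] b IH] m m_gt0 /=; [by rewrite m_gt0| |exact: IH].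
by rewrite m_gt0 IH.
Qed.

Lemma mem_descs_bitcomp b x : (x \in descs (bitcomp 1 b)) = (0 < x) && nth false b x.-1.
Proof.
(* Generalised to a partial sum s already reached and a first part m: the first possible descent is
   then s + m. *)
suff H s m : (x \in take (size (bitcomp m b)).-1 (scanl addn s (bitcomp m b)))
    = (s + m <= x) && nth false b (x - (s + m)).
  by rewrite /descs H add0n subn1.
elim: b s m => [|[] b IH] s m; first by rewrite /= nth_nil andbF.
  have ->: take (size (bitcomp m (true :: b))).-1 (scanl addn s (bitcomp m (true :: b)))
    = s + m :: take (size (bitcomp 1 b)).-1 (scanl addn (s + m) (bitcomp 1 b)).
    by rewrite /= size_bitcomp.
  rewrite inE IH addn1; case: (ltngtP x (s + m)) => [lt|lt|->] //=; last by rewrite subnn.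
  by rewrite -[x in RHS](@subnKC (s + m).+1 x) // addSnnS addKn.
rewrite [bitcomp _ _]/= IH addnS; case: (ltngtP x (s + m)) => [lt|lt|->] //=.
  by rewrite -[x in RHS](@subnKC (s + m).+1 x) // addSnnS addKn.
by rewrite subnn.
Qed.

(** Positions count from 1 and bits from 0, whence the shifts; beyond the end of b the default
    [false] means no descent. *)
Definition peakbit b x := [&& 1 < x, nth false b x.-1 & ~~ nth false b x.-2].

Lemma mem_peaks n b (x : 'I_n) : (x \in peaks n (bitcomp 1 b)) = peakbit b x.
Proof.
rewrite inE !mem_descs_bitcomp /peakbit; case: x => [[|[|x]] ltx] //=.
by rewrite andbC.
Qed.

Lemma peaks_peakset n al : is_peakset (peaks n al).
Proof.
apply/forall_inP => x; rewrite inE => /and3P[x2 xd xd']; rewrite x2 /=.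
apply/forall_inP => y; rewrite inE => /and3P[_ _ yd].
by apply: contraNneq xd => <-.
Qed.

(** The composition with descent set P itself has peak set P, because P contains neither 1 nor two
    consecutive elements. *)
Lemma peakset_peaks n (P : {set 'I_n.+1}) : is_peakset P ->
  exists2 b, size b = n & peaks n.+1 (bitcomp 1 b) = P.
Proof.
move=> /forall_inP pP; exists (mkseq (fun i => inord i.+1 \in P) n); first by rewrite size_mkseq.
apply/setP => -[x ltx]; rewrite mem_peaks /peakbit /=.
have inx y (lty : y < n.+1) : inord y = Ordinal lty :> 'I_n.+1.
  by apply: val_inj; rewrite /= inordK.
apply/and3P/idP => [[]|xP].
  by case: x ltx => [|[|x]] // ltx _; rewrite nth_mkseq //= inx.
have /andP[x2 nxt] := pP _ xP; case: x ltx xP x2 nxt => [|[|x]] //= ltx xP _ /forall_inP nxt.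
split=> //; first by rewrite nth_mkseq // inx.
have ltx' := ltn_trans (ltnSn _) ltx.
by rewrite nth_mkseq // inx; apply/negP => /nxt /eqP[].
Qed.

Lemma big_bits_cat (A : nmodType) m n (F : bitseq -> A) :
  (\sum_(b <- bits (m + n)) F b = \sum_(b <- bits m) \sum_(b' <- bits n) F (b ++ b'))%R.
Proof.
elim: m F => [|m IH] F; first by rewrite big_seq1.
by rewrite /= !big_cat !big_map !IH.
Qed.

(** Every set bit but the first follows a set bit, so the bits read 1...10...0: these are the hooks
    (1^k, n + 1 - k). *)
Definition peakfree b := sorted (fun x y : bool => y ==> x) b.

Lemma big_peakfree (A : nmodType) n (F : bitseq -> A) :
  (\sum_(b <- bits n | peakfree b) F b =
     \sum_(k < n.+1) F (nseq k true ++ nseq (n - k) false))%R.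
Proof.
elim: n F => [|n IH] F; first by rewrite big_cons /= big_nil addr0 big_ord1.
rewrite /= big_cat !big_map /= big_ord_recl addrC; congr (_ + _)%R; last first.
  rewrite (eq_bigl (fun b => peakfree b)); last by case=> [|c b] //=; rewrite implybT.
  by rewrite IH; apply: eq_bigr => i _.
rewrite subn0; elim: n {IH} F => [|n IH] F; first by rewrite big_cons /= big_nil addr0.
by rewrite /= big_cat !big_map /= big_pred0_eq add0r (IH (fun b => F (false :: b))).
Qed.

Lemma peakfreeP b : reflect (forall x, ~~ peakbit b x) (peakfree b).
Proof.
apply: (iffP (sortedP false)) => [sb [|[|x]] //|pb x ltx].
  rewrite /peakbit /=; case: (ltnP x.+1 (size b)) => [/sb|le]; last by rewrite nth_default.
  by rewrite -negb_imply negbK.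
by have := pb x.+2; rewrite /peakbit /= -negb_imply negbK.
Qed.

Lemma all2_implbP b' b : size b' = size b ->
  reflect (forall i, nth false b' i -> nth false b i) (all2 implb b' b).
Proof.
elim: b' b => [|c' b' IH] [|c b] //=; first by move=> _; left=> i; rewrite nth_nil.
case=> /IH{}IH; apply: (iffP andP) => [[/implyP cc /IH sub] [|i] //=|sub]; first exact: sub.
split; first exact/implyP/(sub 0%N).
by apply/IH => i; apply: (sub i.+1).
Qed.

Lemma big_all2_implb (A : nmodType) c b (F : bitseq -> A) :
  (\sum_(b' <- bits (size (c :: b)) | all2 implb b' (c :: b)) F b' =
    (if c then \sum_(b' <- bits (size b) | all2 implb b' b) F (true :: b') else 0) +
    \sum_(b' <- bits (size b) | all2 implb b' b) F (false :: b'))%R.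
Proof. by rewrite /= big_cat !big_map /=; case: c => //; rewrite big_pred0_eq. Qed.

Lemma big_comps_descs (A : nmodType) b (F : seq nat -> A) :
  (\sum_(be <- comps (size b).+1 | all (mem (descs (bitcomp 1 b))) (descs be)) F be =
    \sum_(b' <- bits (size b) | all2 implb b' b) F (bitcomp 1 b'))%R.
Proof.
rewrite comps_bits big_map big_seq_cond [RHS]big_seq_cond; apply: eq_bigl => b'.
rewrite mem_bits; apply: andb_id2l => /eqP sb; apply/allP/(all2_implbP sb) => [sub i bi|sub x].
  have := sub i.+1; rewrite mem_descs_bitcomp => /(_ bi).
  by rewrite inE mem_descs_bitcomp.
by rewrite inE !mem_descs_bitcomp => /andP[-> /sub].
Qed.

End DescentBits.

Section Ribbon.
Variable K : fieldType.
Local Notation nsym := (nsym K).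
Local Notation Hn := (Hn K).
Local Notation En := (En K).
Local Notation Qn := (Qn K).
Implicit Types b : bitseq.

Lemma opp_sign_scale (V : lmodType K) n (v : V) : - ((-1) ^+ n *: v) = (-1) ^+ n.+1 *: v.
Proof. by rewrite exprS mulN1r scaleNr. Qed.

(** The ribbon element of [bitcomp m b]. A first descent is removed by solving the product rule for
    H_m times a ribbon, which yields the concatenation plus the shape where m is merged with the
    next part. *)
Fixpoint ribbon m b : nsym :=
  match b with
  | [::] => Hn m
  | true :: b' => Hn m * ribbon 1 b' - ribbon m.+1 b'
  | false :: b' => ribbon m.+1 b'
  end.

(** The product rule for ribbons: concatenation or near-concatenation, according to the bit at the
    junction. *)
Lemma ribbonM m b b' :
  ribbon m b * ribbon 1 b' = ribbon m (b ++ true :: b') + ribbon m (b ++ false :: b').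
Proof.
elim: b m => [|[] b IH] m /=; [by rewrite subrK| |exact: IH].
by rewrite mulrBl -mulrA !IH mulrDr opprD addrACA.
Qed.

Lemma ribbon_sum m b : ribbon m b = \sum_(b' <- bits (size b) | all2 implb b' b)
  (-1) ^+ (count id b - count id b') *: Hprod K (bitcomp m b').
Proof.
elim: b m => [|c b IH] m.
  by rewrite big_cons /= big_nil addr0 scale1r /Hprod big_seq1.
rewrite big_all2_implb; case: c; last by rewrite add0r; exact: IH.
rewrite [ribbon _ _]/= !IH mulr_sumr -sumrN; congr (_ + _).
  by apply: eq_bigr => b' _; rewrite [count _ _]/= [count _ (true :: b')]/= subnDl /Hprod big_cons -malg_scaleAr.
apply: eq_bigr => b' le; rewrite [LHS]opp_sign_scale.
(* The exponent is a truncated subtraction, exact because b' lies below b bit by bit. *)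
suff: (count id b' <= count id b)%N by move/subSn => <-.
by elim: b' b le {IH} => [|[] b' IH] [|[] b] //= /IH; rewrite ?leq_add2l ?add1n ?add0n // => /leqW.
Qed.

Lemma Rn_bitcomp b : Rn K (bitcomp 1 b) = ribbon 1 b.
Proof.
rewrite ribbon_sum /Rn sumn_bitcomp big_comps_descs; apply: eq_bigr => b' _.
by rewrite !size_bitcomp subSS.
Qed.

Lemma ribbon_nseq_false m n : ribbon m (nseq n false) = Hn (m + n)%N.
Proof. by elim: n m => [|n IH] m /=; rewrite ?addn0 // IH addSnnS. Qed.

(** Here w (k + 1) is the hook ribbon (1^k, n + 1 - k). The product of R_(1^k) and H_(n+1-k) is the
    sum of two consecutive hooks, and the null values w 0 and w (n + 2) make this uniform at both
    ends. Alternating sums of these products telescope; plain sums count each hook twice. *)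
Lemma ribbon_hook_rec n : exists w : nat -> nsym,
  [/\ w 0%N = 0, w n.+2 = 0,
      forall k, (k <= n)%N -> w k.+1 = ribbon 1 (nseq k true ++ nseq (n - k) false)
    & forall k, (k <= n.+1)%N ->
        (if k is k'.+1 then ribbon 1 (nseq k' true) else 1) * Hn (n.+1 - k) = w k.+1 + w k].
Proof.
pose w k := if k is k'.+1 then
   if (k' <= n)%N then ribbon 1 (nseq k' true ++ nseq (n - k') false) else 0 else 0.
exists w; split=> [//||k lekn|k]; rewrite /w ?ltnn ?lekn //.
case: k => [|k] lekn; first by rewrite mul1r subn0 addr0 subn0 ribbon_nseq_false.
rewrite subSS; move: (lekn); rewrite ltnS => ->; move: lekn; rewrite leq_eqVlt => /predU1P[[->]|].
  by rewrite subnn Hn0 mulr1 ltnn add0r cats0.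
rewrite ltnS => ltkn; rewrite ltkn -[Hn _]/(Hn (n - k)%N).
have ->: Hn (n - k)%N = ribbon 1 (nseq (n - k.+1) false).
  by rewrite ribbon_nseq_false add1n subnSK.
rewrite ribbonM; congr (ribbon 1 _ + ribbon 1 _).
  by rewrite -[nseq k.+1 _]/(nseq (1 + k) true) addnC nseqD -catA.
by rewrite -(subnSK ltkn).
Qed.

(** E_k = R_(1^k): with these elements the alternating sum against the H_n telescopes to 0 in
    positive degree, and left inverses of the series H are unique. *)
Lemma En_ribbon : En = fun k => if k is k'.+1 then ribbon 1 (nseq k' true) else 1.
Proof.
set e := fun k => _; apply: (inv_inj (@altK _)); apply: (conv_inv_uniq (Hn0 K)).
transitivity (delta0 nsym); [exact: conv_EH|apply: funext => -[|n]].
  by rewrite conv0 /alt expr0 mul1r mul1r Hn0.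
have [w [w0 wn _ ew]] := ribbon_hook_rec n.
rewrite /conv (eq_bigr (fun i : 'I_n.+2 => (-1) ^+ i * (w i.+1 + w i))); last first.
  by move=> i _; rewrite /alt -mulrA ew ?leq_ord.
have tel m : \sum_(i < m) (-1) ^+ i * (w i.+1 + w i) = - ((-1) ^+ m * w m).
  elim: m => [|m IH]; first by rewrite big_ord0 w0 mulr0 oppr0.
  by rewrite big_ord_recr /= IH mulrDr exprS mulN1r mulNr opprK addrC addrK.
by rewrite tel wn mulr0 oppr0.
Qed.

(** The factor 2 is the number of products E_k H_(n+1-k) in which a given hook occurs. *)
Lemma Qn_ribbon n : Qn n.+1 = 2 *: \sum_(b <- bits n | peakfree b) ribbon 1 b.
Proof.
have [w [w0 wn wr ew]] := ribbon_hook_rec n.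
rewrite QnE /conv En_ribbon (eq_bigr (fun i : 'I_n.+2 => w i.+1 + w i)); last first.
  by move=> i _; rewrite ew ?leq_ord.
rewrite big_split /= big_ord_recr [X in _ + X]big_ord_recl /= wn w0 addr0 add0r.
rewrite big_peakfree scaler_nat mulr2n.
by congr (_ + _); apply: eq_bigr => i _; rewrite wr ?leq_ord.
Qed.

End Ribbon.

(** * Sums over the compositions with a given peak set *)

Section PeakClasses.
Local Open Scope nat_scope.
Implicit Types b : bitseq.

Definition bitpeaks n b : {set 'I_n.+1} := peaks n.+1 (bitcomp 1 b).

Lemma mem_bitpeaks n b (x : 'I_n.+1) : (x \in bitpeaks n b) = peakbit b x.
Proof. exact: mem_peaks. Qed.

(** Meant for the peak sets of b c b', where b has length m and peak set P and b' is peakfree: the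
    junction can create peaks at m + 1 and m + 2 only, and these two are left free. *)
Definition peak_extends m n (P : {set 'I_m.+1}) (D : {set 'I_(m + n.+1).+1}) :=
  [forall x : 'I_m.+1, (inord x \in D) == (x \in P)] && [forall x in D, x <= m.+2].

Lemma peakbit_catl b b' x : x <= size b -> peakbit (b ++ b') x = peakbit b x.
Proof.
case: x => [|[|x]] // ltx; rewrite /peakbit /=.
by rewrite !nth_cat ltx (ltn_trans _ ltx).
Qed.

(** The bound on y keeps both compared bits inside b'; at y = 1 one of them is the junction c. *)
Lemma peakbit_catr b c b' y : 1 < y -> peakbit (b ++ c :: b') ((size b).+1 + y) = peakbit b' y.
Proof.
have E i : nth false (b ++ c :: b') ((size b).+1 + i) = nth false b' i.
  by rewrite -cat_rcons -(size_rcons b c) nth_cat ltnNge leq_addr addKn.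
case: y => [|[|y]] // _; rewrite /peakbit.
have -> : ((size b).+1 + y.+2).-1 = (size b).+1 + y.+1 by rewrite !addnS.
have -> : ((size b).+1 + y.+1).-1 = (size b).+1 + y by rewrite !addnS.
by rewrite !E addSn !addnS.
Qed.

Lemma peakbit_size b x : peakbit b x -> x <= size b.
Proof.
case: x => [|[|x]] // /and3P[_ bx _]; rewrite ltnNge; apply/negP => le.
by rewrite /= nth_default in bx.
Qed.

Lemma peak_extends_bits m n (P : {set 'I_m.+1}) b c b' :
  size b = m -> size b' = n ->
  peak_extends P (bitpeaks (m + n.+1) (b ++ c :: b')) = (bitpeaks m b == P) && peakfree b'.
Proof.
move=> sb sb'; congr (_ && _).
  have E (x : 'I_m.+1) :
      (inord x \in bitpeaks (m + n.+1) (b ++ c :: b')) = (x \in bitpeaks m b).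
    rewrite !mem_bitpeaks inordK; last by rewrite (leq_trans (ltn_ord x)) // ltnS leq_addr.
    by rewrite peakbit_catl // sb -ltnS.
  apply/forallP/eqP => [eqD|<- x]; last by rewrite E.
  by apply/setP => x; rewrite -E; apply/eqP/eqD.
apply/forall_inP/(peakfreeP _) => [le y|pf x]; last first.
  rewrite mem_bitpeaks leqNgt => px; apply/negP => ltx.
  have := pf (x - m.+1); rewrite -(peakbit_catr b c) ?sb; last by rewrite ltn_subRL addn1.
  by rewrite subnKC ?px // (leq_trans _ ltx) // ltnW.
apply/negP => py; have y1 : 1 < y by case/andP: py.
have yn := peakbit_size py; rewrite sb' in yn.
have lty : m.+1 + y < (m + n.+1).+1 by rewrite addSn ltnS -addnS leq_add2l.
have := le (inord (m.+1 + y)); rewrite mem_bitpeaks inordK // -{1}sb peakbit_catr //.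
by move=> /(_ py); rewrite -[X in _ <= X]addn1 leq_add2l leqNgt y1.
Qed.

Lemma bitpeaks_eq0 n b : size b = n -> (bitpeaks n b == set0) = peakfree b.
Proof.
move=> sb; apply/eqP/(peakfreeP _) => [/setP p0 x|pf].
  apply/negP => px; have := peakbit_size px; rewrite sb -ltnS => ltx.
  by have := p0 (Ordinal ltx); rewrite mem_bitpeaks /= px inE.
by apply/setP => x; rewrite mem_bitpeaks inE; apply/negbTE.
Qed.

Section ClassSum.
Variables (A : nmodType) (r : bitseq -> A).

Definition class_sum n (P : {set 'I_n.+1}) : A :=
  (\sum_(b <- bits n | bitpeaks n b == P) r b)%R.

Lemma class_sum0 n :
  (\sum_(b <- bits n | peakfree b) r b = class_sum (set0 : {set 'I_n.+1}))%R.
Proof.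
rewrite /class_sum big_seq_cond [RHS]big_seq_cond; apply: eq_bigl => b.
by apply: andb_id2l => /size_bits /bitpeaks_eq0 ->.
Qed.

Lemma sum_classes n (c : pred {set 'I_n.+1}) :
  (\sum_(b <- bits n | c (bitpeaks n b)) r b =
     \sum_(P : {set 'I_n.+1} | c P && is_peakset P) class_sum P)%R.
Proof.
rewrite (partition_big (bitpeaks n) (fun P => c P && is_peakset P)) /=; last first.
  by move=> b ->; apply: peaks_peakset.
apply: eq_bigr => P /andP[cP _]; apply: eq_bigl => b.
by case: eqP => [->|]; rewrite ?cP // andbF.
Qed.

(** The condition on d involves its peak set only, so the left side is a sum of whole classes, while
    the right side is what multiplying a class by the hooks produces. *)
Lemma sum_extends m n (P : {set 'I_m.+1}) :
  (\sum_(d <- bits (m + n.+1) | peak_extends P (bitpeaks (m + n.+1) d)) r d =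
   \sum_(b <- bits m | bitpeaks m b == P) \sum_(b' <- bits n | peakfree b')
     (r (b ++ true :: b') + r (b ++ false :: b')))%R.
Proof.
rewrite big_mkcond big_bits_cat [RHS]big_mkcond /=.
rewrite big_seq [RHS]big_seq; apply: eq_bigr => b /size_bits sb.
rewrite big_cat !big_map /= -big_split /=.
rewrite big_seq (eq_bigr (fun b' => if (bitpeaks m b == P) && peakfree b'
    then r (b ++ true :: b') + r (b ++ false :: b') else 0)%R) => [|b' /size_bits sb'].
  rewrite -big_seq; case: (bitpeaks m b == P) => /=; first by rewrite -big_mkcond.
  by rewrite big1.
by rewrite !peak_extends_bits //; case: ifP; rewrite ?addr0.
Qed.

End ClassSum.
End PeakClasses.

(** * The peak algebra is spanned by the Xi_P *)

Section PeakBasis.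
Variable K : fieldType.
Hypothesis char2 : 2 != 0 :> K.
Local Notation nsym := (nsym K).
Local Notation Qn := (Qn K).
Local Notation ribbon := (@ribbon K 1).

Lemma XiS n (P : {set 'I_n.+1}) : Xi K P = class_sum ribbon P.
Proof. by rewrite /Xi comps_bits big_map; apply: eq_bigr => b _; rewrite Rn_bitcomp. Qed.

Lemma Xi0 (P : {set 'I_0}) : Xi K P = 1.
Proof.
rewrite /Xi big_cons /= big_nil addr0; have -> : peaks 0 [::] == P.
  by apply/eqP/setP => -[].
rewrite /Rn /= big_cons /= big_nil addr0 /Hprod big_nil scale1r //.
Qed.

Lemma Qn_Xi n : Qn n.+1 = 2 *: Xi K (set0 : {set 'I_n.+1}).
Proof.
by rewrite Qn_ribbon XiS class_sum0. Qed.

(** Each product of a ribbon in the class P with a hook gives both values of the junction bit, and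
    [sum_extends] says that these shapes fill entire peak classes. *)
Lemma Xi_mul_Qn m n (P : {set 'I_m.+1}) : Xi K P * Qn n.+1 =
  2 *: \sum_(D : {set 'I_(m + n.+1).+1} | peak_extends P D && is_peakset D) Xi K D.
Proof.
rewrite (eq_bigr (fun D => class_sum ribbon D)) => [|D _]; last exact: XiS.
rewrite -sum_classes sum_extends XiS Qn_ribbon -malg_scaleAr /class_sum mulr_suml.
congr (_ *: _); apply: eq_bigr => b _; rewrite mulr_sumr; apply: eq_bigr => b' _.
exact: ribbonM.
Qed.

Lemma peak_gen_Qn n : Qn n \in spanb (@peak_gen K).
Proof. by apply/spanbP/span_gen; exists [:: n]; rewrite big_seq1. Qed.

Lemma peak_mul_Qn x n : x \in spanb (@peak_gen K) -> x * Qn n \in spanb (@peak_gen K).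
Proof.
move=> /spanbP; elim=> [|a v w [s ->] _ IH]; first by rewrite mul0r rpred0.
rewrite mulrDl -scalerAl; apply: rpredD => //; apply: rpredZ.
by apply/spanbP/span_gen; exists (rcons s n); rewrite -cats1 big_cat big_seq1.
Qed.

(* Induction on the largest peak p: by [Xi_mul_Qn], the product of Xi_(P minus p) with
   some Q_k is 2 Xi_P plus terms with all peaks before p. *)
Lemma Xi_peak n (P : {set 'I_n}) : is_peakset P -> Xi K P \in spanb (@peak_gen K).
Proof.
suff H p N (D : {set 'I_N}) : is_peakset D -> (forall x : 'I_N, x \in D -> (x < p)%N) ->
  Xi K D \in spanb (@peak_gen K) by move=> pP; apply: (H n) => // x _.
elim: p N D => {n P} [|p IH] N D pD ltD.
  have -> : D = set0 by apply/setP => x; rewrite inE; apply/negP => /ltD.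
  case: N {D pD ltD} => [|N]; first by rewrite Xi0 -(Qn0 K) peak_gen_Qn.
  by rewrite -[Xi _ _](scalerK char2) -Qn_Xi rpredZ ?peak_gen_Qn.
case: (pickP (fun x : 'I_N => (x \in D) && (p <= x)%N)) => [x0|noP]; last first.
  apply: IH => // x xD; have := noP x; rewrite xD /=.
  by rewrite leqNgt => /negbFE.
case/andP=> x0D; rewrite leq_eqVlt; have := ltD _ x0D; rewrite ltnS leqNgt => /negbTE -> /=.
rewrite orbF => /eqP x0p; have /forall_inP pD' := pD.
have /andP[p2 nxt] := pD' _ x0D; rewrite -x0p in p2.
case: p p2 {x0p} (esym x0p) IH ltD => [|[|m]] // _ x0p IH ltD.
have defN : N = (m + (N - m.+2).+1).+1.
  by rewrite addnS -!addSn subnKC // -x0p ltnW.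
move: (N - m.+2)%N defN => n' defN; subst N.
(* The largest peak is m + 2 and peaks are never adjacent, so m + 1 is not in D, and cutting D at m
   removes exactly its largest element. *)
pose P : {set 'I_m.+1} := [set x : 'I_m.+1 | inord x \in D].
have ltord (x : 'I_m.+1) : (x < (m + n'.+1).+1)%N.
  by rewrite (leq_trans (ltn_ord x)) // ltnS leq_addr.
have pP : is_peakset P.
  apply/forall_inP => x; rewrite inE => xD; have /andP[x2 /forall_inP nx] := pD' _ xD.
  rewrite inordK // in x2 nx; rewrite x2; apply/forall_inP => y; rewrite inE => /nx.
  by rewrite inordK.
have XP : Xi K P \in spanb (@peak_gen K).
  by apply: IH => // x _; apply: ltnW; rewrite ltnS.
have ext : peak_extends P D.
  apply/andP; split; first by apply/forallP => x; rewrite inE.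
  by apply/forall_inP => x /ltD; rewrite ltnS.
have := Xi_mul_Qn n' P; rewrite (bigD1 D) /= ?ext // => /(canLR (scalerK char2))/esym.
move/(canRL (addrK _)) => ->; apply: rpredB.
  by rewrite rpredZ // peak_mul_Qn.
(* Any other extension D1 of P satisfies the smaller bound: if m + 2 belonged to it, m + 1 would
   not, and D1 would agree with D everywhere. *)
apply: rpred_sum => D1 /andP[/andP[/andP[/forallP eqD lt] pD1] neq].
apply: IH => // x xD'; have := forall_inP lt _ xD'; rewrite leq_eqVlt => /predU1P[xm|//].
case/eqP: neq; apply/setP => y.
case: (leqP y m) => [leym|ltmy].
  have /eqP := eqD (Ordinal (leym : y < m.+1)%N); rewrite inE.
  have -> : inord (Ordinal (leym : y < m.+1)%N) = y :> 'I_(m + n'.+1).+1.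
    by apply: val_inj; rewrite /= inordK.
  by [].
have /andP[_ /forall_inP nxt'] := forall_inP pD1 _ xD'.
move: ltmy; rewrite leq_eqVlt => /predU1P[ym|].
  transitivity false; first by apply/negP => /nxt' /eqP[]; rewrite -ym xm.
  by apply/esym/negP => /(forall_inP nxt) /eqP[]; rewrite -ym x0p.
rewrite leq_eqVlt => /predU1P[ym|lty].
  have -> : y = x by apply: val_inj; rewrite /= xm ym.
  by rewrite xD'; have -> : x = x0 by apply: val_inj; rewrite /= xm x0p.
transitivity false; first by apply/negP => /(forall_inP lt); rewrite leqNgt lty.
by apply/esym/negP => /ltD; rewrite ltnS leqNgt lty.
Qed.

(** The converse of [Xi_peak]: the span of the Xi_P contains 1 and is stable under right
    multiplication by every Q_n. *)
Lemma peak_Xi (x : nsym) : Defs.span (@peak_gen K) x ->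
  Defs.span (fun z => exists n (P : {set 'I_n}), is_peakset P /\ z = Xi K P) x.
Proof.
set X := fun z => _.
have XX n (P : {set 'I_n}) : is_peakset P -> Xi K P \in spanb X.
  by move=> pP; apply/spanbP/span_gen; exists n, P.
have XQ z n : z \in spanb X -> z * Qn n \in spanb X.
  case: n => [|n]; first by rewrite Qn0 mulr1.
  move=> /spanbP; elim=> [|a v w [m [P [pP ->]]] _ IH]; first by rewrite mul0r rpred0.
  rewrite mulrDl -scalerAl; apply: rpredD => //; apply: rpredZ.
  case: m P pP => [|m] P pP.
    rewrite Xi0 mul1r Qn_Xi; apply: rpredZ; apply: XX.
    by apply/forall_inP => y; rewrite inE.
  rewrite Xi_mul_Qn; apply: rpredZ; apply: rpred_sum => D /andP[_ pD]; exact: XX.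
have X1 : 1 \in spanb X.
  rewrite -(Xi0 (set0 : {set 'I_0})); apply: XX.
  by apply/forall_inP => y; rewrite inE.
have XQs s : \prod_(k <- s) Qn k \in spanb X.
  elim/last_ind: s => [|s k IH]; first by rewrite big_nil.
  by rewrite -cats1 big_cat big_seq1; apply: XQ.
move=> sx; apply/spanbP; elim: sx => [|a v w [s ->] _ IH]; first exact: rpred0.
by apply: rpredD => //; apply: rpredZ.
Qed.

End PeakBasis.

(** * Clifford modules over the 0-Hecke algebra *)

Section CliffordModule.
Variables (K : fieldType) (n d : nat).
Local Notation S := {ffun 'I_n -> bool}.
Local Notation V := {ffun S -> 'cV[K]_d}.
Implicit Types (J : S) (v w : V) (i j k : 'I_n) (t : 'M[K]_d).

Definition upd J i a : S := [ffun k => if k == i then a else J k].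

Lemma updE J i a k : upd J i a k = if k == i then a else J k.
Proof. exact: ffunE. Qed.

Lemma upd_same J i a : upd J i a i = a. Proof. by rewrite updE eqxx. Qed.

Lemma upd_id J i a : J i = a -> upd J i a = J.
Proof. by move=> <-; apply/ffunP => k; rewrite updE; case: eqP => [->|]. Qed.

Lemma upd_upd J i a b : upd (upd J i a) i b = upd J i b.
Proof. by apply/ffunP => k; rewrite !updE; case: eqP. Qed.

Lemma upd_comm J i j a b : i != j -> upd (upd J i a) j b = upd (upd J j b) i a.
Proof.
by move=> ij; apply/ffunP => k; rewrite !updE; case: eqP => [->|//]; rewrite eq_sym (negbTE ij).
Qed.

(** The number of factors of c_J that c_j has to cross to reach its place. *)
Definition below J j : nat := (\sum_(k < n | (k < j)%N) J k)%N.

Lemma below_upd_ge J i a j : (j <= i)%N -> below (upd J i a) j = below J j.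
Proof.
move=> ji; apply: eq_bigr => k kj; rewrite updE ifN //.
by apply: contraTneq kj => ->; rewrite -leqNgt.
Qed.

Lemma below_upd_lt J i a j : (i < j)%N -> (below (upd J i a) j + J i = below J j + a)%N.
Proof.
move=> ij; rewrite /below (bigD1 i) //= [in RHS](bigD1 i) //= upd_same.
rewrite (eq_bigr (fun k => J k : nat)); first by rewrite addnAC [RHS]addnC addnA addnC addnA; lia.
by move=> k /andP[_ /negbTE ki]; rewrite updE ki.
Qed.

(* The action of T_i on c_J (x) w for J running over the values at i and i + 1,
   read off from the relations of the 0-Hecke-Clifford algebra. *)
Definition loc p t (w : bool -> bool -> 'M[K]_(d, p)) (a b : bool) : 'M[K]_(d, p) :=
  match a, b with
  | false, false => t *m w false false + w true true
  | true, false => t *m w false true + w false true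
  | false, true => t *m w true false - w false true
  | true, true => - (t *m w true true) - w true true
  end.

Definition Top i i' t v : V :=
  [ffun J => loc t (fun a b => v (upd (upd J i a) i' b)) (J i) (J i')].

(** Left multiplication by c_j on sums of c_J (x) v_J. The component at J comes from J flipped at j;
    the sign counts the factors crossed, and once more c_j c_j = -1 when c_j was already present. *)
Definition Cop j v : V :=
  [ffun J => (-1) ^+ (below J j + ~~ J j) *: v (upd J j (~~ J j))].

Lemma Top_linear i i' t : linear (Top i i' t).
Proof.
move=> a v w; apply/ffunP => J; rewrite !ffunE.
by case: (J i) (J i') => [] []; rewrite /= !ffunE !(mulmxDr, mulmxBr) -!scalemxAr ?scalerDr ?scalerN ?opprD -?addrA; congr (_ + _);
  rewrite [RHS]addrCA // [LHS]addrCA.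
Qed.

Lemma Cop_linear j : linear (Cop j).
Proof.
by move=> a v w; apply/ffunP => J; rewrite !ffunE scalerDr !scalerA mulrC.
Qed.

(** Passing to entries hands the additive identities left by the relations over to [ring]. *)
Lemma cv_ext (p q : 'cV[K]_d) : (forall r s, p r s = q r s) -> p = q.
Proof. by move=> pq; apply/matrixP. Qed.

Lemma entN (p : 'cV[K]_d) r s : (- p) r s = - p r s. Proof. by rewrite mxE. Qed.
Lemma entA (p q : 'cV[K]_d) r s : (p + q) r s = p r s + q r s. Proof. by rewrite mxE. Qed.

Section Relations.
Variables i i' : 'I_n.
Hypothesis ii' : i' = i.+1 :> nat.

Let neq_ii' : i != i'.
Proof. by apply/eqP => e; move: ii'; rewrite -e => /n_Sn. Qed.

Lemma Top_upd t v J a b : Top i i' t v (upd (upd J i a) i' b) =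
  loc t (fun a b => v (upd (upd J i a) i' b)) a b.
Proof.
rewrite ffunE upd_same updE (negbTE neq_ii') upd_same.
have E x y : upd (upd (upd (upd J i a) i' b) i x) i' y = upd (upd J i x) i' y.
  by apply/ffunP => k; rewrite !updE; case: (k == i'); case: (k == i).
by case: a b E => [] [] E; rewrite /loc !E.
Qed.

Lemma Top_sq t v : t *m t = - t -> Top i i' t (Top i i' t v) = - Top i i' t v.
Proof.
move=> tt; apply/ffunP => J; rewrite ffunE [RHS]ffunE ffunE.
have tt' (p : 'cV_d) : t *m (t *m p) = - (t *m p) by rewrite mulmxA tt mulNmx.
case: (J i) (J i') => [] []; rewrite /loc !Top_upd /loc !(mulmxDr, mulmxBr, mulmxN) !tt';
  apply: cv_ext => r s; rewrite !(entA, entN); ring.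
Qed.

End Relations.

Section Braid.
Variables i i' i'' : 'I_n.
Hypotheses (ii' : i' = i.+1 :> nat) (ii'' : i'' = i'.+1 :> nat).

(** Only the bits at i, i', i'' matter. On each of the eight patterns u a b c both sides unfold to
    words in t1 and t2, which the quadratic and braid relations of t1 and t2 bring to a common
    form. *)
Lemma Top_braid t1 t2 v : t1 *m t1 = - t1 -> t2 *m t2 = - t2 ->
  t1 *m t2 *m t1 = t2 *m t1 *m t2 ->
  Top i i' t1 (Top i' i'' t2 (Top i i' t1 v)) = Top i' i'' t2 (Top i i' t1 (Top i' i'' t2 v)).
Proof.
move=> t11 t22 t121; apply/ffunP => J.
have [n1 n2 n3] : [/\ (i == i') = false, (i == i'') = false & (i' == i'') = false].
  by split; apply/eqP => /(congr1 val) /=; lia.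
have [n1' n2' n3'] : [/\ (i' == i) = false, (i'' == i) = false & (i'' == i') = false].
  by split; rewrite eq_sym.
have nq := (n1, n2, n3, n1', n2', n3').
pose u a b c := upd (upd (upd J i a) i' b) i'' c.
have E12 t w a b c : Top i i' t w (u a b c) = loc t (fun a b => w (u a b c)) a b.
  rewrite ffunE {1 2}/u !updE !eqxx n1 n2 n3.
  have E x y : upd (upd (u a b c) i x) i' y = u x y c.
    by apply/ffunP => k; rewrite !updE; case: (k =P i'') => [ek|_]; rewrite ?ek ?eqxx ?nq //;
      case: (k =P i') => [ek|_]; rewrite ?ek ?eqxx ?nq //; case: (k =P i).
  by case: a b E => [] [] E; rewrite /loc !E.
have E23 t w a b c : Top i' i'' t w (u a b c) = loc t (fun b c => w (u a b c)) b c.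
  rewrite ffunE {1 2}/u !updE !eqxx n3.
  have E x y : upd (upd (u a b c) i' x) i'' y = u a x y.
    by apply/ffunP => k; rewrite !updE; case: (k =P i'') => [ek|_]; rewrite ?ek ?eqxx ?nq //;
      case: (k =P i') => [ek|_]; rewrite ?ek ?eqxx ?nq //; case: (k =P i).
  by case: b c E => [] [] E; rewrite /loc !E.
have -> : J = u (J i) (J i') (J i'').
  apply/ffunP => k; rewrite !updE; case: eqP => [->//|_]; case: eqP => [->//|_].
  by case: eqP => [->|].
have r11 (p : 'cV_d) : t1 *m (t1 *m p) = - (t1 *m p) by rewrite mulmxA t11 mulNmx.
have r22 (p : 'cV_d) : t2 *m (t2 *m p) = - (t2 *m p) by rewrite mulmxA t22 mulNmx.
have r121 (p : 'cV_d) : t1 *m (t2 *m (t1 *m p)) = t2 *m (t1 *m (t2 *m p)).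
  by rewrite !mulmxA t121.
case: (J i) (J i') (J i'') => [] [] []; rewrite !(E12, E23) /loc !(E12, E23) /loc !(E12, E23) /loc;
  rewrite ?(mulmxDr, mulmxBr, mulmxN, opprD, opprK) ?r11 ?r22 ?r121 ?(mulmxDr, mulmxBr, mulmxN, opprD, opprK) ?r11 ?r22 ?r121;
  apply: cv_ext => r s; rewrite ?(entA, entN); ring.
Qed.

End Braid.

Section Commute.
Variables i i' j j' : 'I_n.
Hypotheses (ii' : i' = i.+1 :> nat) (jj' : j' = j.+1 :> nat) (ij : (i.+1 < j)%N).

Lemma Top_comm t1 t2 v : t1 *m t2 = t2 *m t1 ->
  Top i i' t1 (Top j j' t2 v) = Top j j' t2 (Top i i' t1 v).
Proof.
move=> t12; apply/ffunP => J.
have neqs (k l : 'I_n) : k <> l :> nat -> (k == l) = false.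
  by move=> kl; apply/eqP => /(congr1 val).
have [n1 n2] : (i == i') = false /\ (j == j') = false by split; apply: neqs; lia.
have [n3 n4 n5 n6] : [/\ (i == j) = false, (i == j') = false,
  (i' == j) = false & (i' == j') = false] by split; apply: neqs => /=; lia.
have nq := (n1, n2, n3, n4, n5, n6).
pose u a b c e := upd (upd (upd (upd J i a) i' b) j c) j' e.
have E12 t w a b c e : Top i i' t w (u a b c e) = loc t (fun a b => w (u a b c e)) a b.
  rewrite ffunE {1 2}/u !updE !eqxx !nq.
  have E x y : upd (upd (u a b c e) i x) i' y = u x y c e.
    by apply/ffunP => k; rewrite !updE; case: (k =P i') => [ek|_]; rewrite ?ek ?eqxx ?nq //;
      case: (k =P i) => [ek|_]; rewrite ?ek ?eqxx ?nq.
  by case: a b E => [] [] E; rewrite /loc !E.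
have E34 t w a b c e : Top j j' t w (u a b c e) = loc t (fun c e => w (u a b c e)) c e.
  rewrite ffunE {1 2}/u !updE !eqxx !nq.
  have E x y : upd (upd (u a b c e) j x) j' y = u a b x y.
    by apply/ffunP => k; rewrite !updE; case: (k =P j') => //; case: (k =P j).
  by case: c e E => [] [] E; rewrite /loc !E.
have -> : J = u (J i) (J i') (J j) (J j').
  apply/ffunP => k; rewrite !updE; do !case: eqP => [->//|_]; by [].
have r12 (p : 'cV_d) : t1 *m (t2 *m p) = t2 *m (t1 *m p) by rewrite !mulmxA t12.
case: (J i) (J i') (J j) (J j') => [] [] [] []; rewrite !(E12, E34) /loc !(E12, E34) /loc;
  rewrite ?(mulmxDr, mulmxBr, mulmxN, opprD, opprK) ?r12;
  apply: cv_ext => r s; rewrite ?(entA, entN); ring.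
Qed.

End Commute.

End CliffordModule.

Section CliffordRelations.
Variables (K : fieldType) (n d : nat).
Local Notation S := {ffun 'I_n -> bool}.
Local Notation V := {ffun S -> 'cV[K]_d}.
Implicit Types (J : S) (v w : V) (i j k : 'I_n) (t : 'M[K]_d).

Lemma below_upd_sign J i a j : (i < j)%N ->
  (-1) ^+ below (upd J i a) j = (-1) ^+ (below J j + (J i (+) a)) :> K.
Proof.
move=> ij; have /(congr1 odd) e := below_upd_lt J a ij.
rewrite -signr_odd -[in RHS]signr_odd; move: e; rewrite !oddD !oddb => e; congr (_ ^+ _); congr nat_of_bool.
by rewrite (canRL (addbK _) e) -addbA [a (+) _]addbC.
Qed.

Lemma CopE j v J : Cop j v J = (-1) ^+ (below J j + ~~ J j) *: v (upd J j (~~ J j)).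
Proof. exact: ffunE. Qed.

Lemma TopE i i' t v J :
  Top i i' t v J = loc t (fun a b => v (upd (upd J i a) i' b)) (J i) (J i').
Proof. exact: ffunE. Qed.

Lemma Cop_sq j v : Cop j (Cop j v) = - v.
Proof.
apply/ffunP => J; rewrite !CopE [RHS]ffunE. rewrite upd_same upd_upd negbK (upd_id (erefl (J j))) scalerA.
rewrite below_upd_ge // -exprD addnACA addnn exprD -signr_odd odd_double mul1r.
by case: (J j); rewrite expr1 scaleN1r.
Qed.

Lemma Cop_anti j k v : j != k -> Cop j (Cop k v) = - Cop k (Cop j v).
Proof.
wlog jk : j k / (j < k)%N.
  move=> H; have [lt|gt|/val_inj->] := ltngtP j k; [exact: H| |by rewrite eqxx].
  by move=> jk; rewrite (H k j) ?opprK // eq_sym.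
move=> njk; apply/ffunP => J; rewrite [RHS]ffunE !CopE !scalerA !updE (negbTE njk) eq_sym (negbTE njk).
rewrite upd_comm // -scaleNr; congr (_ *: _).
rewrite !exprD below_upd_sign // below_upd_ge; last exact: ltnW.
rewrite exprD; case: (J j) => /=; rewrite !expr1; ring.
Qed.

Section Mixed.
Variables i i' : 'I_n.
Hypothesis ii' : i' = i.+1 :> nat.

Let neq : (i == i') = false.
Proof. by apply/eqP => /(congr1 val) /=; lia. Qed.

Let neq' : (i' == i) = false.
Proof. by rewrite eq_sym. Qed.

Lemma Top_Cop t j v : j != i -> j != i' -> Top i i' t (Cop j v) = Cop j (Top i i' t v).
Proof.
move=> ji ji'; apply/ffunP => J; rewrite TopE CopE TopE !updE.
rewrite ![_ == j]eq_sym (negbTE ji) (negbTE ji').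
have E a b : upd (upd (upd J i a) i' b) j (~~ J j) = upd (upd (upd J j (~~ J j)) i a) i' b.
  by rewrite ![upd (upd J j _) _ _]upd_comm // [in RHS]upd_comm // upd_comm.
(* [loc] only mixes patterns with the same parity at i and i', so the number of factors crossed by
   an outside c_j keeps its parity. *)
have sE a b : a (+) b = J i (+) J i' ->
    (-1) ^+ below (upd (upd J i a) i' b) j = (-1) ^+ below J j :> K.
  move=> ab; have [lt|] := ltnP j i.
    by rewrite !below_upd_ge // ?ii' ltnW // ltnW.
  rewrite leq_eqVlt eq_sym => /orP[/eqP/val_inj/eqP|ij]; first by rewrite (negbTE ji).
  have i'j : (i' < j)%N by move: ij ji'; rewrite -val_eqE /= ii'; lia.
  rewrite below_upd_sign // exprD below_upd_sign // exprD updE neq' -mulrA.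
  by move: ab; case: (J i) (J i') a b => [] [] [] [] //= _; rewrite ?mulrNN ?mulr1.
have cE a b : a (+) b = J i (+) J i' -> Cop j v (upd (upd J i a) i' b) =
    (-1) ^+ (below J j + ~~ J j) *: v (upd (upd (upd J j (~~ J j)) i a) i' b).
  move=> ab; rewrite CopE exprD sE // !updE (negbTE ji) (negbTE ji') E -exprD.
  by rewrite -E.
move: cE; case: (J i) (J i') => [] [] cE; rewrite /loc !cE // ?(scalerDr, scalerBr, scalerN) ?scalemxAr //.
Qed.

Let upd_lo J a b c : upd (upd (upd J i a) i' b) i c = upd (upd J i c) i' b.
Proof. by apply/ffunP => k; rewrite !updE; case: (k =P i) => [->|]; rewrite ?neq. Qed.

Let sign_lo J a b : below (upd (upd J i a) i' b) i = below J i.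
Proof. by rewrite !below_upd_ge // ii' ltnW. Qed.

Let below_hi J : below J i' = (below J i + J i)%N.
Proof.
rewrite /below (bigD1 i) ?ii' //= addnC; congr (_ + _)%N; apply: eq_bigl => k.
by rewrite ltnS ltn_neqAle andbC -val_eqE.
Qed.

Lemma Top_Cop_lo t v : Top i i' t (Cop i v) = Cop i' (Top i i' t v).
Proof.
apply/ffunP => J; rewrite TopE CopE TopE upd_same updE neq.
have cE a b : Cop i v (upd (upd J i a) i' b) =
    (-1) ^+ (below J i + ~~ a) *: v (upd (upd J i (~~ a)) i' b).
  by rewrite CopE sign_lo upd_lo updE neq upd_same.
have tE a b : upd (upd (upd J i' (~~ J i')) i a) i' b = upd (upd J i a) i' b.
  by apply/ffunP => k; rewrite !updE; case: (k == i'); case: (k == i).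
rewrite below_hi !exprD; case: (J i) (J i') cE tE => [] [] cE tE; rewrite /loc !cE !tE /= ?exprD;
  rewrite ?expr0 ?expr1 ?mulr1 ?mulrN1 ?scaleNr ?mulmxN ?(scalerDr, scalerBr, scalerN) ?scalemxAr ?opprK ?mulNr ?mulr1 ?scaleNr ?opprD ?opprK //.
Qed.

Lemma Top_Cop_hi t v :
  Top i i' t (Cop i' v) + Cop i' v = Cop i (Top i i' t v) + Cop i v.
Proof.
apply/ffunP => J; rewrite [LHS]ffunE [RHS]ffunE TopE !CopE TopE upd_same updE eq_sym neq.
have cE a b : Cop i' v (upd (upd J i a) i' b) =
    (-1) ^+ (below J i + a + ~~ b) *: v (upd (upd J i a) i' (~~ b)).
  rewrite CopE below_hi sign_lo upd_upd upd_same updE neq upd_same.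
  done.
have tE x y a b : upd (upd (upd (upd J i x) i' y) i a) i' b = upd (upd J i a) i' b.
  by rewrite upd_lo !upd_upd.
have -> : upd J i' (~~ J i') = upd (upd J i (J i)) i' (~~ J i') by rewrite (upd_id (erefl (J i))).
have -> : upd J i (~~ J i) = upd (upd J i (~~ J i)) i' (J i').
  by rewrite [RHS]upd_id // updE eq_sym neq.
rewrite below_hi !exprD; case: (J i) (J i') cE tE => [] [] cE tE; rewrite /loc !cE !tE ?exprD ![_ (nat_of_bool _)]/=;
  rewrite ?expr0 ?expr1 ?mulr1 ?mulrN1 ?scaleNr ?mulmxN ?(scalerDr, scalerBr, scalerN) ?scalemxAr ?opprK ?mulNr ?mulr1 ?scaleNr ?opprD ?opprK;
  apply: cv_ext => r s; rewrite ?(entA, entN); ring.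
Qed.

End Mixed.

End CliffordRelations.

(** * Matrices and gradings of the operators *)

Section MatrixOf.
Variable K : fieldType.

Definition mxof p q (F : 'cV[K]_p -> 'cV[K]_q) : 'M[K]_(q, p) :=
  \matrix_(x, y) F (delta_mx y 0) x 0.

Lemma cV_delta p (u : 'cV[K]_p) : u = \sum_y u y 0 *: delta_mx y 0.
Proof.
by rewrite {1}[u]matrix_sum_delta; apply: eq_bigr => y _; rewrite big_ord1.
Qed.

Lemma mxofE p q (F : 'cV[K]_p -> 'cV[K]_q) u : linear F -> mxof F *m u = F u.
Proof.
move=> lF; pose G : {linear 'cV[K]_p -> 'cV[K]_q} :=
  HB.pack F (GRing.isLinear.Build _ _ _ _ F lF).
rewrite -[F]/(G : _ -> _) [in RHS](cV_delta u) linear_sum.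
apply/matrixP => x z; rewrite !mxE summxE; apply: eq_bigr => y _.
by rewrite linearZ !mxE ord1 mulrC.
Qed.

Lemma mulmx_ext p q (A B : 'M[K]_(q, p)) :
  (forall u : 'cV[K]_p, A *m u = B *m u) -> A = B.
Proof.
move=> AB; apply/matrixP => x y; have := congr1 (fun u : 'cV_q => u x 0) (AB (delta_mx y 0)).
by rewrite -!colE !mxE.
Qed.

End MatrixOf.

Section CliffordSpace.
Variables (K : fieldType) (n d : nat).
Local Notation S := {ffun 'I_n -> bool}.
Local Notation V := {ffun S -> 'cV[K]_d}.
Implicit Types (J : S) (v w : V) (t : 'M[K]_d) (F G : V -> V).

(** An [smod] acts on columns, so the functions in V are flattened along the enumeration of the
    pairs (J, a). *)
Definition cdim := #|{: S * 'I_d}|.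

Definition vec v : 'cV[K]_cdim := \col_x v (enum_val x).1 (enum_val x).2 0.
Definition unvec (u : 'cV[K]_cdim) : V := [ffun J => \col_a u (enum_rank (J, a)) 0].

Lemma vecK : cancel vec unvec.
Proof. by move=> v; apply/ffunP => J; apply/colP => a; rewrite ffunE !mxE enum_rankK. Qed.

Lemma unvecK : cancel unvec vec.
Proof.
by move=> u; apply/colP => x; rewrite mxE ffunE mxE -surjective_pairing enum_valK.
Qed.

Lemma vec_linear : linear vec.
Proof. by move=> a v w; apply/colP => x; rewrite !mxE !ffunE !mxE. Qed.

Lemma unvec_linear : linear unvec.
Proof. by move=> a u w; apply/ffunP => J; apply/colP => x; rewrite !(ffunE, mxE). Qed.

HB.instance Definition _ := GRing.isLinear.Build K V 'cV[K]_cdim _ vec vec_linear.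
HB.instance Definition _ := GRing.isLinear.Build K 'cV[K]_cdim V _ unvec unvec_linear.

Definition opmx F : 'M[K]_cdim := mxof (fun u => vec (F (unvec u))).

Lemma opmxE F v : linear F -> opmx F *m vec v = vec (F v).
Proof.
move=> lF; rewrite /opmx mxofE ?vecK // => a u w.
by rewrite linearP lF linearP.
Qed.

Lemma mulmx_vec_ext p (A B : 'M[K]_(p, cdim)) :
  (forall v, A *m vec v = B *m vec v) -> A = B.
Proof. by move=> AB; apply: mulmx_ext => u; rewrite -[u]unvecK. Qed.

Lemma opmx_mul F G v : linear F -> linear G ->
  opmx F *m opmx G *m vec v = vec (F (G v)).
Proof. by move=> lF lG; rewrite -mulmxA !opmxE. Qed.

Definition parity J : bool := odd (\sum_k J k)%N.

Lemma parity_upd J i a : parity (upd J i a) = parity J (+) (J i (+) a).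
Proof.
rewrite /parity !(bigD1 (P := xpredT) i) //= !oddD !oddb upd_same.
rewrite (eq_bigr (fun k => J k : nat)) => [|k /negbTE ki]; last by rewrite updE ki.
by rewrite addbC -addbA [RHS]addbC -!addbA; case: a (J i) (odd _) => [] [] [].
Qed.

Section Grading.
Variable par : 'I_d -> bool.

Definition cpar (x : 'I_cdim) : bool := parity (enum_val x).1 (+) par (enum_val x).2.

Definition homog p v := forall J a, v J a 0 != 0 -> parity J (+) par a = p.

(** A matrix entry is a coordinate of the image of a homogeneous basis vector, so shifting degrees
    by s on vectors is all that the grading axiom of [smod] asks. *)
Lemma opmx_graded F s : (forall p v, homog p v -> homog (p (+) s) (F v)) ->
  forall x y, opmx F x y != 0 -> cpar x = cpar y (+) s.
Proof.
move=> hF x y; rewrite !mxE => nz; apply: hF (nz) => J a.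
rewrite ffunE !mxE eqxx andbT; case: (_ =P y) => [<- _|_]; last by rewrite eqxx.
by rewrite /cpar enum_rankK.
Qed.

Lemma homog_mulmx t p v (J : S) : (forall a b, t a b != 0 -> par a = par b) ->
  homog p v -> forall a, (t *m v J) a 0 != 0 -> parity J (+) par a = p.
Proof.
move=> gt hv a; rewrite mxE => nz.
have [b nzb] : exists b, t a b * v J b 0 != 0.
  apply/existsP; apply: contraNT nz => /existsPn z; apply/eqP/big1 => b _.
  exact/eqP/negbNE/z.
by move: nzb; rewrite mulf_eq0 negb_or => /andP[/gt -> /hv].
Qed.

Lemma homog_Top i i' t p v : i != i' -> (forall a b, t a b != 0 -> par a = par b) ->
  homog p v -> homog (p (+) false) (Top i i' t v).
Proof.
move=> ii' gt hv J a; rewrite addbF TopE => nz.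
have hu x y : x (+) y = J i (+) J i' -> parity (upd (upd J i x) i' y) = parity J.
  move=> xy; rewrite !parity_upd updE eq_sym (negbTE ii') -addbA; move: xy.
  by case: (J i) (J i') x y => [] [] [] [] //=; rewrite addbF.
have h1 x y : x (+) y = J i (+) J i' ->
    (t *m v (upd (upd J i x) i' y)) a 0 != 0 -> parity J (+) par a = p.
  by move=> xy; rewrite -(hu x y xy); apply: homog_mulmx.
have h2 x y : x (+) y = J i (+) J i' ->
    v (upd (upd J i x) i' y) a 0 != 0 -> parity J (+) par a = p.
  by move=> xy; rewrite -(hu x y xy); apply: hv.
apply/eqP; apply: contraNT nz => /eqP np.
have z1 x y : x (+) y = J i (+) J i' -> (t *m v (upd (upd J i x) i' y)) a 0 = 0.
  by move=> xy; apply: contra_notP np => /eqP; apply: h1.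
have z2 x y : x (+) y = J i (+) J i' -> v (upd (upd J i x) i' y) a 0 = 0.
  by move=> xy; apply: contra_notP np => /eqP; apply: h2.
move: z1 z2; case: (J i) (J i') => [] [] z1 z2;
  by rewrite /loc ?entA ?entN ?entA ?z1 ?z2 // ?oppr0 ?addr0 ?subr0.
Qed.

Lemma homog_Cop j p v : homog p v -> homog (p (+) true) (Cop j v).
Proof.
move=> hv J a; rewrite CopE mxE mulf_eq0 negb_or => /andP[_ /hv <-].
by rewrite parity_upd; case: (J j) (parity J) (par a) => [] [] [].
Qed.

End Grading.
End CliffordSpace.

(** * Ordered Clifford products in an arbitrary ring *)

Section OrderedProducts.
Variables (n : nat) (R : pzRingType) (c : 'I_n -> R).
Local Notation S := {ffun 'I_n -> bool}.
Implicit Types (J : S) (s : seq 'I_n) (i j k : 'I_n).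

Lemma enum_ord_split j : exists s1 s2, [/\ enum 'I_n = s1 ++ j :: s2,
  forall k, (k \in s1) = (k < j)%N & forall k, (k \in s2) = (j < k)%N].
Proof.
exists (take j (enum 'I_n)), (drop j.+1 (enum 'I_n)); split=> [|k|k].
- rewrite -{1}(cat_take_drop j (enum 'I_n)) (drop_nth j) ?size_enum_ord //.
  by rewrite nth_ord_enum.
- rewrite -(mem_map val_inj) map_take val_enum_ord take_iota mem_iota /=.
  by rewrite leq_min ltn_ord andbT.
rewrite -(mem_map val_inj) map_drop val_enum_ord drop_iota mem_iota add0n.
by rewrite subnKC // ltn_ord andbT.
Qed.

Lemma enum_ord_split2 i i' : i' = i.+1 :> nat ->
  exists s1 s2, [/\ enum 'I_n = s1 ++ i :: i' :: s2, i \notin s1, i' \notin s1,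
    i \notin s2 & i' \notin s2].
Proof.
move=> ii'; have [s1 [s2 [e m1 m2]]] := enum_ord_split i.
have [s1' [s2' [e' m1' m2']]] := enum_ord_split i'.
have := e; rewrite e' => {}e.
have s12 : size s1' = (size s1).+1.
  have sz j t1 t2 : enum 'I_n = t1 ++ j :: t2 -> (forall k, (k \in t1) = (k < j)%N) -> size t1 = j.
    move=> et mt; have := congr1 (index j) et; rewrite index_enum_ord index_cat mt ltnn /= eqxx addn0.
    by move->.
  by rewrite (sz i' s1' s2') // (sz i s1 s2) // -e.
have [t et] : exists t, s2 = i' :: t.
  have := congr1 (drop (size s1).+1) e.
  rewrite -{1}s12 drop_size_cat // -[s1 ++ _]cat_rcons -(size_rcons s1 i) drop_size_cat //.
  by move=> <-; exists s2'.
exists s1, t; rewrite -et -e m1 ltnn m1 ii' ltnNge leqnSn; split=> //.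
  by apply/negP => it; have := m2 i; rewrite et inE it orbT ltnn.
have := enum_uniq 'I_n; rewrite e' e et cat_uniq /=.
by case/and3P=> _ _ /andP[_ /andP[]].
Qed.

Lemma below_split J j s1 s2 : enum 'I_n = s1 ++ j :: s2 ->
  (forall k, (k \in s1) = (k < j)%N) -> (forall k, (k \in s2) = (j < k)%N) ->
  below J j = (\sum_(k <- s1) J k)%N.
Proof.
move=> e m1 m2; transitivity (\sum_(k <- enum 'I_n | (k < j)%N) J k)%N; first by rewrite big_enum_cond.
rewrite e big_cat big_cons ltnn /=.
rewrite [X in (_ + X)%N]big1_seq ?addn0; last first.
  by move=> k /andP[kj]; rewrite m2 ltnNge ltnW.
by rewrite big_seq_cond [RHS]big_seq; apply: eq_bigl => k; rewrite m1 andbb.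
Qed.

Definition cseq s J : R := \prod_(k <- s) (if J k then c k else 1).
Definition cprod J : R := cseq (enum 'I_n) J.

Lemma cseq_cat s1 s2 J : cseq (s1 ++ s2) J = cseq s1 J * cseq s2 J.
Proof. exact: big_cat. Qed.

Lemma cseq_cons k s J : cseq (k :: s) J = (if J k then c k else 1) * cseq s J.
Proof. exact: big_cons. Qed.

Lemma cseq_upd s J j a : j \notin s -> cseq s (upd J j a) = cseq s J.
Proof.
move=> js; rewrite /cseq big_seq [RHS]big_seq; apply: eq_bigr => k ks.
have /negbTE kj : k != j by apply: contraNneq js => <-.
by rewrite updE kj.
Qed.

Hypothesis c_sq : forall j, c j * c j = -1.
Hypothesis c_anti : forall i j, i != j -> c i * c j = - (c j * c i).

Lemma sign_comm m (x : R) : (-1) ^+ m * x = x * (-1) ^+ m.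
Proof.
by rewrite -signr_odd; case: (odd m); rewrite ?expr0 ?expr1 ?mul1r ?mulr1 ?mulrN1 ?mulN1r.
Qed.

Lemma cseq_comm j s J : j \notin s ->
  c j * cseq s J = (-1) ^+ (\sum_(k <- s) J k) * (cseq s J * c j).
Proof.
elim: s => [|k s IH] js; first by rewrite /cseq !big_nil mul1r mul1r mulr1.
move: js; rewrite inE negb_or => /andP[jk /IH{}IH].
rewrite cseq_cons big_cons; case: (J k) => /=; last by rewrite !mul1r add0n.
by rewrite mulrA c_anti // mulNr -mulrA IH exprS mulN1r mulNr !mulrA -sign_comm.
Qed.

Lemma cprod_mul j J :
  c j * cprod J = (-1) ^+ (below J j + J j) * cprod (upd J j (~~ J j)).
Proof.
have [s1 [s2 [e m1 m2]]] := enum_ord_split j.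
have j1 : j \notin s1 by rewrite m1 ltnn.
have j2 : j \notin s2 by rewrite m2 ltnn.
rewrite (below_split J e m1 m2) /cprod e !cseq_cat !cseq_cons !cseq_upd // upd_same.
rewrite mulrA cseq_comm // exprD -!mulrA; congr (_ * _).
case: (J j) => /=; last by rewrite expr0 !mul1r.
by rewrite [c j * (c j * _)]mulrA c_sq expr1 !mulN1r mul1r mulrN.
Qed.

Section Mixed.
Variables (i i' : 'I_n) (T : R).
Hypothesis ii' : i' = i.+1 :> nat.
Hypothesis T_far : forall j, j != i -> j != i' -> T * c j = c j * T.
Hypothesis T_lo : T * c i = c i' * T.
Hypothesis T_hi : (T + 1) * c i' = c i * (T + 1).

Lemma cseq_far s J : i \notin s -> i' \notin s -> T * cseq s J = cseq s J * T.
Proof.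
elim: s => [|k s IH] is1 i's; first by rewrite /cseq !big_nil mul1r mulr1.
move: is1 i's; rewrite !inE !negb_or => /andP[ik is1] /andP[i'k i's].
rewrite cseq_cons; case: (J k); last by rewrite !mul1r IH.
by rewrite mulrA T_far 1?eq_sym // -mulrA IH // mulrA.
Qed.

Let T_hi' : T * c i' = c i * T + c i - c i'.
Proof. by move: T_hi; rewrite mulrDl mul1r mulrDr mulr1 => <-; rewrite addrK. Qed.

Lemma cprod_mixed J : let u a b := upd (upd J i a) i' b in
  [/\ T * cprod (u false false) = cprod (u false false) * T,
      T * cprod (u true false) = cprod (u false true) * T,
      T * cprod (u false true) = cprod (u true false) * T + cprod (u true false)
                                 - cprod (u false true)
    & T * cprod (u true true) = cprod (u false false) - cprod (u true true) * T
                                - cprod (u true true)].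
Proof.
move=> u; have [s1 [s2 [e n1 n1' n2 n2']]] := enum_ord_split2 ii'.
have neq : (i == i') = false by apply/eqP => /(congr1 val) /=; lia.
pose L := cseq s1 J; pose Q := cseq s2 J.
have uE a b : cprod (u a b) =
    L * ((if a then c i else 1) * (if b then c i' else 1)) * Q.
  by rewrite /cprod e cseq_cat !cseq_cons !cseq_upd // !updE !eqxx neq !mulrA.
have TL : T * L = L * T by apply: cseq_far.
have TQ : T * Q = Q * T by apply: cseq_far.
have TE x y : T * x = y -> T * (L * x * Q) = L * y * Q.
  by move=> <-; rewrite !mulrA TL.
rewrite !uE !mulr1 !mul1r; split.
- by rewrite mulrA TL -!mulrA TQ.
- by rewrite (TE _ _ T_lo) -!mulrA TQ.
- rewrite (TE _ _ T_hi') !mulrBr !mulrDr !mulrBl !mulrDl; congr (_ + _ - _).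
  by rewrite -!mulrA TQ.
have Tcc : T * (c i * c i') = 1 - c i * c i' * T - c i * c i'.
  rewrite mulrA T_lo -mulrA T_hi' !mulrBr !mulrDr c_sq opprK !mulrA.
  rewrite (c_anti (_ : i' != i)) ?[i' == i]eq_sym ?neq // mulNr addrC addrA.
  by [].
rewrite (TE _ _ Tcc) !mulrBr !mulrBl mulr1 -!mulrA TQ.
by [].
Qed.

End Mixed.
End OrderedProducts.

(** Each J is grouped with the three that differ from it only at i and i', since T respects these
    groups but not single terms. *)
Lemma sum_upd2 (A : zmodType) n (i i' : 'I_n) (G : {ffun 'I_n -> bool} -> A) : i != i' ->
  let u J a b := upd (upd J i a) i' b in
  \sum_J G J = \sum_(J : {ffun 'I_n -> bool} | ~~ J i && ~~ J i')
     (G (u J false false) + G (u J true false) + G (u J false true) + G (u J true true)).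
Proof.
move=> ii' u.
have split1 k (P : pred {ffun 'I_n -> bool}) F : (forall J a, P (upd J k a) = P J) ->
    \sum_(J | P J) F J = \sum_(J : {ffun 'I_n -> bool} | P J && ~~ J k) (F (upd J k false) + F (upd J k true)) :> A.
  move=> PE; rewrite (bigID (fun J : {ffun _} => J k)) /= addrC big_split; congr (_ + _).
    by apply: eq_bigr => J /andP[_ /negbTE Jk]; rewrite upd_id.
  rewrite (reindex_onto (fun J => upd J k true) (fun J => upd J k false)) /=; last first.
    by move=> J /andP[_ Jk]; rewrite upd_upd upd_id.
  apply: eq_bigl => J; rewrite PE upd_same upd_upd andbT; congr (_ && _).
  apply/eqP/idP => [<-|/negbTE Jk]; last by rewrite upd_id.
  by rewrite upd_same.
rewrite (split1 i xpredT) // (split1 i' (fun J => ~~ J i)) => [|J a]; last first.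
  by rewrite updE (negbTE ii').
have i'i : i' != i by rewrite eq_sym.
by apply: eq_bigr => J _; rewrite addrA !(upd_comm _ _ _ i'i).
Qed.

Section CliffordExtension.
Variables (K : fieldType) (n d D : nat) (c : 'I_n -> 'M[K]_D) (f : 'M[K]_(D, d)).
Local Notation S := {ffun 'I_n -> bool}.
Local Notation V := {ffun S -> 'cV[K]_d}.
Implicit Types (J : S) (v : V).

(** The only possible extension of f to the sums of c_J (x) v_J that commutes with the Clifford
    generators. *)
Definition cext v : 'cV[K]_D := \sum_J cprod c J *m (f *m v J).

Lemma cext_linear : linear cext.
Proof.
move=> a v w; rewrite /cext scaler_sumr -big_split; apply: eq_bigr => J _ /=.
by rewrite !ffunE !mulmxDr -!scalemxAr.
Qed.

Lemma sign_mulmx m p (X : 'M[K]_D) (u : 'M[K]_(D, p)) :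
  ((-1) ^+ m * X) *m u = (-1) ^+ m *: (X *m u).
Proof.
rewrite -signr_odd -[in RHS]signr_odd; case: (odd m).
  by rewrite expr1 expr1 mulN1r scaleN1r mulNmx.
by rewrite expr0 expr0 mul1r scale1r.
Qed.

Hypothesis c_sq : forall j, c j * c j = -1.
Hypothesis c_anti : forall i j, i != j -> c i * c j = - (c j * c i).

Lemma cext_Cop j v : cext (Cop j v) = c j *m cext v.
Proof.
pose flip J := upd J j (~~ J j).
have flipK : involutive flip.
  by move=> J; rewrite /flip upd_upd upd_same negbK upd_id.
rewrite /cext (reindex_inj (inv_inj flipK)) mulmx_sumr; apply: eq_bigr => J _.
rewrite CopE -/(flip (flip J)) flipK [RHS]mulmxA.
have E : c j *m cprod c J = (-1) ^+ (below J j + J j) * cprod c (flip J).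
  exact: cprod_mul.
rewrite E sign_mulmx -/(flip J) /flip below_upd_ge // upd_same negbK.
by rewrite -!scalemxAr.
Qed.

(** In each group of four, moving T across the products by [cprod_mixed] yields the four components
    of [loc], t being turned into T by f. *)
Lemma cext_Top (i i' : 'I_n) (t : 'M[K]_d) (T : 'M[K]_D) v : i' = i.+1 :> nat ->
  (forall j, j != i -> j != i' -> T * c j = c j * T) ->
  T * c i = c i' * T -> (T + 1) * c i' = c i * (T + 1) ->
  f *m t = T *m f -> cext (Top i i' t v) = T *m cext v.
Proof.
move=> ii' Tfar Tlo Thi fT.
have neq : i != i' by apply/eqP => /(congr1 val) /=; lia.
rewrite /cext mulmx_sumr !(sum_upd2 _ neq); apply: eq_bigr => J _.
rewrite !(Top_upd ii') /loc.
have [e00 e10 e01 e11] := cprod_mixed c_sq c_anti ii' Tfar Tlo Thi J.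
pose C a b := cprod c (upd (upd J i a) i' b).
have E00 (x : 'cV_D) : T *m (C false false *m x) = C false false *m (T *m x).
  by rewrite !mulmxA; congr (_ *m x); exact: e00.
have E10 (x : 'cV_D) : T *m (C true false *m x) = C false true *m (T *m x).
  by rewrite !mulmxA; congr (_ *m x); exact: e10.
have E01 (x : 'cV_D) : T *m (C false true *m x) =
    C true false *m (T *m x) + C true false *m x - C false true *m x.
  by rewrite !mulmxA -mulmxDl -mulmxBl; congr (_ *m x); exact: e01.
have E11 (x : 'cV_D) : T *m (C true true *m x) =
    C false false *m x - C true true *m (T *m x) - C true true *m x.
  by rewrite !mulmxA -!mulmxBl; congr (_ *m x); exact: e11.
have fT' (x : 'cV_d) : f *m (t *m x) = T *m (f *m x) by rewrite !mulmxA fT.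
rewrite -![cprod c _]/(C _ _) !(mulmxDr, mulmxBr, mulmxN) !fT' E00 E10 E01 E11.
apply: cv_ext => r s; rewrite ?(entA, entN); ring.
Qed.

End CliffordExtension.

(** * The universal property of the explicit model *)

Section InducedModule.
Variables (K : fieldType) (A B : salg) (n : nat) (M : smod K A).
(* [code] sorts the generators of B into those of A and n Clifford generators; the
   generator a of A lies at the neighbouring positions [pos a] and [pos' a]. *)
Variables (code : sgen B -> sgen A + 'I_n) (phi : sgen A -> sgen B) (cgen : 'I_n -> sgen B).
Variables (pos pos' : sgen A -> 'I_n).
Hypothesis posS : forall a, pos' a = (pos a).+1 :> nat.
Hypothesis codeK : forall x, code (match x with inl a => phi a | inr j => cgen j end) = x.
Hypothesis code_inj : injective code.
Hypothesis oddA : forall a : sgen A, sodd a = false.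
Hypothesis oddB : forall b : sgen B, sodd b = if code b is inr _ then true else false.
Local Notation d := (sdim M).
Local Notation V := {ffun {ffun 'I_n -> bool} -> 'cV[K]_d}.
Local Notation S := {ffun 'I_n -> bool}.

(** One construction serves HC_n over H_n and HC_m (x) HC_k over H_m (x) H_k; the relations of the
    target algebra are checked separately in the two cases. *)
Definition indact b : 'M[K]_(cdim n d) :=
  match code b with
  | inl a => opmx (Top (pos a) (pos' a) (sact M a))
  | inr j => opmx (@Cop K n d j)
  end.

Hypothesis relB : srel indact.

Let pos_neq a : pos a != pos' a.
Proof. by apply/eqP => /(congr1 val) /=; rewrite posS; lia. Qed.

Lemma sact_graded (a : sgen A) (i j : 'I_d) :
  sact M a i j != 0 -> spar (s := M) i = spar j (+) sodd a.
Proof. by case: M a i j => ? ? ? h ? a i j; apply: h. Qed.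

Lemma indact_graded b x y : indact b x y != 0 ->
  cpar (@spar K A M) x = cpar (@spar K A M) y (+) sodd b.
Proof.
rewrite /indact oddB; case: (code b) => [a|j]; apply: opmx_graded => p v.
  apply: homog_Top => // i j /sact_graded ->; by rewrite oddA addbF.
exact: homog_Cop.
Qed.

Definition indmod : smod K B := SMod indact_graded relB.

Definition bas (J0 : S) (u : 'cV[K]_d) : V := [ffun J => if J == J0 then u else 0].

Lemma bas_linear J0 : linear (bas J0).
Proof.
by move=> a u w; apply/ffunP => J; rewrite !ffunE; case: ifP; rewrite ?scaler0 ?addr0.
Qed.

Definition indemb : 'M[K]_(cdim n d, d) := mxof (fun u => vec (bas [ffun=> false] u)).

Lemma indembE u : indemb *m u = vec (bas [ffun=> false] u).
Proof. by rewrite mxofE // => a x y; rewrite bas_linear linearP. Qed.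

Let cind j : 'M[K]_(cdim n d) := indact (cgen j).

Lemma cindE j (v : V) : cind j *m vec v = vec (Cop j v).
Proof. by rewrite /cind /indact (codeK (inr j)) opmxE //; apply: Cop_linear. Qed.

Lemma Tind a (v : V) : indact (phi a) *m vec v = vec (Top (pos a) (pos' a) (sact M a) v).
Proof. by rewrite /indact (codeK (inl a)) opmxE //; apply: Top_linear. Qed.

(** As s is increasing, each generator is applied to a product of later ones only, already stands in
    its place, and causes no sign. *)
Lemma cseq_bas (s : seq 'I_n) J u : sorted (fun i j : 'I_n => (i < j)%N) s ->
  cseq cind s J *m vec (bas [ffun=> false] u) =
  vec (bas [ffun k => (k \in s) && J k] u).
Proof.
elim: s => [|k s IH] /= ps.
  by rewrite /cseq big_nil mul1mx; congr (vec (bas _ u)).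
have lt_k : all (fun j : 'I_n => (k < j)%N) s.
  by apply: order_path_min ps => x y z; apply: ltn_trans.
have ks : k \notin s by apply/negP => /(allP lt_k); rewrite ltnn.
rewrite cseq_cons; case: ifP => Jk; last first.
  rewrite mul1r IH ?(path_sorted ps) //; congr (vec (bas _ u)).
  by apply/ffunP => j; rewrite !ffunE inE; case: eqP => [->|]; rewrite ?Jk ?andbF.
rewrite -mulmxA IH ?(path_sorted ps) // cindE; congr vec.
set J0 := [ffun _ => _]; set J1 := [ffun _ => _].
have E : J1 = upd J0 k true.
  by apply/ffunP => j; rewrite updE !ffunE inE; case: eqP => [->|]; rewrite ?Jk.
have J0k : J0 k = false by rewrite ffunE (negbTE ks).
apply/ffunP => I; rewrite CopE !ffunE E.
have -> : (upd I k (~~ I k) == J0) = (I == upd J0 k true).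
  apply/eqP/eqP => [e|->]; last by rewrite upd_upd upd_same upd_id.
  have := J0k; rewrite -e upd_same => /negbFE Ik.
  by rewrite upd_upd upd_id.
case: eqP => [->|_]; last by rewrite scaler0.
rewrite upd_same addn0 below_upd_ge // /below big1 ?scale1r // => j jk.
rewrite ffunE; case: (boolP (j \in s)) => // /(allP lt_k).
by rewrite ltnNge ltnW.
Qed.

Lemma cprod_bas J u : cprod cind J *m vec (bas [ffun=> false] u) = vec (bas J u).
Proof.
rewrite /cprod cseq_bas; last first.
  by have := iota_ltn_sorted 0 n; rewrite -val_enum_ord sorted_map.
by congr (vec (bas _ u)); apply/ffunP => j; rewrite ffunE mem_enum.
Qed.

Lemma sum_bas (v : V) : v = \sum_J bas J (v J).
Proof.
apply/ffunP => I; rewrite sum_ffunE (bigD1 I) //= ffunE eqxx big1 ?addr0 // => J JI.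
by rewrite ffunE eq_sym (negbTE JI).
Qed.

Definition clifford_gens (R : pzRingType) (x : sgen B -> R) : Prop :=
  [/\ forall j, x (cgen j) * x (cgen j) = -1,
      forall i j, i != j -> x (cgen i) * x (cgen j) = - (x (cgen j) * x (cgen i)),
      forall a j, j != pos a -> j != pos' a -> x (phi a) * x (cgen j) = x (cgen j) * x (phi a),
      forall a, x (phi a) * x (cgen (pos a)) = x (cgen (pos' a)) * x (phi a)
    & forall a, (x (phi a) + 1) * x (cgen (pos' a)) = x (cgen (pos a)) * (x (phi a) + 1)].

Hypothesis rel_clifford : forall (R : pzRingType) (x : sgen B -> R), srel x -> clifford_gens x.

Lemma genP b : (exists a, b = phi a) \/ (exists j, b = cgen j).
Proof.
case cb: (code b) => [a|j]; [left; exists a|right; exists j]; apply: code_inj; rewrite cb.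
  exact: esym (codeK (inl a)).
exact: esym (codeK (inr j)).
Qed.

(** The vectors 1 (x) u generate: c_J (x) u is obtained from them by Clifford generators alone,
    which g carries to those of L. *)
Lemma hom_indmod_unique (L : smod K B) (g : 'M[K]_(sdim L, sdim indmod)) v :
  @Defs.hom K B indmod L g ->
  g *m vec v = cext (fun j => sact L (cgen j)) (g *m indemb) v.
Proof.
move=> hg; rewrite {1}[v]sum_bas linear_sum mulmx_sumr; apply: eq_bigr => J _.
rewrite /= -cprod_bas -indembE mulmxA -[g *m indemb *m _]mulmxA [RHS]mulmxA; congr (_ *m _).
rewrite /cprod; elim: (enum _) => [|k s IH]; first by rewrite /cseq !big_nil mulmx1 mul1mx.
rewrite !cseq_cons; case: (J k); last by rewrite !mul1r IH.
rewrite -[_ * _]/(_ *m _) mulmxA (hg (cgen k) : g *m cind k = _) -mulmxA IH.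
by rewrite mulmxA.
Qed.

(** [cext] provides the mediating map, equivariant by the relations of L gathered in
    [clifford_gens]; it is unique by [hom_indmod_unique]. *)
Theorem indmod_induced : induced phi M indmod.
Proof.
exists indemb; split=> [a|x i|L f fphi].
- apply: mulmx_ext => u; rewrite -!mulmxA !indembE /= Tind; congr vec.
  (* The vector 1 (x) u vanishes at every J with a set bit, so [loc] only retains t applied to the
     pattern with both bits clear. *)
  apply/ffunP => J; have bas1 (I : S) i w : I i -> bas [ffun=> false] w I = 0.
    by move=> Ii; rewrite ffunE; case: eqP => // e; move: Ii; rewrite e ffunE.
  have posF := negbTE (pos_neq a).
  have b1 x w : bas [ffun=> false] w (upd (upd J (pos a) x) (pos' a) true) = 0.
    by rewrite (bas1 _ (pos' a)) // upd_same.
  have b2 x w : bas [ffun=> false] w (upd (upd J (pos a) true) (pos' a) x) = 0.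
    by rewrite (bas1 _ (pos a)) // updE posF upd_same.
  rewrite TopE; case Ji: (J (pos a)); case Ji': (J (pos' a));
    rewrite /loc ?b1 ?b2 ?(bas1 _ _ _ Ji) ?(bas1 _ _ _ Ji') ?mulmx0 ?oppr0 ?addr0 //.
  rewrite (upd_id Ji) (upd_id Ji') !ffunE.
  by case: ifP; rewrite ?mulmx0.
- rewrite [spar x]/= /indemb !mxE /cpar ffunE; case: (_ =P [ffun=> false]) => [->|_]; last by rewrite mxE eqxx.
  rewrite !mxE eqxx andbT; case: (_ =P i) => [-> _|]; last by rewrite eqxx.
  by rewrite /parity big1 // => k _; rewrite ffunE.
have [c_sq c_anti Tfar Tlo Thi] := rel_clifford (sact_rel L).
pose F v := cext (fun j => sact L (cgen j)) f v.
have lF : linear F by apply: cext_linear.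
pose g : 'M[K]_(sdim L, cdim n d) := mxof (fun u => F (unvec u)).
have gE v : g *m vec v = F v.
  by rewrite /g mxofE ?vecK // => a x y; rewrite linearP lF.
exists g; split.
  split.
    move=> b; apply: mulmx_vec_ext => v; rewrite -!mulmxA gE.
    case: (genP b) => [[a ->]|[j ->]] /=.
      rewrite Tind gE; apply: (cext_Top c_sq c_anti _ (posS a) (Tfar a) (Tlo a) (Thi a)).
      exact: fphi.
    by rewrite -/(cind j) cindE gE; apply: cext_Cop.
  apply: mulmx_ext => u; rewrite -mulmxA indembE gE /F /cext.
  rewrite (bigD1 [ffun=> false]) //= ffunE eqxx big1 ?addr0 => [|J /negbTE J0].
    rewrite /cprod /cseq big1 ?mul1mx // => k _; by rewrite ffunE.
  by rewrite ffunE J0 !mulmx0.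
move=> h [hh hf]; apply: mulmx_vec_ext => v.
by rewrite gE (hom_indmod_unique _ hh) hf.
Qed.

End InducedModule.

Section CliffordHeckeRelations.
Variables (K : fieldType) (n d : nat).
Local Notation TT i i' t := (opmx (@Top K n d i i' t)).
Local Notation CC j := (opmx (@Cop K n d j)).
Local Notation opE := (opmxE _ (Top_linear _ _ _), opmxE _ (Cop_linear _)).

Variables (m off : nat) (q : 'I_m -> 'I_n) (p p' : 'I_m.-1 -> 'I_n) (t : 'I_m.-1 -> 'M[K]_d).
Hypotheses (qE : forall j, q j = (off + j)%N :> nat) (pE : forall i, p i = (off + i)%N :> nat).
Hypothesis p'E : forall i, p' i = (off + i).+1 :> nat.

Let p'S i : p' i = (p i).+1 :> nat. Proof. by rewrite pE p'E. Qed.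

(** The offset is 0 for HC_n and for the first factor of HC_m (x) HC_k, and m for the second
    factor. *)
Lemma Top_hecke_rel : hecke_rel t -> hecke_rel (fun i => TT (p i) (p' i) (t i)).
Proof.
case=> tsq tcomm tbraid; split=> [i|i j ij|i j ij]; apply: mulmx_vec_ext => v;
  rewrite -![_ * _]/(_ *m _) -?mulmxA ?mulNmx !opE.
- rewrite (Top_sq (p'S i)); [exact: linearN|exact: tsq].
- congr vec; apply: (Top_comm (p'S i) (p'S j)); first by rewrite !pE -addnS ltn_add2l.
  exact: tcomm.
have -> : p j = p' i by apply: val_inj; rewrite /= pE p'E ij addnS.
congr vec; apply: Top_braid; rewrite ?p'S //.
- by rewrite !pE ij addnS.
- exact: tsq.
- exact: tsq.
exact: tbraid.
Qed.

Let q_inj i j : i != j -> q i != q j.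
Proof. by apply: contra_neq => /(congr1 val) /=; rewrite !qE => /addnI /val_inj. Qed.

Lemma Top_clifford_rel : clifford_rel (fun i => TT (p i) (p' i) (t i)) (fun j => CC (q j)).
Proof.
split=> [j|i j ij|i j ji ji'|i j k ji ki|i j k ji ki]; apply: mulmx_vec_ext => v;
  rewrite -![_ * _]/(_ *m _) ?mulmxDl ?mulmxDr ?mulmx1 -?mulmxA ?mulNmx ?mul1mx ?mulmxDl -?mulmxA ?opE.
- by rewrite Cop_sq linearN.
- rewrite Cop_anti; [exact: linearN|exact: q_inj].
- congr vec; apply: (Top_Cop (p'S i)).
    by apply: contraNneq ji => /(congr1 val) /=; rewrite qE pE => /addnI ->.
  by apply: contraNneq ji' => /(congr1 val) /=; rewrite qE p'E -addnS => /addnI ->.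
- have -> : q j = p i by apply: val_inj; rewrite /= qE pE ji.
  have -> : q k = p' i by apply: val_inj; rewrite /= qE p'E ki addnS.
  by congr vec; apply: Top_Cop_lo.
have -> : q j = p i by apply: val_inj; rewrite /= qE pE ji.
have -> : q k = p' i by apply: val_inj; rewrite /= qE p'E ki addnS.
by rewrite ?mul1mx ?opE -!linearD Top_Cop_hi.
Qed.

End CliffordHeckeRelations.

(** * Induction from one and from two 0-Hecke algebras *)

Section InducedHecke.
Variable K : fieldType.

Fact hlo_subproof n (i : 'I_n.-1) : (i < n)%N. Proof. by rewrite (leq_trans (ltn_ord i)) ?leq_pred. Qed.
Fact hhi_subproof n (i : 'I_n.-1) : (i.+1 < n)%N. Proof. by rewrite -ltn_predRL. Qed.
Definition hlo n (i : 'I_n.-1) : 'I_n := Ordinal (hlo_subproof i).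
Definition hhi n (i : 'I_n.-1) : 'I_n := Ordinal (hhi_subproof i).

Lemma clifford_rel_gens n (R : pzRingType) (T : 'I_n.-1 -> R) (c : 'I_n -> R) :
  clifford_rel T c ->
  [/\ forall j, c j * c j = -1, forall i j, i != j -> c i * c j = - (c j * c i),
      forall i j, j != hlo i -> j != hhi i -> T i * c j = c j * T i,
      forall i, T i * c (hlo i) = c (hhi i) * T i
    & forall i, (T i + 1) * c (hhi i) = c (hlo i) * (T i + 1)].
Proof.
case=> csq canti far lo hi; split=> // i; [exact: lo|exact: hi].
Qed.

Section OneBlock.
Variables (n : nat) (M : smod K (hecke n)).

Local Notation hcode := (fun g : sgen (heckeC n) => g : sgen (hecke n) + 'I_n).

Lemma heckeC_rel : srel (indact (B := heckeC n) M hcode (@hlo n) (@hhi n)).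
Proof.
split; first exact: (Top_hecke_rel (off := 0) _ _ (sact_rel M)).
exact: (Top_clifford_rel (off := 0)).
Qed.

Fact heckeC_odd (b : sgen (heckeC n)) :
  sodd b = if hcode b is inr _ then true else false.
Proof. by case: b. Qed.

Definition hcind : smod K (heckeC n) :=
  indmod (A := hecke n) (B := heckeC n) (M := M) (code := hcode) (pos := @hlo n) (pos' := @hhi n)
    (fun=> erefl) (fun=> erefl) heckeC_odd heckeC_rel.

Lemma hcind_clifford (R : pzRingType) (x : sgen (heckeC n) -> R) : srel x ->
  clifford_gens (A := hecke n) (B := heckeC n) (@hincl n) inr (@hlo n) (@hhi n) x.
Proof. by case=> _ /clifford_rel_gens. Qed.

Lemma hcind_induced : induced (@hincl n) M hcind.
Proof.
apply: (indmod_induced (B := heckeC n) (cgen := inr)) => [[]//|//|]; exact: hcind_clifford.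
Qed.

End OneBlock.

Section TwoBlocks.
Variables (m k : nat) (X : smod K (stens (hecke m) (hecke k))).
Local Notation A2 := (stens (hecke m) (hecke k)).
Local Notation B2 := (stens (heckeC m) (heckeC k)).

Definition code2 (g : sgen B2) : sgen A2 + 'I_(m + k) :=
  match g with
  | inl (inl i) => inl (inl i)
  | inl (inr j) => inr (lshift k j)
  | inr (inl i) => inl (inr i)
  | inr (inr j) => inr (rshift m j)
  end.

Definition incl2 (g : sgen A2) : sgen B2 :=
  match g with inl i => inl (inl i) | inr i => inr (inl i) end.

Definition cgen2 (j : 'I_(m + k)) : sgen B2 :=
  match split j with inl j => inl (inr j) | inr j => inr (inr j) end.

Definition pos2 (a : sgen A2) : 'I_(m + k) :=
  match a with inl i => lshift k (hlo i) | inr i => rshift m (hlo i) end.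
Definition pos2' (a : sgen A2) : 'I_(m + k) :=
  match a with inl i => lshift k (hhi i) | inr i => rshift m (hhi i) end.

Lemma cgen2l j : cgen2 (lshift k j) = inl (inr j).
Proof. by rewrite /cgen2 (unsplitK (inl j)). Qed.
Lemma cgen2r j : cgen2 (rshift m j) = inr (inr j).
Proof. by rewrite /cgen2 (unsplitK (inr j)). Qed.

Fact pos2S a : pos2' a = (pos2 a).+1 :> nat.
Proof. by case: a => i //=; rewrite addnS. Qed.

Fact code2K x : code2 (match x with inl a => incl2 a | inr j => cgen2 j end) = x.
Proof.
case: x => [[i|i]|j] //; case: (split_ordP j) => i ->; by rewrite ?cgen2l ?cgen2r.
Qed.

Fact code2_inj : injective code2.
Proof.
apply: (can_inj (g := fun x => match x with inl a => incl2 a | inr j => cgen2 j end)).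
by case=> [[i|j]|[i|j]] //=; rewrite ?cgen2l ?cgen2r.
Qed.

Fact odd2A (a : sgen A2) : sodd a = false. Proof. by case: a. Qed.

Fact odd2B (b : sgen B2) : sodd b = if code2 b is inr _ then true else false.
Proof. by case: b => [[]|[]]. Qed.

(** All m + k Clifford generators act on one space. The two factors supercommute because distinct
    c_j anticommute, while a T of one factor occupies positions disjoint from those of the other
    factor. *)
Lemma heckeC2_rel : srel (indact (B := B2) X code2 pos2 pos2').
Proof.
have [r1 r2 r12] := sact_rel X.
split; first split.
- exact: (Top_hecke_rel (off := 0) _ _ r1).
- exact: (Top_clifford_rel (off := 0)).
- split; first by apply: (Top_hecke_rel (off := m) _ _ r2) => // i; rewrite /= addnS.
  by apply: (Top_clifford_rel (off := m)) => // i; rewrite /= addnS.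
have TC a b : sact X (inl a) * sact X (inr b) = sact X (inr b) * sact X (inl a).
  by rewrite r12 mul1r.
move=> a b; rewrite /indact; apply: mulmx_vec_ext => v.
case: a b => [a|a] [b|b] /=; rewrite ?expr0 ?expr1 ?mul1r ?mulN1r ?mulNmx;
  rewrite -![opmx _ * _]/(opmx _ *m _) ?opmx_mul; try exact: Top_linear; try exact: Cop_linear.
- congr vec; apply: Top_comm; rewrite /= ?addnS //; last exact: TC.
  exact: leq_trans (hhi_subproof a) (leq_addr _ _).
- congr vec; apply: Top_Cop => //; apply/eqP => /(congr1 val) /= e.
    by have := ltn_ord (hlo a); rewrite /= -e ltnNge leq_addr.
  by have := ltn_ord (hhi a); rewrite /= -e ltnNge leq_addr.
- congr vec; apply/esym/Top_Cop; rewrite /= ?addnS //; apply/eqP => /(congr1 val) /= e.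
    by have := ltn_ord a; rewrite e ltnNge leq_addr.
  by have := ltn_ord a; rewrite e ltnNge leq_addr.
rewrite Cop_anti ?linearN //.
by apply/eqP => /(congr1 val) /= e; have := ltn_ord a; rewrite e ltnNge leq_addr.
Qed.

Definition hcind2 : smod K B2 := indmod pos2S odd2A odd2B heckeC2_rel.

Lemma hcind2_clifford (R : pzRingType) (x : sgen B2 -> R) : srel x ->
  clifford_gens incl2 cgen2 pos2 pos2' x.
Proof.
case=> -[_ /clifford_rel_gens[/= s1 a1 f1 l1 h1]] [_ /clifford_rel_gens[/= s2 a2 f2 l2 h2]] x12.
have C12 i j : x (inl (inr i)) * x (inr (inr j)) = - (x (inr (inr j)) * x (inl (inr i))).
  by rewrite x12 /= expr1 mulN1r.
split=> [j|i j|a j|[a|a]|[a|a]].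
- by case: (split_ordP j) => i ->; rewrite ?cgen2l ?cgen2r.
- case: (split_ordP i) => i0 ->; case: (split_ordP j) => j0 ->; rewrite ?cgen2l ?cgen2r => ij.
  + by apply: a1; apply: contraNneq ij => ->.
  + exact: C12.
  + by rewrite C12 opprK.
  by apply: a2; apply: contraNneq ij => ->.
- case: (split_ordP j) => j0 ->; case: a => a /=; rewrite ?cgen2l ?cgen2r => ja ja'.
  + by apply: f1; [apply: contraNneq ja => ->|apply: contraNneq ja' => ->].
  + by rewrite x12 /= mul1r.
  + by rewrite x12 /= mul1r.
  by apply: f2; [apply: contraNneq ja => ->|apply: contraNneq ja' => ->].
- by rewrite !cgen2l; apply: l1.
- by rewrite !cgen2r; apply: l2.
- by rewrite !cgen2l; apply: h1.
by rewrite !cgen2r; apply: h2.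
Qed.

Lemma hcind2_induced : induced incl2 X hcind2.
Proof. exact: (indmod_induced pos2S code2K code2_inj odd2A odd2B heckeC2_rel hcind2_clifford). Qed.

End TwoBlocks.
End InducedHecke.

(** * Induction, projectivity and outer products *)

Section InducedModules.
Variable K : fieldType.

(** The condition inside [induced] with its map exposed, because transitivity composes and factors
    these maps. *)
Definition induction_map (A B : salg) (phi : sgen A -> sgen B) (M : smod K A) (N : smod K B)
    (j : 'M[K]_(sdim N, sdim M)) : Prop :=
  [/\ intertw phi (M := M) (N := N) j, evenmap (M := M) (N := N) j
    & forall (L : smod K B) (f : 'M[K]_(sdim L, sdim M)), intertw phi (M := M) (N := L) f ->
        exists! g : 'M[K]_(sdim L, sdim N), @Defs.hom K B N L g /\ g *m j = f].

Lemma sact_grd (A : salg) (M : smod K A) (a : sgen A) i j :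
  sact M a i j != 0 -> spar (s := M) i = spar (s := M) j (+) sodd a.
Proof. by case: M i j => ? ? ? h ? i j; apply: h. Qed.

Section EvenPart.
Variables (A : salg) (M N : smod K A).
Implicit Type g : 'M[K]_(sdim N, sdim M).

(** The universal property of [induced] produces homomorphisms of no definite parity, while
    projectivity is about even ones. Actions are homogeneous, so the even part of a homomorphism is
    one again. *)
Definition evenpart g : 'M[K]_(sdim N, sdim M) :=
  \matrix_(i, j) (if spar (s := N) i == spar (s := M) j then g i j else 0).

Lemma evenpart_even g : evenmap (M := M) (N := N) (evenpart g).
Proof. by move=> i j; rewrite mxE; case: ifP => [/eqP//|_]; rewrite eqxx. Qed.

Lemma evenpart_id g : evenmap (M := M) (N := N) g -> evenpart g = g.
Proof.
move=> eg; apply/matrixP => i j; rewrite mxE; case: ifP => // /negbT ne.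
by apply/esym/eqP; apply: contraNT ne => /eg ->.
Qed.

Lemma evenpart_hom g : @Defs.hom K A M N g -> @Defs.hom K A M N (evenpart g).
Proof.
move=> hg a; apply/matrixP => i j; have := congr1 (fun X : 'M_(_, _) => X i j) (hg a).
rewrite !mxE => e.
have l : \sum_k evenpart g i k * sact M a k j =
   if spar (s := N) i == spar (s := M) j (+) sodd a then \sum_k g i k * sact M a k j else 0.
  case: ifP => ij; [apply: eq_bigr|apply: big1] => k _; rewrite mxE;
    have [->|/sact_grd ->] := eqVneq (sact M a k j) 0; rewrite ?mulr0 //.
    by rewrite ij.
  by rewrite ij mul0r.
have r : \sum_k sact N a i k * evenpart g k j =
   if spar (s := N) i == spar (s := M) j (+) sodd a then \sum_k sact N a i k * g k j else 0.
  case: ifP => ij; [apply: eq_bigr|apply: big1] => k _; rewrite mxE;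
    have [->|/sact_grd e1] := eqVneq (sact N a i k) 0; rewrite ?mul0r //.
    by move: ij; rewrite e1 (inj_eq (@addIb _)) => ->.
  by move: ij; rewrite e1 (inj_eq (@addIb _)) => ->; rewrite mulr0.
by rewrite l r e.
Qed.

Lemma evenpart_mul (C : salg) (P : smod K C) (j : 'M[K]_(sdim M, sdim P)) g :
  evenmap (M := P) (N := M) j -> evenmap (M := P) (N := N) (g *m j) ->
  evenpart g *m j = g *m j.
Proof.
move=> ej egj; apply/matrixP => i l.
have [e|ne] := eqVneq (spar (s := N) i) (spar (s := P) l); rewrite !mxE.
  apply: eq_bigr => k _; rewrite mxE.
  have [->|/ej ->] := eqVneq (j k l) 0; first by rewrite !mulr0.
  by rewrite e eqxx.
rewrite [LHS]big1 => [|k _]; last first.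
  rewrite mxE; have [->|/ej ->] := eqVneq (j k l) 0; first by rewrite mulr0.
  by rewrite (negbTE ne) mul0r.
apply/esym/eqP; apply: contraNT ne => nz; apply/eqP/egj; by rewrite mxE.
Qed.

End EvenPart.

(** The even part of g has the same composite with j as g itself, and uniqueness identifies the
    two. *)
Lemma induction_even (A B : salg) (phi : sgen A -> sgen B) (M : smod K A) (N L : smod K B)
    (j : 'M[K]_(sdim N, sdim M)) (g : 'M[K]_(sdim L, sdim N)) :
  induction_map phi j -> @Defs.hom K B N L g -> evenmap (M := M) (N := L) (g *m j) ->
  evenmap (M := N) (N := L) g.
Proof.
move=> [ij ej univ] hg egj.
have igj : intertw phi (M := M) (N := L) (g *m j).
  by move=> a; rewrite -mulmxA ij !mulmxA hg.
have [h [[hh hj] uniq]] := univ _ _ igj.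
have -> : g = evenpart (M := N) (N := L) g; last exact: evenpart_even.
transitivity h; [exact/esym/uniq|apply: uniq; split].
  exact: evenpart_hom.
exact: evenpart_mul.
Qed.

Section Restriction.
Variables (A B : salg) (phi : sgen A -> sgen B).
Hypothesis odd_phi : forall a, sodd (phi a) = sodd a.
Hypothesis rel_phi : forall (R : pzRingType) (x : sgen B -> R), srel x -> srel (x \o phi).
Variable L : smod K B.

Fact restr_grd a i j : sact L (phi a) i j != 0 ->
  spar (s := L) i = spar (s := L) j (+) sodd a.
Proof. by move/sact_grd; rewrite odd_phi. Qed.

Definition restr : smod K A := SMod restr_grd (rel_phi (sact_rel L)).

End Restriction.

(** Induction is left adjoint to restriction, which preserves surjections: lift over A, extend to B,
    and recover evenness from [induction_even]. *)
Lemma induction_projective (A B : salg) (phi : sgen A -> sgen B) (M : smod K A) (N : smod K B) :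
  (forall a, sodd (phi a) = sodd a) ->
  (forall (R : pzRingType) (x : sgen B -> R), srel x -> srel (x \o phi)) ->
  induced phi M N -> projective M -> projective N.
Proof.
move=> odd_phi rel_phi [j ind]; have [ij ej univ] := ind => pM P Q p f [hp ep] sp [hf ef].
have [] := pM (restr odd_phi rel_phi P) (restr odd_phi rel_phi Q) p (f *m j) _ sp.
- by split=> [a|//]; apply: hp.
- split=> [a|i l]; first by rewrite -mulmxA (ij a : j *m _ = _) !mulmxA (hf (phi a) : f *m _ = _).
  rewrite mxE => nz; have [k nzk] : exists k, f i k * j k l != 0.
    apply/existsP; apply: contraNT nz => /existsPn z; apply/eqP/big1 => k _.
    exact/eqP/negbNE/z.
  by move: nzk; rewrite mulf_eq0 negb_or => /andP[/ef -> /ej ->].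
move=> g [hg eg] pg; have [h [[hh hj] uniq]] := univ P g hg.
have eh : evenmap (M := N) (N := P) h by apply: (induction_even ind hh); rewrite hj.
exists h => //.
have ifj : intertw phi (M := M) (N := Q) (f *m j).
  by move=> a; rewrite -mulmxA (ij a : j *m _ = _) !mulmxA (hf (phi a) : f *m _ = _).
have [h' [_ uniq']] := univ Q _ ifj.
rewrite -(uniq' f) // -(uniq' (p *m h)) //; split; last by rewrite -mulmxA hj.
by move=> b; rewrite -mulmxA (hh b : h *m _ = _) !mulmxA (hp b : p *m _ = _).
Qed.

Lemma evenmap_mul (A B C : salg) (M : smod K A) (N : smod K B) (P : smod K C)
    (f : 'M[K]_(sdim N, sdim M)) (g : 'M[K]_(sdim P, sdim N)) :
  evenmap (M := M) (N := N) f -> evenmap (M := N) (N := P) g ->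
  evenmap (M := M) (N := P) (g *m f).
Proof.
move=> ef eg i l; rewrite mxE => nz.
have [k nzk] : exists k, g i k * f k l != 0.
  apply/existsP; apply: contraNT nz => /existsPn z; apply/eqP/big1 => k _.
  exact/eqP/negbNE/z.
by move: nzk; rewrite mulf_eq0 negb_or => /andP[/eg -> /ef ->].
Qed.

Section Transitivity.
Variables (A B C : salg) (phi : sgen A -> sgen B) (psi : sgen B -> sgen C).
Hypothesis odd_psi : forall b, sodd (psi b) = sodd b.
Hypothesis rel_psi : forall (R : pzRingType) (x : sgen C -> R), srel x -> srel (x \o psi).
Variables (M : smod K A) (N : smod K B) (P : smod K C).
Variables (j : 'M[K]_(sdim N, sdim M)).
Hypothesis indj : induction_map phi j.

Lemma induction_comp (l : 'M[K]_(sdim P, sdim N)) :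
  induction_map psi l -> induction_map (M := M) (N := P) (psi \o phi) (l *m j).
Proof.
have [ij ej uj] := indj => -[il el ul]; split.
- move=> a; rewrite -mulmxA (ij a : j *m _ = _) mulmxA (il (phi a) : l *m _ = _).
  by rewrite !mulmxA.
- exact: evenmap_mul.
move=> L f hf; have [g [[hg gj] ug]] := uj (restr odd_psi rel_psi L) f hf.
have [h [[hh hl] uh]] := ul L g hg; exists h; split; first by rewrite mulmxA hl.
move=> h' [hh' h'lj]; apply: uh; split=> //; apply/esym/ug; split; last by rewrite -mulmxA.
move=> b; rewrite -mulmxA (il b : l *m _ = _) !mulmxA; congr (_ *m _); exact: hh'.
Qed.

(** What remains of an induction along psi o phi after an induction along phi is an induction along
    psi. *)
Lemma induction_factor (k : 'M[K]_(sdim P, sdim M)) :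
  induction_map (M := M) (N := P) (psi \o phi) k -> exists l, induction_map (M := N) (N := P) psi l.
Proof.
have [ij ej uj] := indj => -[ik ek uk].
have [l [[hl lj] ul]] := uj (restr odd_psi rel_psi P) k ik.
have el : evenmap (M := N) (N := P) l.
  by apply: (induction_even (L := restr odd_psi rel_psi P) indj hl); rewrite lj.
exists l; split=> // L f hf.
have ifj : intertw (psi \o phi) (M := M) (N := L) (f *m j).
  by move=> a; rewrite -mulmxA (ij a : j *m _ = _) !mulmxA (hf (phi a) : f *m _ = _).
have [g [[hg gk] ug]] := uk L _ ifj; exists g; split.
  split=> //; have [f' [_ uf]] := uj (restr odd_psi rel_psi L) _ ifj.
  rewrite -(uf f) // -(uf (g *m l)) //; split; last by rewrite -mulmxA lj.
  move=> b; rewrite -mulmxA (hl b : l *m _ = _) !mulmxA; congr (_ *m _); exact: hg.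
by move=> g' [hg' g'l]; apply: ug; split=> //; rewrite -lj mulmxA g'l.
Qed.

End Transitivity.
End InducedModules.

Lemma loc_map (K : fieldType) d p d' p' (t : 'M[K]_d) (s : 'M[K]_d')
    (f : 'M[K]_(d, p) -> 'M[K]_(d', p')) w a b : linear f ->
  (forall B, f (t *m B) = s *m f B) ->
  f (loc t w a b) = loc s (fun x y => f (w x y)) a b.
Proof.
move=> lf ft; pose F : {linear 'M[K]_(d, p) -> 'M[K]_(d', p')} :=
  HB.pack f (GRing.isLinear.Build _ _ _ _ f lf).
by case: a b => [] []; rewrite /loc -[f]/(F : _ -> _) ?linearB ?linearN ?linearD -?[LHS]/(_) /= ?ft.
Qed.

Lemma col_mulmx (K : fieldType) p q r (A : 'M[K]_(p, q)) (B : 'M[K]_(q, r)) j :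
  col j (A *m B) = A *m col j B.
Proof. by rewrite !colE mulmxA. Qed.

(** * Outer products of induced modules *)

Section OuterInduction.
Variables (K : fieldType) (m k : nat).
Variables (M : smod K (hecke m)) (N : smod K (hecke k)) (X : smod K (stens (hecke m) (hecke k))).
Hypothesis evM : is_even M.
Local Notation I1 := {ffun 'I_m -> bool}.
Local Notation I2 := {ffun 'I_k -> bool}.
Local Notation I12 := {ffun 'I_(m + k) -> bool}.
Local Notation dM := (sdim M).
Local Notation dN := (sdim N).
Local Notation dX := (sdim X).

Definition ffl (J : I12) : I1 := [ffun i => J (lshift k i)].
Definition ffr (J : I12) : I2 := [ffun i => J (rshift m i)].
Definition ffjoin (I : I1) (I' : I2) : I12 :=
  [ffun i => match split i with inl a => I a | inr b => I' b end].

Lemma ffjoinK J : ffjoin (ffl J) (ffr J) = J.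
Proof.
by apply/ffunP => i; rewrite ffunE; case: (split_ordP i) => j ->; rewrite ?(unsplitK (inl j)) ?(unsplitK (inr j)) ffunE.
Qed.

Lemma ffl_join I I' : ffl (ffjoin I I') = I.
Proof. by apply/ffunP => i; rewrite !ffunE (unsplitK (inl i)). Qed.

Lemma ffr_join I I' : ffr (ffjoin I I') = I'.
Proof. by apply/ffunP => i; rewrite !ffunE (unsplitK (inr i)). Qed.

Lemma ffl_updl J i a : ffl (upd J (lshift k i) a) = upd (ffl J) i a.
Proof. by apply/ffunP => j; rewrite !ffunE eq_lshift. Qed.

Lemma ffr_updl J i a : ffr (upd J (lshift k i) a) = ffr J.
Proof. by apply/ffunP => j; rewrite !ffunE eq_rlshift. Qed.

Lemma ffl_updr J i a : ffl (upd J (rshift m i) a) = ffl J.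
Proof. by apply/ffunP => j; rewrite !ffunE eq_lrshift. Qed.

Lemma ffr_updr J i a : ffr (upd J (rshift m i) a) = upd (ffr J) i a.
Proof. by apply/ffunP => j; rewrite !ffunE eq_rshift. Qed.

Lemma below_lshift J j : below J (lshift k j) = below (ffl J) j.
Proof.
rewrite /below big_mkcond big_split_ord /= [X in (_ + X)%N]big1 ?addn0 => [|i _].
  by rewrite -big_mkcond; apply: eq_bigr => i _; rewrite ffunE.
by rewrite ltnNge (leq_trans (ltnW (ltn_ord j))) ?leq_addr.
Qed.

Lemma below_rshift J j : below J (rshift m j) = (\sum_i ffl J i + below (ffr J) j)%N.
Proof.
rewrite /below big_mkcond big_split_ord /=; congr (_ + _)%N.
  by apply: eq_bigr => i _; rewrite ffunE ltn_addr.
rewrite [RHS]big_mkcond; apply: eq_bigr => i _; by rewrite ltn_add2l ffunE.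
Qed.

Lemma parity_join J : parity J = parity (ffl J) (+) parity (ffr J).
Proof.
rewrite /parity big_split_ord oddD; congr (odd _ (+) odd _);
  by apply: eq_bigr => i _; rewrite ffunE.
Qed.

(** A tensor of the two induced modules is a matrix Y; this is its coefficient at c_I (x) c_I',
    itself a tensor of M and N. *)
Definition blk (Y : 'M[K]_(cdim m dM, cdim k dN)) (I : I1) (I' : I2) : 'M[K]_(dM, dN) :=
  \matrix_(a, b) Y (enum_rank (I, a)) (enum_rank (I', b)).

Lemma col_blk Y I I' b : col b (blk Y I I') = unvec (col (enum_rank (I', b)) Y) I.
Proof. by apply/colP => a; rewrite ffunE !mxE. Qed.

Lemma row_blk Y I I' a : col a (blk Y I I')^T = unvec ((row (enum_rank (I, a)) Y)^T) I'.
Proof. by apply/colP => b; rewrite ffunE !mxE. Qed.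

Lemma opmx_unvec n d (F : {ffun {ffun 'I_n -> bool} -> 'cV[K]_d} -> _) u : linear F ->
  opmx F *m u = vec (F (unvec u)).
Proof. by move=> lF; rewrite -{1}[u]unvecK opmxE. Qed.

Lemma blk_left F Y I I' b : linear F ->
  col b (blk (opmx F *m Y) I I') = F (unvec (col (enum_rank (I', b)) Y)) I.
Proof.
by move=> lF; rewrite col_blk col_mulmx opmx_unvec // vecK.
Qed.

Lemma blk_right F Y I I' a : linear F ->
  col a (blk (Y *m (opmx F)^T) I I')^T = F (unvec ((row (enum_rank (I, a)) Y)^T)) I'.
Proof.
by move=> lF; rewrite row_blk row_mul trmx_mul trmxK opmx_unvec // vecK.
Qed.

Lemma col_ext p q (A B : 'M[K]_(p, q)) : (forall j, col j A = col j B) -> A = B.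
Proof. by move=> AB; apply/matrixP => i j; have /colP/(_ i) := AB j; rewrite !mxE. Qed.

Lemma blk_Top_left i i' t Y I I' : blk (opmx (Top i i' t) *m Y) I I' =
  loc t (fun a b => blk Y (upd (upd I i a) i' b) I') (I i) (I i').
Proof.
apply: col_ext => b; rewrite blk_left; last exact: Top_linear.
rewrite TopE (loc_map (s := t) (f := col b)) => [||B]; last by rewrite col_mulmx.
  by congr (loc _ _ _ _); do 2 apply: funext => ?; rewrite col_blk.
by move=> a u v; apply/colP => x; rewrite !mxE.
Qed.

(** The second factor acts on the right by transposes, so [loc], which multiplies on the left, is
    applied to transposed blocks. *)
Lemma blk_Top_right i i' t Y I I' : (blk (Y *m (opmx (Top i i' t))^T) I I')^T =
  loc t (fun a b => (blk Y I (upd (upd I' i a) i' b))^T) (I' i) (I' i').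
Proof.
apply: col_ext => b; rewrite blk_right; last exact: Top_linear.
rewrite TopE (loc_map (s := t) (f := col b)) => [||B]; last by rewrite col_mulmx.
  by congr (loc _ _ _ _); do 2 apply: funext => ?; rewrite row_blk.
by move=> a u v; apply/colP => x; rewrite !mxE.
Qed.

Lemma blk_Cop_left j Y I I' : blk (opmx (Cop j) *m Y) I I' =
  (-1) ^+ (below I j + ~~ I j) *: blk Y (upd I j (~~ I j)) I'.
Proof.
apply: col_ext => b; rewrite blk_left; last exact: Cop_linear.
by rewrite CopE -col_blk; apply/colP => x; rewrite !mxE.
Qed.

Lemma blk_Cop_right j Y I I' : blk (Y *m (opmx (Cop j))^T) I I' =
  (-1) ^+ (below I' j + ~~ I' j) *: blk Y I (upd I' j (~~ I' j)).
Proof.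
apply: trmx_inj; apply: col_ext => b; rewrite blk_right; last exact: Cop_linear.
by rewrite CopE -row_blk; apply/colP => x; rewrite !mxE.
Qed.

Lemma blk_sign s Y I I' :
  blk (diag_mx (\row_x (-1) ^+ (s && cpar (@spar K _ M) x)) *m Y) I I' =
  (-1) ^+ (s && parity I) *: blk Y I I'.
Proof.
apply/matrixP => a b; rewrite !mxE (bigD1 (enum_rank (I, a))) //= !mxE eqxx mulr1n.
rewrite big1 ?addr0 => [|x ne]; first by rewrite /cpar enum_rankK /= evM addbF.
by rewrite !mxE eq_sym (negbTE ne) mulr0n mul0r.
Qed.

(** The isomorphism sends (c_I (x) u) (x) (c_I' (x) v) to c_(I,I') (x) (u (x) v). As M is purely
    even, c_I' crosses u without a sign, and the Koszul sign of a Clifford generator of the second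
    factor is the parity of I, which is the first summand in [below_rshift]. *)
Theorem outer_induction : outer M N X -> outer (hcind M) (hcind N) (hcind2 X).
Proof.
case=> phi [lphi [psi phiK psiK] phi1 phi2 phi_even].
(* 0-Hecke generators are even, so the sign matrix of [outer] is the identity. *)
have phi2' b Y : phi (Y *m (sact N b)^T) = sact X (inr b) *m phi Y.
  rewrite -phi2; congr (phi (_ *m _)); rewrite (_ : diag_mx _ = 1%:M) ?mul1mx //.
  by apply/matrixP => i j; rewrite !mxE.
pose F : {linear 'M[K]_(dM, dN) -> 'cV[K]_dX} :=
  HB.pack phi (GRing.isLinear.Build _ _ _ _ phi lphi).
pose G Y : {ffun I12 -> 'cV[K]_dX} := [ffun J => F (blk Y (ffl J) (ffr J))].
pose Gi (v : {ffun I12 -> 'cV[K]_dX}) : 'M[K]_(cdim m dM, cdim k dN) := \matrix_(x, y)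
  psi (v (ffjoin (enum_val x).1 (enum_val y).1)) (enum_val x).2 (enum_val y).2.
have GK : cancel G Gi.
  move=> Y; apply/matrixP => x y; rewrite mxE ffunE -[F _]/(phi _) phiK ffl_join ffr_join mxE.
  by rewrite -!surjective_pairing !enum_valK.
have GiK : cancel Gi G.
  move=> v; apply/ffunP => J; rewrite ffunE -[F _]/(phi _) -[RHS]psiK; congr (phi _).
  by apply/matrixP => a b; rewrite !mxE !enum_rankK ffjoinK.
exists (fun Y => vec (G Y)); split.
- move=> a Y Z; rewrite -linearP; congr vec; apply/ffunP => J; rewrite !ffunE -linearP.
  by congr (F _); apply/matrixP => b c; rewrite !mxE.
- exists (fun u => Gi (unvec u)) => u; first by rewrite vecK GK.
  by rewrite GiK unvecK.
- move=> [a|j] Y; rewrite opmxE; try exact: Top_linear; try exact: Cop_linear;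
    congr vec; apply/ffunP => J; rewrite ffunE.
    rewrite blk_Top_left (loc_map (s := sact X (inl a)) (f := F)) ?TopE; last exact: phi1.
      congr (loc _ _ _ _); rewrite ?ffunE //; do 2 apply: funext => ?.
      by rewrite ffunE !ffl_updl !ffr_updl.
    exact: linearP.
  by rewrite blk_Cop_left linearZ CopE below_lshift !ffunE ffl_updl ffr_updl.
- move=> [a|j] Y; rewrite opmxE; try exact: Top_linear; try exact: Cop_linear;
    congr vec; apply/ffunP => J; rewrite ffunE.
    rewrite -[blk _ _ _]trmxK blk_Top_right.
    rewrite (loc_map (s := sact X (inr a)) (f := fun Z => F Z^T)) ?TopE => [||B].
    + congr (loc _ _ _ _); rewrite ?ffunE //; do 2 apply: funext => ?.
      by rewrite trmxK blk_sign scale1r ffunE !ffl_updr !ffr_updr.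
    + by move=> b Y1 Y2; rewrite linearP linearP.
    by rewrite trmx_mul; apply: phi2'.
  rewrite blk_Cop_right blk_sign scalerA [LHS]linearZ CopE below_rshift !ffunE ffl_updr ffr_updr.
  congr (_ *: _); rewrite -addnA [RHS]exprD [RHS]mulrC; congr (_ * _).
  by rewrite -[in RHS]signr_odd.
move=> x y z; rewrite mxE ffunE.
have -> : blk (delta_mx x y) (ffl (enum_val z).1) (ffr (enum_val z).1) =
    (if (ffl (enum_val z).1 == (enum_val x).1) && (ffr (enum_val z).1 == (enum_val y).1)
     then delta_mx (enum_val x).2 (enum_val y).2 else 0).
  apply/matrixP => a b; rewrite !mxE -{1}[x]enum_valK -{1}[y]enum_valK.
  rewrite !(inj_eq enum_rank_inj) [enum_val x]surjective_pairing [enum_val y]surjective_pairing.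
  by rewrite !xpair_eqE /=; case: (ffl _ == _); case: (ffr _ == _); rewrite ?andbF ?mxE.
case E: ((ffl _ == _) && _); last by rewrite linear0 mxE eqxx.
have /andP[/eqP e1 /eqP e2] := E.
move/phi_even => /= e; rewrite /cpar /= e parity_join e1 e2.
by rewrite -!addbA; congr (_ (+) _); rewrite addbCA.
Qed.

End OuterInduction.

(** * The trivial module *)

Section LongestWord.
Variables (R : pzRingType) (P : nat -> R).
Hypothesis P_idem : forall i, P i * P i = P i.
Hypothesis P_comm : forall i j, (i.+1 < j)%N -> P i * P j = P j * P i.
Hypothesis P_braid : forall i, P i * P i.+1 * P i = P i.+1 * P i * P i.+1.

(** [long_word m] is (P_0 ... P_(m-1)) (P_0 ... P_(m-2)) ... (P_0), a reduced word of the longest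
    element on m generators. *)
Definition row_word m : R := \prod_(i < m) P i.
Fixpoint long_word m : R := if m is m'.+1 then row_word m * long_word m' else 1.

Lemma row_word_comm i m : (m <= i)%N -> P i.+1 * row_word m = row_word m * P i.+1.
Proof.
elim: m => [|m IH] mi; first by rewrite /row_word big_ord0 mulr1 mul1r.
rewrite /row_word big_ord_recr /= -/(row_word m) mulrA IH; last exact: ltnW.
by rewrite -!mulrA (@P_comm m).
Qed.

Lemma row_word_shift i m : (i.+1 < m)%N -> P i.+1 * row_word m = row_word m * P i.
Proof.
elim: m => // m IH; rewrite ltnS leq_eqVlt => /predU1P[<-|im]; last first.
  rewrite /row_word big_ord_recr /= -/(row_word m) mulrA IH //.
  by rewrite -!mulrA P_comm.
rewrite /row_word !big_ord_recr /= -/(row_word i) !mulrA row_word_comm //.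
by rewrite -!mulrA; congr (_ * _); rewrite !mulrA P_braid.
Qed.

(** P_0 disappears into the first row by idempotence; P_(i+1) crosses that row, becomes P_i, and
    meets the shorter word. *)
Lemma long_word_absorb i m : (i < m)%N -> P i * long_word m = long_word m.
Proof.
elim: m i => // m IH [|i] im /=.
  by rewrite mulrA /row_word big_ord_recl mulrA P_idem.
by rewrite mulrA row_word_shift // -mulrA IH.
Qed.

End LongestWord.

Lemma addmxE (V : zmodType) p q (A B : 'M[V]_(p, q)) i j : (A + B) i j = A i j + B i j.
Proof. exact: mxE. Qed.

Lemma oppmxE (V : zmodType) p q (A : 'M[V]_(p, q)) i j : (- A) i j = - A i j.
Proof. exact: mxE. Qed.

Section TrivialModule.
Variables (K : fieldType) (n : nat).
Local Notation triv a := (simple_mod K n [:: a]).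

Lemma simple_sact al (i : 'I_n.-1) :
  sact (simple_mod K n al) i = (if i.+1 \in descs al then -1 else 0)%:M.
Proof. by []. Qed.

Lemma triv_sact a i : sact (triv a) i = 0.
Proof. by rewrite simple_sact /= raddf0. Qed.

(** The value 1 outside the range of the generators keeps the relations of [LongestWord] true for
    all natural indices; at the edge the braid relation reduces to idempotence. *)
Definition pi_act (M : smod K (hecke n)) (i : nat) : 'M[K]_(sdim M) :=
  if insub i is Some j then 1 + sact M (j : 'I_n.-1) else 1.

Lemma pi_actE M (i : 'I_n.-1) : pi_act M i = 1 + sact M i.
Proof. by rewrite /pi_act valK. Qed.

Lemma pi_act_out M i : (n.-1 <= i)%N -> pi_act M i = 1.
Proof. by move=> le; rewrite /pi_act insubF // ltnNge le. Qed.

Lemma pi_act_rel M : [/\ forall i, pi_act M i * pi_act M i = pi_act M i,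
  forall i j, (i.+1 < j)%N -> pi_act M i * pi_act M j = pi_act M j * pi_act M i
  & forall i, pi_act M i * pi_act M i.+1 * pi_act M i =
              pi_act M i.+1 * pi_act M i * pi_act M i.+1].
Proof.
have [tsq tcomm tbraid] := sact_rel M.
have idem i : pi_act M i * pi_act M i = pi_act M i.
  have [lt|ge] := ltnP i n.-1; last by rewrite pi_act_out // mulr1.
  rewrite -[i]/(val (Ordinal lt)) pi_actE mulrDl mul1r mulrDr mulr1 tsq.
  by rewrite subrr addr0.
split=> // [i j ij|i].
  have [lti|ge] := ltnP i n.-1; last by rewrite (pi_act_out _ ge) mulr1 mul1r.
  have [ltj|ge] := ltnP j n.-1; last by rewrite (pi_act_out _ ge) mulr1 mul1r.
  rewrite -[i]/(val (Ordinal lti)) -[j]/(val (Ordinal ltj)) !pi_actE.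
  have ab : GRing.comm (sact M (Ordinal lti)) (sact M (Ordinal ltj)) by apply: tcomm.
  by apply: commrD; [exact: commr1|apply/commr_sym/commrD; [exact: commr1|exact/commr_sym]].
have [lti|ge] := ltnP i.+1 n.-1; last by rewrite (pi_act_out _ ge) !mulr1 mul1r idem.
have lti' := ltnW lti.
rewrite -[i.+1]/(val (Ordinal lti)) -[X in pi_act M X]/(val (Ordinal lti')) !pi_actE.
have := tbraid (Ordinal lti') (Ordinal lti) erefl.
have := tsq (Ordinal lti'); have := tsq (Ordinal lti).
move: (sact M (Ordinal lti)) (sact M (Ordinal lti')) => b a bb aa aba.
rewrite !(mulrDl, mulrDr) !mulr1 !mul1r aba aa bb.
by apply/matrixP => r s; rewrite !(addmxE, oppmxE); ring.
Qed.

Definition pi_long (M : smod K (hecke n)) : 'M[K]_(sdim M) := long_word (pi_act M) n.-1.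

Lemma sact_pi_long (M : smod K (hecke n)) (i : 'I_n.-1) : sact M i *m pi_long M = 0.
Proof.
have [idem comm braid] := pi_act_rel M.
have := long_word_absorb idem comm braid (ltn_ord i); rewrite -/(pi_long M) pi_actE.
by rewrite mulrDl mul1r => /(canRL (addKr _)); rewrite addNr.
Qed.

(** Two modules at once, so that a homomorphism can be carried past the whole word. *)
Lemma long_word_ind (M N : smod K (hecke n)) (Q : 'M[K]_(sdim M) -> 'M[K]_(sdim N) -> Prop) :
  Q 1 1 -> (forall A A' B B', Q A A' -> Q B B' -> Q (A * B) (A' * B')) ->
  (forall i, Q (1 + sact M i) (1 + sact N i)) -> Q (pi_long M) (pi_long N).
Proof.
move=> Q1 QM Qs; rewrite /pi_long; elim: n.-1 => //= m IH; apply: (QM) => //.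
apply: (big_ind2 Q) => // i _.
by rewrite /pi_act; case: insubP.
Qed.

(* The T_i + 1 satisfy the braid relations and are idempotent, so their product along
   the longest word maps a lift of the generator to an invariant lift. *)
Lemma triv_projective a : projective (triv a).
Proof.
move=> M N p f [hp ep] sp [hf ef].
have [v0 pv0] : exists v : 'M[K]_(sdim M, 1), p *m v = f.
  by have [v ->] := sp f; exists v.
(* The preimage v0 need not be homogeneous; as p and f are even, its even part is still a
   preimage. *)
pose v := evenpart (M := triv a) (N := M) v0.
have pv : p *m v = f.
  have ef' : evenmap (M := triv a) (N := N) (p *m v0) by rewrite pv0.
  rewrite -pv0 -(evenpart_id ef'); apply/matrixP => i l; rewrite !mxE.
  case: ifP => /eqP e; [apply: eq_bigr|apply: big1] => k _; rewrite mxE;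
    have [->|/ep e1] := eqVneq (p i k) 0; rewrite ?mul0r // -e1; case: eqP => //.
  by rewrite mulr0.
exists (pi_long M *m v); first split.
- by move=> i; rewrite triv_sact mulmx0 mulmxA sact_pi_long mul0mx.
- apply: evenmap_mul; first exact: evenpart_even.
  pose Q (A B : 'M[K]_(sdim M)) := evenmap (M := M) (N := M) A.
  suff : Q (pi_long M) (pi_long M) by [].
  apply: (long_word_ind (Q := Q)) => [i j|A A' B B' eA eB|i].
  + by rewrite mxE; case: (i =P j) => [->|] //; rewrite eqxx.
  + exact: evenmap_mul.
  move=> j l; rewrite !mxE; case: (j =P l) => [->//|_]; rewrite add0r => /sact_grd ->.
  by rewrite addbF.
have -> : p *m (pi_long M *m v) = pi_long N *m f.
  rewrite mulmxA -pv mulmxA; congr (_ *m _).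
  pose Q (A : 'M[K]_(sdim M)) (B : 'M[K]_(sdim N)) := p *m A = B *m p.
  suff : Q (pi_long M) (pi_long N) by [].
  apply: (long_word_ind (Q := Q)) => [|A A' B B' eA eB|i]; rewrite /Q ?mulmx1 ?mul1mx //.
    by rewrite -[A * B]/(A *m B) mulmxA eA -mulmxA eB mulmxA.
  by rewrite mulmxDr mulmxDl mulmx1 mul1mx hp.
pose Q (A B : 'M[K]_(sdim N)) := A *m f = f.
suff : Q (pi_long N) (pi_long N) by [].
apply: (long_word_ind (Q := Q)) => [|A A' B B' eA eB|i]; rewrite /Q ?mul1mx //.
  by rewrite -[A * B]/(A *m B) -mulmxA eB eA.
rewrite mulmxDl mul1mx -hf triv_sact mulmx0 addr0 //.
Qed.

Lemma triv_pmod a : pmod_class (triv a).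
Proof. by split=> //; apply: triv_projective. Qed.

Lemma triv_cover a : proj_cover (triv a) (triv a).
Proof.
split; first exact: triv_projective.
exists 1%:M; split=> [|w|Y g _].
- split=> [i|i j _ //]; by rewrite mulmx1 mul1mx.
- by exists w; rewrite mul1mx.
by rewrite mul1mx.
Qed.

End TrivialModule.

(** * Homomorphisms out of the induced trivial module *)

Section HomSpace.
Variables (K : fieldType) (A : salg) (M N : smod K A).

Definition hom_defect (a : sgen A) (f : 'M[K]_(sdim N, sdim M)) : 'M[K]_(sdim N, sdim M) :=
  f *m sact M a - sact N a *m f.

Fact hom_defect_linear a : linear (hom_defect a).
Proof.
move=> c f g; rewrite /hom_defect mulmxDl mulmxDr -scalemxAl -scalemxAr.
by rewrite scalerBr opprD addrACA.
Qed.

HB.instance Definition _ a := GRing.isLinear.Build K _ _ _ (hom_defect a) (hom_defect_linear a).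

Definition homspace : {vspace 'M[K]_(sdim N, sdim M)} :=
  (\bigcap_(a : sgen A) lker (linfun (hom_defect a)))%VS.

Lemma homdimE : homdim M N = \dim homspace. Proof. by []. Qed.

Lemma homspaceP f : reflect (@Defs.hom K A M N f) (f \in homspace).
Proof.
rewrite memvE; apply: (iffP subv_bigcapP) => h a; last move=> _.
  have := h a isT; rewrite -memvE memv_ker lfunE /= => /eqP.
  by move/(canRL (subrK _)); rewrite add0r.
by rewrite -memvE memv_ker lfunE /= /hom_defect h subrr.
Qed.

End HomSpace.

Section InvariantVectors.
Variables (K : fieldType) (n : nat) (al : seq nat).
Local Notation S := (simple_mod K n al).
Local Notation I := {ffun 'I_n -> bool}.

(** The kernel of T on the four patterns at two neighbouring positions, according to whether T acts
    on S_al by -1 or by 0. *)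
Lemma simple_Top (i : 'I_n.-1) (v : {ffun I -> 'cV[K]_1}) (J : I) :
  Top (hlo i) (hhi i) (sact S i) v = 0 ->
  forall a : bool, let w (a b : bool) := v (upd (upd J (hlo i) a) (hhi i) b) in
  if i.+1 \in descs al then w false false = w true true /\ w true false = - w false true
  else w a true = 0.
Proof.
move=> T0 a w; rewrite simple_sact in T0.
have E x y : loc (if i.+1 \in descs al then -1 else 0)%:M w x y = 0.
  have := Top_upd (erefl : hhi i = (hlo i).+1 :> nat) (if i.+1 \in descs al then -1 else 0)%:M v J x y.
  by rewrite T0 ffunE => <-.
case: ifP E => _ E.
  have := E false false; rewrite /loc mul_scalar_mx scaleN1r addrC => /subr0_eq <-.
  split=> //; have := E false true.
  by rewrite /loc mul_scalar_mx scaleN1r => /subr0_eq /(canRL (@opprK _)) ->.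
case: a; have := E true false; rewrite /loc mul_scalar_mx scale0r add0r // => _.
by have := E false false; rewrite /loc mul_scalar_mx scale0r add0r.
Qed.

(** The non-descent x - 1 kills the components with the middle one of three bits set, and the
    descent x equates every other component, up to sign, with one of those. *)
Lemma peak_no_invariant x : (1 < x < n)%N -> x \in descs al -> x.-1 \notin descs al ->
  forall v : {ffun I -> 'cV[K]_1},
  (forall i : 'I_n.-1, Top (hlo i) (hhi i) (sact S i) v = 0) -> v = 0.
Proof.
case: x => [|[|x]] // /andP[_ ltx] xD x'D v T0; rewrite /= in x'D.
have lt1 : (x < n.-1)%N by lia.
have lt2 : (x.+1 < n.-1)%N by lia.
pose i1 : 'I_n.-1 := Ordinal lt1; pose i2 : 'I_n.-1 := Ordinal lt2.
have e12 : hlo i2 = hhi i1 by apply: val_inj.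
have z (J : I) : J (hhi i1) -> v J = 0.
  move=> J1; have := simple_Top J (T0 i1) (J (hlo i1)).
  by rewrite /= (negbTE x'D) upd_id // upd_id.
apply/ffunP => J; rewrite ffunE.
have := simple_Top J (T0 i2) true; rewrite /= xD => -[w1 w2].
have z1 b : v (upd (upd J (hlo i2) true) (hhi i2) b) = 0.
  have ne : (hhi i1 == hhi i2) = false by apply/eqP => /(congr1 val) /=; lia.
  by apply: z; rewrite -e12 !updE e12 ne eqxx.
case Jlo: (J (hlo i2)); first by apply: z; rewrite -e12.
case Jhi: (J (hhi i2)).
  have : v (upd (upd J (hlo i2) false) (hhi i2) true) = 0.
    by apply/eqP; rewrite -oppr_eq0 -w2 z1.
  by rewrite (upd_id Jlo) (upd_id Jhi).
by have := w1; rewrite z1 (upd_id Jlo) (upd_id Jhi).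
Qed.

End InvariantVectors.

Section TrivialHoms.
Variables (K : fieldType) (n : nat) (a : nat) (P : smod K (heckeC n)).
Local Notation triv := (simple_mod K n [:: a]).
Variable j : 'M[K]_(sdim P, sdim triv).
Hypothesis indP : induction_map (@hincl n) j.
Local Notation I := {ffun 'I_n -> bool}.

(** The generator of the trivial module is killed by every T_i, hence so is its image under g. *)
Lemma triv_hom_invariant (M : smod K (hecke n)) (g : 'M[K]_(sdim (hcind M), sdim P)) (i : 'I_n.-1) :
  @Defs.hom K (heckeC n) P (hcind M) g ->
  Top (hlo i) (hhi i) (sact M i) (unvec (g *m j : 'cV_ _)) = 0.
Proof.
have [ij _ _] := indP => hg; apply: (can_inj (@vecK _ _ _)).
rewrite -opmx_unvec; last exact: Top_linear.
have := congr1 (fun X => X *m j) (hg (inl i)).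
rewrite -[sact (hcind M) (inl i)]/(opmx (Top (hlo i) (hhi i) (sact M i))) => e.
rewrite linear0 mulmxA -e -mulmxA -(ij i : j *m sact triv i = sact P (inl i) *m j).
by rewrite triv_sact !mulmx0.
Qed.

Lemma homdim_peak (al : seq nat) x : (1 < x < n)%N -> x \in descs al -> x.-1 \notin descs al ->
  homdim P (hcind (simple_mod K n al)) = 0%N.
Proof.
move=> ltx xD x'D; rewrite homdimE; apply/eqP; rewrite dimv_eq0 -subv0; apply/subvP => g.
move=> /homspaceP hg; rewrite memv0.
have gj : g *m j = 0.
  have inv i := triv_hom_invariant i hg.
  have := peak_no_invariant ltx xD x'D inv => e.
  by rewrite -[g *m j]unvecK [unvec _]e linear0.
have [_ _ univ] := indP.
have [|h [_ uh]] := univ (hcind (simple_mod K n al)) 0.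
  by move=> i; rewrite mul0mx mulmx0.
rewrite -(uh g) ?(uh 0) //; split=> // [b|]; first by rewrite mul0mx mulmx0.
by rewrite mul0mx.
Qed.

End TrivialHoms.

Section TrivialEndomorphisms.
Variables (K : fieldType) (n0 a a' : nat).
Local Notation n := n0.+1.
Local Notation triv := (simple_mod K n [:: a]).
Local Notation triv' := (simple_mod K n [:: a']).
Variables (P : smod K (heckeC n)) (j : 'M[K]_(sdim P, sdim triv)).
Hypothesis indP : induction_map (@hincl n) j.
Local Notation I := {ffun 'I_n -> bool}.
Local Notation L := (hcind triv').

(** The sets indexing 1 and c_1. When T_i acts by 0 on the simple module, it kills v exactly if v
    vanishes wherever the bit at [hhi i] is set; hence only the first bit may be set, and the
    invariants have dimension 2. *)
Definition at0 (b : bool) : I := [ffun k => (k == ord0) && b].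

Lemma hhi_at0 (i : 'I_n.-1) b : at0 b (hhi i) = false.
Proof. by rewrite ffunE. Qed.

Definition eval0 (g : 'M[K]_(sdim L, sdim P)) : 'rV[K]_2 :=
  \row_(b < 2) unvec (g *m j : 'cV_(cdim n 1)) (at0 (b == 1%N :> nat)) 0 0.

Fact eval0_linear : linear eval0.
Proof.
move=> c f g; apply/rowP => b; rewrite !mxE mulmxDl -scalemxAl.
by rewrite [unvec _]linearP !ffunE !mxE.
Qed.

HB.instance Definition _ := GRing.isLinear.Build K _ _ _ eval0 eval0_linear.

Lemma hom_eval0_eq0 g : @Defs.hom K _ P L g -> eval0 g = 0 -> g = 0.
Proof.
move=> hg g0; set v := unvec (g *m j : 'cV_(cdim n 1)).
have gj : g *m j = 0.
  suff v0 : v = 0 by rewrite -[g *m j]unvecK -/v v0 linear0.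
  apply/ffunP => J; rewrite [RHS]ffunE; case: (pickP (fun k : 'I_n => (k != ord0) && J k)) => [k|no].
    case/andP=> k0 Jk; have lti : (k.-1 < n.-1)%N by have := ltn_ord k; case: k k0 {Jk} => [[|k]].
    pose i : 'I_n.-1 := Ordinal lti.
    have ki : hhi i = k by apply: val_inj; rewrite /= prednK // lt0n.
    have := simple_Top J (triv_hom_invariant indP i hg) (J (hlo i)).
    have Jhi : J (hhi i) = true by rewrite ki.
    by rewrite /= (upd_id (erefl (J (hlo i)))) (upd_id Jhi).
  have -> : J = at0 (J ord0).
    apply/ffunP => k; rewrite ffunE; have := no k; case: eqP => [->//|_ /=]; by move=> ->.
  apply/colP => z; rewrite !ord1 [RHS]mxE.
  have /rowP/(_ (inord (J ord0))) := g0; rewrite !mxE -/v inordK; last by case: (J ord0).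
  by case: (J ord0).
have [_ _ univ] := indP; have [|h [_ uh]] := univ L 0.
  by move=> i; rewrite mul0mx mulmx0.
rewrite -(uh g) ?(uh 0) //; split=> // [b|]; first by rewrite mul0mx mulmx0.
by rewrite mul0mx.
Qed.

Lemma hom_eval0_surj r : exists2 g, @Defs.hom K _ P L g & eval0 g = r.
Proof.
(* The combination of 1 and c_1 with coefficients r; no T_i sees it, since [hhi i] is never the
   first position. *)
pose v : {ffun I -> 'cV[K]_1} := [ffun J =>
  if J == at0 false then (r 0 0)%:M else if J == at0 true then (r 0 1)%:M else 0].
have v0 (i : 'I_n.-1) (J : I) : J (hhi i) -> v J = 0.
  by move=> Ji; rewrite ffunE !ifN //; apply: contraTneq Ji => ->; rewrite hhi_at0.
have [_ _ univ] := indP; have [|g [[hg gj] _]] := univ L (vec v).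
  move=> i; rewrite triv_sact mulmx0.
  rewrite -[sact L _]/(opmx (Top (hlo i) (hhi i) (sact triv' i))) opmxE; last exact: Top_linear.
  suff -> : Top (hlo i) (hhi i) (sact triv' i) v = 0 by rewrite linear0.
  have z (J : I) : v (upd J (hhi i) true) = 0 by rewrite (v0 i) // upd_same.
  apply/ffunP => J; rewrite TopE triv_sact ffunE; case: (J (hlo i)) (J (hhi i)) => [] [];
    by rewrite /loc ?z // !(mul0mx, oppr0, addr0).
exists g => //; apply/rowP => b; rewrite mxE gj vecK ffunE.
have ne : at0 true == at0 false = false.
  by apply/eqP => /ffunP/(_ ord0); rewrite !ffunE.
case: b => [[|[|b]] ltb] //=; rewrite ?eqxx ?ne ?eqxx mxE eqxx mulr1n;
  by congr (r _ _); apply: val_inj.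
Qed.

Lemma homdim_triv : homdim P L = 2%N.
Proof.
rewrite homdimE -(@limg_dim_eq _ _ _ (linfun eval0)).
  suff -> : (linfun eval0 @: homspace P L)%VS = fullv by rewrite dimvf.
  apply/vspaceP => r; rewrite memvf.
  have [g hg <-] := hom_eval0_surj r; rewrite -[eval0 g](lfunE eval0).
  by apply: memv_img; apply/homspaceP.
apply/eqP; rewrite -subv0; apply/subvP => g; rewrite memv_cap memv_ker lfunE /= => /andP[gE /eqP g0].
have hg := elimT (homspaceP g) gE.
by rewrite memv0 (hom_eval0_eq0 hg g0).
Qed.

End TrivialEndomorphisms.

Lemma cdim0 : cdim 0 1 = 1%N.
Proof. by rewrite /cdim card_prod card_ffun !card_ord expn0. Qed.

(** * Ind and the Cartan map respect products *)

Section GrothendieckInduction.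
Variable K : fieldType.

Lemma hincl_odd n (i : sgen (hecke n)) : sodd (hincl i) = sodd i.
Proof. by []. Qed.

Lemma hincl_rel n (R : pzRingType) (x : sgen (heckeC n) -> R) :
  srel x -> srel (s := hecke n) (x \o @hincl n).
Proof. by case. Qed.

Lemma heckeC_emb_odd m k (g : sgen (stens (heckeC m) (heckeC k))) :
  sodd (heckeC_emb g) = sodd g.
Proof. by case: g => [[]|[]]. Qed.

Lemma heckeC_emb_rel m k (R : pzRingType) (x : sgen (heckeC (m + k)) -> R) :
  srel x -> srel (s := stens (heckeC m) (heckeC k)) (x \o @heckeC_emb m k).
Proof.
case=> -[tsq tcomm tbraid] [csq canti far lo hi]; split.
- split; split=> /=.
  + by move=> i; apply: tsq.
  + by move=> i i' ii'; apply: tcomm.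
  + by move=> i i' ii'; apply: tbraid.
  + by move=> i; apply: csq.
  + by move=> i i' ii'; apply: canti; rewrite (inj_eq (@lshift_inj _ _)).
  + by move=> i c ci ci'; apply: far.
  + by move=> i c c' ci ci'; apply: lo.
  + by move=> i c c' ci ci'; apply: hi.
- split; split=> /=.
  + by move=> i; apply: tsq.
  + by move=> i i' ii'; apply: tcomm; rewrite /= -addnS ltn_add2l.
  + by move=> i i' ii'; apply: tbraid; rewrite /= ii' addnS.
  + by move=> i; apply: csq.
  + by move=> i i' ii'; apply: canti; rewrite (inj_eq (@rshift_inj _ _)).
  + by move=> i c ci ci'; apply: far; rewrite /= -?addnS eqn_add2l.
  + by move=> i c c' ci ci'; apply: lo; rewrite /= ?ci ?ci' ?addnS.
  + by move=> i c c' ci ci'; apply: hi; rewrite /= ?ci ?ci' ?addnS.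
move=> [i|c] [i'|c'] /=; rewrite ?expr0 ?expr1 ?mul1r ?mulN1r.
- by apply: tcomm => /=; have := hhi_subproof i; rewrite -(ltn_add2r i' _ m); lia.
- by apply: far; rewrite /=; have := hhi_subproof i; lia.
- by apply/esym/far; rewrite /=; have := ltn_ord c; lia.
apply: canti; by rewrite eq_lrshift.
Qed.

(** The routes from H_m (x) H_k to HC_(m+k) through H_(m+k) and through HC_m (x) HC_k agree on
    generators. The first is a composite of inductions, so [induction_factor] applies to the
    second. *)
Lemma hcind_transitive m k (X : smod K (stens (hecke m) (hecke k))) (L : smod K (hecke (m + k))) :
  induced (@temb hecke_tower m k) X L ->
  induced (@temb heckeC_tower m k) (hcind2 X) (hcind L).
Proof.
move=> [l1 ind1]; have [l2 ind2] := hcind_induced L; have [l3 ind3] := hcind2_induced X.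
apply: (induction_factor (@heckeC_emb_odd m k) (@heckeC_emb_rel m k) ind3 (k := l2 *m l1)).
have -> : @heckeC_emb m k \o @incl2 m k = @hincl (m + k) \o @temb hecke_tower m k.
  by apply: funext => -[i|i].
exact: (induction_comp (@hincl_odd (m + k)) (@hincl_rel (m + k)) ind1).
Qed.

Lemma hcind_projective n (M : smod K (hecke n)) : projective M -> projective (hcind M).
Proof.
move=> pM; apply: (induction_projective (@hincl_odd n) (@hincl_rel n) (hcind_induced M) pM).
Qed.

Variable Ind : {linear K0 K -> K0s K}.
Hypothesis IndP : is_Ind Ind.

Lemma Ind_pcls n (M : smod K (hecke n)) (hM : pmod_class M) :
  Ind (pcls hM) = spcls (hcind_projective hM.2).
Proof. exact/IndP/hcind_induced. Qed.

(** Linearity reduces [bilin_ext] to classes of modules, where [outer_induction], using that M is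
    even, and [hcind_transitive] supply the two halves of a product. *)
Lemma Ind_bmul u v w : bmul (K0_bialg K) u v w -> bmul (K0s_bialg K) (Ind u) (Ind v) (Ind w).
Proof.
elim=> [? ? ? [m k M N X L hM hN hL oX iL]|c x x' y z z' _ IH1 _ IH2|c x y y' z z' _ IH1 _ IH2].
- rewrite -[gcls hM]/(pcls hM) -[gcls hN]/(pcls hN) -[gcls hL]/(pcls hL) !Ind_pcls.
  apply: BilinBase; apply: (GMul (T := heckeC_tower)).
    exact: outer_induction hM.1 oX.
  exact: hcind_transitive.
- by rewrite !linearP; apply: BilinLeft.
by rewrite !linearP; apply: BilinRight.
Qed.

Lemma Ind_bone u : bone (K0_bialg K) u -> bone (K0s_bialg K) (Ind u).
Proof.
move=> [M [hM [d1 ->]]]; rewrite -[gcls hM]/(pcls hM) Ind_pcls.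
exists (hcind M), (hcind_projective hM.2); split=> //.
by rewrite -[sdim _]/(cdim 0 (sdim M)) d1 cdim0.
Qed.

Variable chi : {linear K0s K -> G0s K}.
Hypothesis chiP : is_Cartan chi.

Lemma chi_bmul u v w : bmul (K0s_bialg K) u v w -> bmul (G0s_bialg K) (chi u) (chi v) (chi w).
Proof.
elim=> [? ? ? [m k M N X L hM hN hL oX iL]|c x x' y z z' _ IH1 _ IH2|c x y y' z z' _ IH1 _ IH2].
- rewrite -[gcls hM]/(spcls hM) -[gcls hN]/(spcls hN) -[gcls hL]/(spcls hL) !chiP.
  by apply: BilinBase; apply: (GMul (T := heckeC_tower)) oX iL.
- by rewrite !linearP; apply: BilinLeft.
by rewrite !linearP; apply: BilinRight.
Qed.

Lemma chi_bone u : bone (K0s_bialg K) u -> bone (G0s_bialg K) (chi u).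
Proof.
move=> [M [hM [d1 ->]]]; rewrite -[gcls hM]/(spcls hM) chiP.
by exists M, I.
Qed.

End GrothendieckInduction.

(** * Quasisymmetric functions *)

From mathcomp Require Import mpoly.

Section TensorLift.
Variables (K : fieldType) (G H : monomType) (A : comAlgType K).
Variables (f : {malg K[G]} -> A) (g : {malg K[H]} -> A).
Hypotheses (lf : linear f) (lg : linear g).
Hypotheses (fM : {morph f : x y / x * y}) (gM : {morph g : x y / x * y}).

Definition tenslift : {malg K[(G * H)%type]} -> A := mlin (fun uv => f << uv.1 >> * g << uv.2 >>).

Lemma tenslift_linear : linear tenslift. Proof. exact: mlin_linear. Qed.

Lemma tenslift_tens x y : tenslift (tens x y) = f x * g y.
Proof.
apply: (@malg_linear_ext _ _ _ (fun x => tenslift (tens x y)) (fun x => f x * g y))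
  => [||k].
- by move=> a u v; rewrite tens_linl tenslift_linear.
- by move=> a u v; rewrite lf mulrDl -scalerAl.
apply: (@malg_linear_ext _ _ _ (fun y => tenslift (tens << k >> y))
   (fun y => f << k >> * g y)) => [||l].
- by move=> a u v; rewrite tens_linr tenslift_linear.
- by move=> a u v; rewrite lg mulrDr -scalerAr.
by rewrite tensUU /tenslift mlinU.
Qed.

Lemma tensliftM : {morph tenslift : x y / x * y}.
Proof.
apply: (malg_bilinear_mul _ tenslift_linear) => [|[k l] [k' l']].
  by move=> a x y; rewrite scalerAr.
have ->: << mmul (k, l) (k', l') >> = tens (<< k >> * << k' >>) (<< l >> * << l' >>)
    :> {malg K[(G * H)%type]} by rewrite !malg_mulUU tensUU.
by rewrite tenslift_tens fM gM /tenslift !mlinU mulrACA.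
Qed.

End TensorLift.

(** * Symmetric functions and the forgetful map *)

Section CompleteSums.

Lemma coef_prod_linear (R : comNzRingType) (I : finType) (N : nat) (x : I -> 'I_N.+1 -> R) m :
  (\prod_i \sum_(k < N.+1) x i k *: 'X^k)`_m =
  \sum_(f : {ffun I -> 'I_N.+1} | (\sum_i f i == m)%N) \prod_i x i (f i).
Proof.
rewrite bigA_distr_bigA /= coef_sum [RHS]big_mkcond; apply: eq_bigr => f _.
have -> : \prod_i (x i (f i) *: 'X^(f i)) = (\prod_i x i (f i)) *: 'X^(\sum_i f i) :> {poly R}.
  elim/big_rec3: _ => [|i p q r _ ->]; first by rewrite scale1r expr0.
  by rewrite exprD -scalerAl -scalerAr scalerA.
by rewrite coefZ coefXn eq_sym; case: eqP; rewrite ?mulr1 ?mulr0.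
Qed.

(** The product of the 1 / (1 - x_i z), each factor truncated after degree n. *)
Definition geo (R : comNzRingType) N (x : 'I_N -> R) n : {poly R} :=
  \prod_(i < N) \sum_(k < n.+1) x i ^+ k *: 'X^k.

Variable K : fieldType.

Lemma hn_geo N m n : (m <= n)%N -> hn K m N = (geo (fun i => 'X_i : mpoly N K) n)`_m.
Proof.
move=> le_mn; rewrite /geo coef_prod_linear /hn.
(* The default [bm0] is taken when the total degree exceeds m; the condition h' (h f) = f excludes
   these f. *)
pose h (f : {ffun 'I_N -> 'I_n.+1}) : 'X_{1..N < m.+1} :=
  insubd bm0 [multinom (f i : nat) | i < N].
pose h' (u : 'X_{1..N < m.+1}) : {ffun 'I_N -> 'I_n.+1} := [ffun i => inord (u i)].
have hE (f : {ffun 'I_N -> 'I_n.+1}) : (\sum_i f i = m)%N -> val (h f) = [multinom (f i : nat) | i < N].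
  move=> fm; rewrite /h insubdK // -topredE /= mdegE.
  by rewrite (eq_bigr (fun i => f i : nat)) ?fm // => i _; rewrite mnmE.
have ule (u : 'X_{1..N < m.+1}) i : (u i < n.+1)%N.
  rewrite (leq_trans _ (_ : m.+1 <= n.+1)%N) //; apply: leq_ltn_trans (bmdeg u).
  by rewrite mdegE (bigD1 i) //= leq_addr.
rewrite (reindex_onto h h') /=; last first.
  move=> u /eqP um; apply: val_inj; rewrite hE; last first.
    by rewrite -[RHS]um mdegE; apply: eq_bigr => i _; rewrite ffunE inordK.
  by apply/mnmP => i; rewrite mnmE ffunE inordK.
apply: eq_big => [f|f /andP[/eqP hm /eqP h'h]].
  apply/andP/eqP => [[/eqP hm /eqP h'h]|fm].
    by rewrite -[RHS]hm mdegE -[in LHS]h'h; apply: eq_bigr => i _; rewrite ffunE inordK.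
  split; first by rewrite hE // mdegE -[X in _ == X]fm; apply/eqP/eq_bigr => i _; rewrite mnmE.
  by apply/eqP/ffunP => i; rewrite ffunE; apply: val_inj; rewrite /= inordK ?ule // hE // mnmE.
by rewrite mpolyXE_id; apply: eq_bigr => i _; rewrite -[in RHS]h'h ffunE inordK.
Qed.

End CompleteSums.

Section ForgetfulMap.
Variable K : fieldType.
Local Notation nsym := (nsym K).

Lemma geo_rmorph (A B : comNzRingType) (h : {rmorphism A -> B}) N (x : 'I_N -> A) n :
  map_poly h (geo x n) = geo (h \o x) n.
Proof.
rewrite /geo rmorph_prod; apply: eq_bigr => i _; rewrite rmorph_sum; apply: eq_bigr => k _.
by rewrite /= map_polyZ map_polyXn rmorphXn.
Qed.

Lemma hn0 N : hn K 0 N = 1.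
Proof.
rewrite (hn_geo _ _ (leqnn 0)) /geo big1 ?coef1 // => i _.
by rewrite big_ord1 expr0 expr0 scale1r.
Qed.

Definition Lvar N M : N.-tuple (mpoly (N + M) K) := [tuple 'X_(lshift M i) | i < N].
Definition Rvar N M : M.-tuple (mpoly (N + M) K) := [tuple 'X_(rshift N i) | i < M].

(** The generating product over N + M variables factors into its two blocks. *)
Lemma hn_split n N M : hn K n (N + M)%N =
  \sum_(i < n.+1) comp_mpoly (Lvar N M) (hn K i N) * comp_mpoly (Rvar N M) (hn K (n - i)%N M).
Proof.
have gL : map_poly (comp_mpoly (Lvar N M)) (geo (fun i => 'X_i : mpoly N K) n) =
    geo (fun i => 'X_(lshift M i) : mpoly (N + M) K) n.
  rewrite geo_rmorph; congr geo; apply: funext => i /=.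
  by rewrite comp_mpolyXU -tnth_nth tnth_mktuple.
have gR : map_poly (comp_mpoly (Rvar N M)) (geo (fun i => 'X_i : mpoly M K) n) =
    geo (fun i => 'X_(rshift N i) : mpoly (N + M) K) n.
  rewrite geo_rmorph; congr geo; apply: funext => i /=.
  by rewrite comp_mpolyXU -tnth_nth tnth_mktuple.
rewrite (hn_geo _ _ (leqnn n)) /geo big_split_ord -/(geo _ n) -/(geo _ n) coefM.
apply: eq_bigr => i _; rewrite -gL -gR !coef_map.
by rewrite !(@hn_geo _ _ _ n) ?leq_subr ?leq_ord.
Qed.

Lemma forgetful_linear N : linear (fun x : nsym => forgetful x N).
Proof. exact: nsym_lift_linear. Qed.

Lemma forgetful1 N : forgetful (1 : nsym) N = 1.
Proof. exact: nsym_lift1. Qed.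

Lemma forgetfulM N : {morph (fun x : nsym => forgetful x N) : x y / x * y}.
Proof. by apply: nsym_liftM => a x y; rewrite scalerAr. Qed.

Lemma forgetful_H n N : forgetful (Hn K n) N = hn K n N.
Proof. by apply: nsym_lift_H; apply: hn0. Qed.

(** Splitting the variables and applying the product of the two substituted maps to [Delta] are both
    algebra morphisms, and they agree at H_n by [hn_split]. *)
Lemma forgetful_comul x s N M : tsum s = Delta x ->
  forgetful x (N + M)%N = \sum_(p <- s)
     comp_mpoly (Lvar N M) (forgetful p.1 N) * comp_mpoly (Rvar N M) (forgetful p.2 M).
Proof.
move=> sx; pose f y := comp_mpoly (Lvar N M) (forgetful (y : nsym) N).
pose g y := comp_mpoly (Rvar N M) (forgetful (y : nsym) M).
have lf : linear f by move=> a y z; rewrite /f forgetful_linear linearP.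
have lg : linear g by move=> a y z; rewrite /g forgetful_linear linearP.
have fM : {morph f : y z / y * z} by move=> y z; rewrite /f forgetfulM rmorphM.
have gM : {morph g : y z / y * z} by move=> y z; rewrite /g forgetfulM rmorphM.
pose mu : {linear _ -> mpoly (N + M) K} :=
  HB.pack (tenslift f g) (GRing.isLinear.Build _ _ _ _ (tenslift f g) (tenslift_linear f g)).
have muE (p : nsym * nsym) : mu (tens p.1 p.2) = f p.1 * g p.2 by exact: tenslift_tens.
transitivity (mu (Delta x)); last first.
  rewrite -sx /tsum linear_sum; apply: eq_bigr => p _; exact: muE.
apply: (@nsym_morph_ext K (mpoly (N + M) K) (fun y => forgetful y (N + M)%N)
  (fun y => tenslift f g (Delta y))) => {x s sx}.
- exact: forgetful_linear.
- by move=> a y z; rewrite Delta_linear tenslift_linear.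
- exact: forgetful1.
- rewrite Delta1 -[X in tenslift f g X](tens11 K).
  by rewrite (tenslift_tens lf lg) /f /g !forgetful1 !rmorph1 mulr1.
- exact: forgetfulM.
- by move=> y z; rewrite DeltaM (tensliftM lf lg fM gM).
move=> n _; have /(congr1 (fun h => h n)) /= -> := Delta_H K.
rewrite forgetful_H conv_tens hn_split -[tenslift f g]/(mu : _ -> _) linear_sum.
by apply: eq_bigr => i _; rewrite (muE (_, _)) /f /g !forgetful_H.
Qed.

Lemma forgetful_counit x : forgetful (x : nsym) 0 = (ncoef mone x)%:MP.
Proof.
rewrite -alg_mpolyC.
apply: (@nsym_morph_ext K (mpoly 0 K) (fun y => forgetful y 0)
  (fun y => (ncoef mone y)%:A)).
- exact: forgetful_linear.
- move=> a y z; rewrite /ncoef monalg.mcoeffD monalg.mcoeffZ scalerDl scalerA.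
  by [].
- exact: forgetful1.
- by rewrite /ncoef monalg.mcoeff1 eqxx scale1r.
- exact: forgetfulM.
- by move=> y z; rewrite counitM -scalerAl mul1r scalerA.
move=> n n_gt0; rewrite forgetful_H counit_H (hn_geo _ _ (leqnn n)) /geo big_ord0 coef1.
by rewrite eqn0Ngt n_gt0 scale0r.
Qed.

(** The elementary symmetric polynomial, as a coefficient of the product of the 1 + x_i z. *)
Definition elem N n : mpoly N K := (\prod_(i < N) (1 + 'X_i *: 'X))`_n.

Lemma alt_elem N n : alt (elem N) n = (\prod_(i < N) (1 - ('X_i : mpoly N K) *: 'X))`_n.
Proof.
rewrite /alt /elem; elim/big_rec2: _ n => [|i p q _ IH] n.
  by rewrite !coef1; case: n => [|n]; rewrite ?expr0 ?mul1r // mulr0.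
rewrite !mulrDl !mul1r !coefD mulrDr IH mulNr coefN -!scalerAl !coefZ !coefXM.
case: n => [|n] /=; first by rewrite !mulr0 oppr0.
by rewrite -!IH exprS mulN1r !mulNr mulrCA.
Qed.

Lemma geo_telescope (R : comNzRingType) (x : R) n :
  (1 - x *: 'X) * (\sum_(k < n) x ^+ k *: 'X^k) = 1 - x ^+ n *: 'X^n.
Proof.
under eq_bigr => k _ do rewrite -exprZn.
by rewrite -[RHS]opprB -exprZn subrX1 -mulNr opprB.
Qed.

Lemma coef_high (R : comNzRingType) (p : {poly R}) (c : R) n m : (n < m)%N ->
  ((1 - c *: 'X^m) * p)`_n = p`_n.
Proof.
by move=> lt; rewrite mulrBl mul1r coefB -scalerAl coefZ coefXnM lt mulr0 subr0.
Qed.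

(** Each 1 - x_i z cancels its truncated geometric series up to a term of degree n + 1, invisible in
    degree n. *)
Lemma conv_elem_hn N : conv (alt (elem N)) (fun n => hn K n N) = delta0 _.
Proof.
apply: funext => n.
transitivity (((\prod_(i < N) (1 - ('X_i : mpoly N K) *: 'X)) *
    geo (fun i => 'X_i : mpoly N K) n)`_n).
  rewrite coefM; apply: eq_bigr => i _; rewrite alt_elem (@hn_geo _ _ _ n) ?leq_subr //.
rewrite /geo -big_split /=; transitivity ((1 : {poly mpoly N K})`_n); last by rewrite coef1.
elim/big_rec: _ => // i p _ <-; rewrite geo_telescope; exact: coef_high.
Qed.

(** Uniqueness of inverses identifies the image of E(z) with the product of the 1 + x_i z; then Q(z)
    = E(z) H(z) goes to the product defining [qn]. *)
Lemma forgetful_Q n : forgetful (Qn K n) = qn K n.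
Proof.
apply: functional_extensionality_dep => N.
pose f (x : nsym) : mpoly N K := forgetful x N.
have fB : {morph f : x y / x - y}.
  by move=> x y; rewrite /f addrC -scaleN1r forgetful_linear scaleN1r addrC.
have fH : f \o Hn K = (fun n => hn K n N) by apply: funext => m; apply: forgetful_H.
have fE : f \o En K = elem N.
  apply: (morph_inv fB (forgetful1 N) (@forgetfulM N) (Hn0 K) (conv_EH K)).
  by rewrite fH conv_elem_hn.
have /(congr1 (fun h => h n)) := morph_conv fB (forgetful1 N) (@forgetfulM N) (En K) (Hn K).
rewrite fE fH /= => e; rewrite QnE -[LHS]/(f (conv (En K) (Hn K) n)) e /qn big_split /= coefM.
by apply: eq_bigr => i _; rewrite (@hn_geo _ _ _ n) ?leq_subr.
Qed.

End ForgetfulMap.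

(** * Weighted sequences and the equality of K_0 with q_n *)

Section WeightedSequences.
Variables (R : comNzRingType) (N : nat) (x : 'I_N -> R).

(* The total weight of the sequences a = t_0 <= t_1 <= ... that increase strictly
   at the descents of [b]. *)
Fixpoint seq_weight (b : bitseq) (a : 'I_N) : R :=
  if b is c :: b' then
    x a * \sum_(a' : 'I_N | if c then (a < a')%N else (a <= a')%N) seq_weight b' a'
  else x a.

Definition bit_increasing b n (t : {ffun 'I_n -> 'I_N}) : bool :=
  [forall j : 'I_n, forall k : 'I_n, (val k == j.+1) ==>
     (if nth false b j then (t j < t k)%N else (t j <= t k)%N)].

Definition ffun_cons n (a : 'I_N) (t : {ffun 'I_n -> 'I_N}) : {ffun 'I_n.+1 -> 'I_N} :=
  [ffun i => if unlift ord0 i is Some j then t j else a].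

Lemma ffun_cons0 n a (t : {ffun 'I_n -> 'I_N}) : ffun_cons a t ord0 = a.
Proof. by rewrite ffunE unlift_none. Qed.

Lemma ffun_consS n a (t : {ffun 'I_n -> 'I_N}) j : ffun_cons a t (lift ord0 j) = t j.
Proof. by rewrite ffunE liftK. Qed.

Lemma bit_increasing_cons c b n a (t : {ffun 'I_n.+1 -> 'I_N}) :
  bit_increasing (c :: b) (ffun_cons a t) =
    (if c then (a < t ord0)%N else (a <= t ord0)%N) && bit_increasing b t.
Proof.
have inc (j k : 'I_n.+1) : (val (lift ord0 k) == (lift ord0 j).+1)%N = (val k == j.+1)%N by [].
apply/'forall_forallP/andP => [tP|[t0 /'forall_forallP tP] j k].
  split; first by have := tP ord0 (lift ord0 ord0); rewrite ffun_cons0 ffun_consS.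
  apply/'forall_forallP => j k; apply/implyP => jk.
  have := tP (lift ord0 j) (lift ord0 k); by rewrite !ffun_consS inc jk.
apply/implyP; case: (unliftP ord0 k) => [k' ->|->] //; rewrite eqSS.
case: (unliftP ord0 j) => [j' ->|->]; rewrite ?ffun_consS ?ffun_cons0.
  by have /implyP := tP j' k'.
by move=> k0; have -> : k' = ord0 by [apply: val_inj; exact/eqP]; case: (c) t0.
Qed.

Lemma seq_weightE b a :
  \sum_(t : {ffun 'I_(size b).+1 -> 'I_N} | bit_increasing b t && (t ord0 == a))
    \prod_j x (t j) = seq_weight b a.
Proof.
elim: b a => [|c b IH] a.
  rewrite (big_pred1 [ffun => a]) => [|t]; first by rewrite big_ord1 ffunE.
  apply/andP/eqP => [[_ /eqP <-]|->]; first by apply/ffunP => i; rewrite ffunE ord1.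
  rewrite ffunE; split=> //; apply/'forall_forallP => j k.
  by apply/implyP; rewrite (ord1 j) (ord1 k).
rewrite [RHS]/=; under [in RHS]eq_bigr => a' _ do rewrite -IH.
transitivity (\sum_(t : {ffun 'I_(size b).+1 -> 'I_N} |
    bit_increasing (c :: b) (ffun_cons a t)) x a * \prod_j x (t j)).
  rewrite (reindex_onto (ffun_cons a) (fun t => [ffun j => t (lift ord0 j)])) => [|t /andP[_ /eqP ta]].
    apply: eq_big => [t|t _].
      rewrite ffun_cons0 eqxx andbT; case: (_ =P t); rewrite ?andbT // => -[].
      by apply/ffunP => j; rewrite ffunE ffun_consS.
    rewrite big_ord_recl ffun_cons0; congr (_ * _); apply: eq_bigr => j _.
    by rewrite ffun_consS.
  apply/ffunP => i; rewrite ffunE; case: unliftP => [j ->|->]; by rewrite ?ffunE.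
rewrite -mulr_sumr; congr (_ * _).
rewrite (partition_big (fun t : {ffun 'I_(size b).+1 -> 'I_N} => t ord0)
   (fun a' : 'I_N => if c then (a < a')%N else (a <= a')%N)) => [|t].
  apply: eq_bigr => a' aa'; apply: eq_bigl => t; rewrite bit_increasing_cons.
  by case: (_ =P a') => [->|]; rewrite ?aa' ?andbT ?andbF.
by rewrite bit_increasing_cons => /andP[].
Qed.

(** Summed over all b, a step a = a' is allowed once and a step a < a' twice, which explains the two
    sums of [level_weightS]. *)
Definition level_weight n a := \sum_(b <- bits n) seq_weight b a.

Lemma level_weight0 a : level_weight 0 a = x a.
Proof. exact: big_seq1. Qed.

Lemma level_weightS n a : level_weight n.+1 a =
  x a * (\sum_(a' : 'I_N | (a < a')%N) level_weight n a' +
         \sum_(a' : 'I_N | (a <= a')%N) level_weight n a').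
Proof.
rewrite /level_weight /= big_cat !big_map /= -!mulr_sumr -mulrDr.
by congr (_ * (_ + _)); exact: exchange_big.
Qed.

Definition tail_poly m k : {poly R} :=
  \prod_(i < N | (k <= i)%N) ((1 + x i *: 'X) * \sum_(j < m.+1) x i ^+ j *: 'X^j).

Lemma tail_sum (A : nmodType) (F : 'I_N -> A) (k : 'I_N) :
  \sum_(i < N | (k <= i)%N) F i = F k + \sum_(i < N | (k < i)%N) F i.
Proof.
rewrite (bigD1 k) //=; congr (_ + _); apply: eq_bigl => i.
by rewrite ltn_neqAle andbC eq_sym.
Qed.

(** Compare coefficients in (1 - x_k z) T_k = (1 + x_k z) T_(k+1), where T_k is [tail_poly m k];
    truncation disturbs this only in degrees above m. *)
Lemma tail_polyS m (k : 'I_N) n : (n < m)%N ->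
  (tail_poly m k)`_n.+1 = (tail_poly m k.+1)`_n.+1 +
     x k * ((tail_poly m k)`_n + (tail_poly m k.+1)`_n).
Proof.
move=> ltnm; have e : (1 - x k *: 'X) * tail_poly m k =
    (1 + x k *: 'X) * ((1 - x k ^+ m.+1 *: 'X^(m.+1)) * tail_poly m k.+1).
  rewrite -geo_telescope /tail_poly (bigD1 k) //= mulrA mulrCA -!mulrA.
  do 3![congr (_ * _)]; apply: eq_bigl => i.
  by rewrite ltn_neqAle andbC eq_sym.
have /(congr1 (fun p : {poly R} => p`_n.+1)) := e.
rewrite mulrBl mulrDl !mul1r coefB coefD -!scalerAl !coefZ !coefXM /=.
have ltnm' : (n < m.+1)%N by rewrite ltnS ltnW.
rewrite (coef_high _ _ ltnm') (@coef_high _ _ _ n.+1 m.+1 ltnm).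
by move/(canRL (subrK _)) ->; rewrite mulrDr addrAC addrA.
Qed.

(** Both sides obey the recursion of [tail_polyS], by induction on N - k and then on n. The 2
    originates in degree 1, where the constant terms of two consecutive tails add up. *)
Lemma coef_tail_poly m n k : (n < m)%N -> (k <= N)%N ->
  (tail_poly m k)`_n.+1 = (\sum_(a : 'I_N | (k <= a)%N) level_weight n a) *+ 2.
Proof.
have c0 k' : (tail_poly m k')`_0 = 1.
  rewrite -horner_coef0 horner_prod big1 // => i _.
  rewrite hornerM hornerD hornerZ hornerX hornerC mulr0 addr0 mul1r.
  rewrite horner_coef0 coef_sum big_ord_recl big1 => [|j _]; last first.
    by rewrite coefZ coefXn mulr0.
  by rewrite expr0 scale1r addr0 coef1.
move=> ltnm lekN.
rewrite -(subKn lekN); elim: (N - k)%N n ltnm => {k lekN}[|d IHd] n ltnm.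
  have Nlt i : (N - 0 <= i)%N -> (i < N)%N -> False by lia.
  rewrite /tail_poly !big1 ?coef1 ?mul0rn // => i Ni; case: (Nlt i Ni (ltn_ord i)).
case: (leqP N d) => [leNd|ltdN].
  by move: (IHd n ltnm); rewrite (_ : N - d = N - d.+1)%N //; lia.
have ltk : (N - d.+1 < N)%N by lia.
pose k := Ordinal ltk; have e : (N - d = k.+1)%N by rewrite /= subnSK.
rewrite -[(N - d.+1)%N]/(k : nat) tail_sum; rewrite e in IHd.
elim: n ltnm => [|n IHn] ltnm.
  rewrite tail_polyS // IHd // !c0 level_weight0 mulrnDl addrC -mulr2n.
  by rewrite mulr_natr.
rewrite tail_polyS // IHd // IHn ?(ltnW ltnm) // IHd ?(ltnW ltnm) //.
rewrite [RHS]mulrnDl [RHS]addrC -mulrnDl mulrnAr level_weightS tail_sum.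
by congr (_ + (_ * _) *+ 2); exact: addrC.
Qed.

End WeightedSequences.

Lemma Fn_bitcomp (K : fieldType) b N :
  Fn K (bitcomp 1 b) N = \sum_a seq_weight (fun i => 'X_i : mpoly N K) b a.
Proof.
rewrite /Fn; move: (sumn_bitcomp 1 b); rewrite add1n; move: (sumn _) => n nb.
under eq_bigl => t do under eq_forallb => j do under eq_forallb => k do
  rewrite mem_descs_bitcomp /=.
subst n.
rewrite (partition_big (fun t : {ffun 'I_(size b).+1 -> 'I_N} => t ord0) predT) //=.
apply: eq_bigr => a _; exact: (seq_weightE _ b a).
Qed.

(** For the empty set every composition qualifies, so all bit patterns are summed, as in
    [level_weight]. *)
Lemma Kn_set0 (K : fieldType) n : Kn K (set0 : {set 'I_n.+1}) = qn K n.+1.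
Proof.
apply: functional_extensionality_dep => N.
have q_tail : qn K n.+1 N = (tail_poly (fun i => 'X_i : mpoly N K) n.+1 0)`_n.+1 by [].
rewrite q_tail coef_tail_poly // /Kn cards0 expr1 /level_weight.
rewrite (eq_bigl predT) => [|al]; last by apply/forall_inP => x; rewrite inE.
rewrite comps_bits big_map exchange_big /= -[RHS]scaler_nat.
rewrite -[LHS]/(2 *: ((\sum_(b <- bits n) Fn K (bitcomp 1 b) : qseries K) N)).
congr (_ *: _).
transitivity (\sum_(b <- bits n) Fn K (bitcomp 1 b) N).
  by apply: (big_morph (fun f : qseries K => f N)).
by apply: eq_bigr => b _; exact: Fn_bitcomp.
Qed.

(** * The characteristic maps *)

Section HopfComposition.
Variables (K : fieldType) (U V W : lmodType K) (BU : bialg U) (BV : bialg V) (BW : bialg W).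

Lemma tmap_comp (f : U -> V) (g : V -> W) s : tmap g (tmap f s) = tmap (g \o f) s.
Proof. by rewrite /tmap -map_comp. Qed.

Lemma hopf_comp (f : U -> V) (g : V -> W) :
  hopf_morph BU BV f -> hopf_morph BV BW g -> hopf_morph BU BW (g \o f).
Proof.
move=> [lf Mf of_ cf ef] [lg Mg og cg eg]; split=> [a x y|x y z /Mf/Mg|x /of_/og|x s|x a /ef/eg] //.
  by rewrite /= lf lg.
by move=> /cf/cg; rewrite tmap_comp.
Qed.

End HopfComposition.

Lemma spval_linear (K : fieldType) (V : lmodType K) (S : V -> Prop) : linear (@spval K V S).
Proof. exact: (linearP (\val : subspan S -> V)). Qed.

Lemma linear_map0 (K : fieldType) (U V : lmodType K) (f : U -> V) : linear f -> f 0 = 0.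
Proof. by move=> lf; have := lf (-1) 0 0; rewrite scaler0 addr0 scaleN1r addNr. Qed.

(** * Nondegeneracy of the pairing on the side of Peak *)

Section PeakPairing.
Variables (K : fieldType) (char2 : 2 != 0 :> K) (bP : peak K -> peakd K -> K^o).
Hypothesis bPP : is_peak_pairing bP.

Lemma bP_linear y : linear (bP^~ y). Proof. by case: bPP => [[]]. Qed.

Definition peak_index n (P : {set 'I_n}) : {n : nat & {set 'I_n}} := existT (fun n => {set 'I_n}) n P.

Lemma peak_index_eq n (P Q : {set 'I_n}) : (peak_index P == peak_index Q) = (P == Q).
Proof. by rewrite -tag_eqE /tag_eq /= eqxx tagged_asE. Qed.

Lemma peak_index_neq n m (P : {set 'I_n}) (Q : {set 'I_m}) : n <> m ->
  (peak_index P == peak_index Q) = false.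
Proof. by move=> ne; apply/eqP => /(congr1 (fun i => tag i)). Qed.

(** The default 0 off the peak sets lets elements of [peak] be written as [mlin XiP f] with f
    defined on all pairs (n, P). *)
Definition XiP (i : {n : nat & {set 'I_n}}) : peak K :=
  if is_peakset (tagged i) then insubd 0 (Xi K (tagged i)) else 0.

Lemma XiP_peakset i : is_peakset (tagged i) -> spval (XiP i) = Xi K (tagged i).
Proof. by move=> pi; rewrite /XiP pi -[spval _]/(val _) insubdK //; apply: Xi_peak. Qed.

Lemma XiP_default i : ~~ is_peakset (tagged i) -> XiP i = 0.
Proof. by rewrite /XiP => /negbTE ->. Qed.

Lemma peak_XiP (x : peak K) : exists f, x = mlin XiP f.
Proof.
have lX : linear (mlin XiP) := mlin_linear _.
suff [f e] : exists f, spval x = spval (mlin XiP f) by exists f; apply: val_inj.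
have := peak_Xi (elimT (spanbP _ _) (valP x)); rewrite -[val x]/(spval x).
elim=> [|a v w [n [P [pP ->]]] _ [f ->]].
  by exists 0; rewrite (linear_map0 lX) (linear_map0 (@spval_linear _ _ _)).
exists (a *: << peak_index P >> + f); rewrite lX mlinU spval_linear.
by rewrite XiP_peakset.
Qed.

Lemma peak_pairing_XiP i m (Q : {set 'I_m}) y : is_peakset Q -> spval y = Kn K Q ->
  bP (XiP i) y = (i == peak_index Q)%:R.
Proof.
case: bPP => _ same diff pQ yQ; case: i => n P.
rewrite -/(peak_index P); have [pP|npP] := boolP (is_peakset P); last first.
  rewrite XiP_default // (linear_map0 (bP_linear y)).
  by case: eqP => // /(congr1 (fun i => is_peakset (tagged i))) /=; rewrite (negbTE npP) pQ.
have [e|ne] := n =P m; last first.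
  by rewrite (diff n m P Q) ?(XiP_peakset (i := peak_index P)) // peak_index_neq.
subst m; rewrite (same n P Q) ?(XiP_peakset (i := peak_index P)) //.
by rewrite peak_index_eq.
Qed.

(** Write x - x' as a combination of the [XiP]: pairing with K_Q returns the coefficient at a peak
    set Q, hence 0, and at the other indices [XiP] itself is 0. *)
Lemma peak_pairing_inj (x x' : peak K) :
  (forall m (Q : {set 'I_m}) y, is_peakset Q -> spval y = Kn K Q -> bP x y = bP x' y) -> x = x'.
Proof.
move=> xx'; apply/eqP; rewrite -subr_eq0; apply/eqP.
have {xx'} : forall m (Q : {set 'I_m}) y, is_peakset Q -> spval y = Kn K Q -> bP (x - x') y = 0.
  by move=> m Q y pQ yQ; rewrite addrC -scaleN1r bP_linear (xx' m Q) // scaleN1r addNr.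
have [f ->] := peak_XiP (x - x') => x0; rewrite /mlin big1 // => -[m Q] _.
have [pQ|npQ] := boolP (is_peakset Q); last by rewrite XiP_default ?scaler0.
suff -> : monalg.mcoeff (peak_index Q) f = 0 by rewrite scale0r.
have KQ : Kn K Q \in spanb (@peakd_gen K) by apply/spanbP/span_gen; exists m, Q.
rewrite -(x0 m Q (SubSpan (Kn K Q) KQ)) //.
rewrite -[RHS]/(((fun z => bP z (SubSpan (Kn K Q) KQ)) \o mlin XiP) f).
apply: (malg_linear_ext (V := K^o) (f := fun f => monalg.mcoeff (peak_index Q) f : K^o)) => [||k].
- by move=> a u v; rewrite monalg.mcoeffD monalg.mcoeffZ.
- by move=> a u v; rewrite /= (mlin_linear XiP) bP_linear.
rewrite [LHS]monalg.mcoeffU /= mlinU (peak_pairing_XiP _ pQ) //; case: (k =P _) => [->|]; by rewrite ?eqxx.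
Qed.

Lemma Qn_pairing n x m (Q : {set 'I_m}) y : spval x = Qn K n.+1 -> is_peakset Q ->
  spval y = Kn K Q -> bP x y = if m == n.+1 then (2 * (Q == set0))%:R else 0.
Proof.
move=> xQ pQ yQ; have p0 : is_peakset (set0 : {set 'I_n.+1}).
  by apply/forall_inP => i; rewrite inE.
have -> : x = 2 *: XiP (peak_index (set0 : {set 'I_n.+1})) + 0.
  by apply: val_inj; rewrite addr0 -![val _]/(spval _) xQ Qn_Xi -[2 *: XiP _]addr0 spval_linear addr0 XiP_peakset.
rewrite bP_linear (peak_pairing_XiP _ pQ yQ) (linear_map0 (bP_linear y)) addr0.
case: (m =P n.+1) => [e|ne]; last first.
  by rewrite peak_index_neq => [|/esym//]; rewrite scaler0.
by subst m; rewrite natrM peak_index_eq eq_sym.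
Qed.

End PeakPairing.

Lemma peaks1 n a : peaks n [:: a] = set0.
Proof. by apply/setP => x; rewrite !inE /= andbF. Qed.

(** Any hook realises the empty peak set; the choice (n) makes S_al trivial, as [homdim_triv]
    requires. *)
Lemma peakset_realized n (P : {set 'I_n}) : is_peakset P -> exists al,
  [/\ is_comp al, sumn al = n, peaks n al = P & (0 < n)%N -> P = set0 -> al = [:: n]].
Proof.
case: n P => [|n] P pP.
  by exists [::]; split=> //; apply/setP => -[].
have [P0|nP0] := eqVneq P set0.
  by exists [:: n.+1]; rewrite peaks1 P0; split=> //=; rewrite addn0.
have [b sb bP] := peakset_peaks pP; exists (bitcomp 1 b); split=> // [||_ P0].
- exact: bitcomp_is_comp.
- by rewrite sumn_bitcomp sb.
by rewrite P0 eqxx in nP0.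
Qed.

Lemma Rn1 (K : fieldType) n : Rn K [:: n.+1] = Hn K n.+1.
Proof.
have -> : [:: n.+1] = bitcomp 1 (nseq n false).
  suff H m : bitcomp m (nseq n false) = [:: m + n]%N by rewrite H.
  by elim: n m => [|n IH] m; rewrite ?addn0 //= IH addSnnS.
by rewrite Rn_bitcomp ribbon_nseq_false.
Qed.

Lemma homdim_hcind_triv (K : fieldType) n al : (peaks n.+1 al = set0 -> al = [:: n.+1]) ->
  homdim (hcind (simple_mod K n.+1 [:: n.+1])) (hcind (simple_mod K n.+1 al)) =
    (2 * (peaks n.+1 al == set0))%N.
Proof.
move=> al0; have [j indj] := hcind_induced (simple_mod K n.+1 [:: n.+1]).
have [p0|] := eqVneq (peaks n.+1 al) set0.
  by rewrite (al0 p0); apply: (homdim_triv _ indj).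
case/set0Pn=> x; rewrite inE => /and3P[x2 x'D xD].
by apply: (homdim_peak indj _ xD x'D); rewrite x2 ltn_ord.
Qed.

(** * The two squares and the image of the Cartan map *)

Section Characteristics.
Variables (K : fieldType) (char2 : 2 != 0 :> K).
Variables (bP : peak K -> peakd K -> K^o) (bG : K0s K -> G0s K -> K^o).
Variables (Chs : nsym K -> K0 K) (Cht : G0s K -> peakd K) (Chts : peak K -> K0s K).
Variables (Ind : {linear K0 K -> K0s K}) (chi : {linear K0s K -> G0s K}).
Hypotheses (bPP : is_peak_pairing bP) (bGP : is_hom_pairing bG).
Hypotheses (ChsP : is_Chs Chs) (ChtP : is_Cht Cht) (ChtsP : is_Chts bP bG Cht Chts).
Hypotheses (IndP : is_Ind Ind) (chiP : is_Cartan chi).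

Lemma Chs_cover n al (P : smod K (hecke n)) (hP : pmod_class P) : is_comp al -> sumn al = n ->
  proj_cover (simple_mod K n al) P -> Chs (Rn K al) = pcls hP.
Proof. by move=> ca e; subst n; apply: ChsP.2. Qed.

Lemma Cht_hcind n al : is_comp al -> sumn al = n ->
  spval (Cht (scls (hcind (simple_mod K n al)))) = Kn K (peaks n al).
Proof. by move=> ca e; subst n; apply: ChtP.2 => //; apply: hcind_induced. Qed.

Definition trivC n : smod K (heckeC n) := hcind (simple_mod K n [:: n]).

Lemma trivC_proj n : spmod_class (trivC n).
Proof. exact: (hcind_projective (@triv_projective K n n)). Qed.

Lemma Chts_Qn n x : spval x = Qn K n.+1 -> Chts x = spcls (@trivC_proj n.+1).
Proof.
(* The inverse [Chtsi] moves the comparison into Peak, where pairings separate elements; the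
   adjunction then turns the pairings of the pulled back class into Hom dimensions. *)
case: ChtsP => -[Chtsi [_ ChtsiK _ _]] adj xQ; rewrite -[RHS]ChtsiK; congr Chts.
apply: (peak_pairing_inj char2 bPP) => m Q y pQ yQ; rewrite (Qn_pairing char2 bPP xQ pQ yQ).
have [al [ca sal alQ al0]] := peakset_realized pQ.
have -> : y = Cht (scls (hcind (simple_mod K m al))).
  by apply: val_inj; rewrite -![val _]/(spval _) yQ Cht_hcind // alQ.
rewrite adj ChtsiK; case: bGP => _ same diff; case: (m =P n.+1) => [e|ne]; last first.
  by rewrite diff // => e; apply: ne.
clear sal; subst m; rewrite same homdim_hcind_triv ?alQ //.
by move=> Q0; apply: al0.
Qed.

Lemma induced_Rn x : Ind (Chs x) = Chts (theta x).
Proof.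
have [[Chsi [_ _ [lC MC oC _ _] _]] _] := ChsP.
have [[Chtsi [ChtsK ChtsiK _ [lI MI oI _ _]]] _] := ChtsP.
(* Products in [K0s] are only a relation. Pulled back by [Chtsi], the left side becomes an algebra
   endomorphism of NSym, so that the generators decide. *)
pose f x := spval (Chtsi (Ind (Chs x))).
rewrite -[LHS]ChtsiK; congr Chts; apply: val_inj; rewrite -[LHS]/(f x).
have fM : {morph f : x y / x * y}.
  move=> y z; exact: (MI _ _ _ (Ind_bmul IndP (MC y z (y * z) erefl))).
apply: (@nsym_morph_ext K (nsym K) f (fun x => spval (theta x))).
- by move=> a y z; rewrite /f lC linearP lI spval_linear.
- exact: nsym_lift_linear.
- exact: (oI _ (Ind_bone IndP (oC 1 erefl))).
- exact: nsym_lift1.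
- exact: fM.
- by apply: nsym_liftM; apply: malg_scaleAr.
case=> // n _; rewrite -[RHS]/(nsym_lift (Qn K) (Hn K n.+1)) theta_H -Rn1 /f.
have -> : Chs (Rn K [:: n.+1]) = pcls (triv_pmod K n.+1 n.+1).
  by apply: Chs_cover => //=; [rewrite addn0|exact: triv_cover].
have Qp : Qn K n.+1 \in spanb (@peak_gen K) by apply: peak_gen_Qn.
have -> : Ind (pcls (triv_pmod K n.+1 n.+1)) = spcls (@trivC_proj n.+1).
  exact/IndP/hcind_induced.
by rewrite -(@Chts_Qn n (SubSpan (Qn K n.+1) Qp)) // ChtsK.
Qed.

Lemma Ind_hopf : hopf_morph (K0_bialg K) (K0s_bialg K) Ind.
Proof.
have [[Chsi [_ ChsiK _ hChsi]] _] := ChsP; have [[_ [_ _ hChts _]] _] := ChtsP.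
have -> : (Ind : K0 K -> K0s K) = Chts \o (@theta K \o Chsi).
  by apply: funext => u; rewrite /= -induced_Rn ChsiK.
exact: hopf_comp (hopf_comp hChsi (theta_hopf K)) hChts.
Qed.

Definition cartan_char (x : peak K) : qseries K := spval (Cht (chi (Chts x))).

Lemma cartan_char_Qn n x : spval x = Qn K n.+1 -> cartan_char x = qn K n.+1.
Proof.
move=> xQ; rewrite /cartan_char (Chts_Qn xQ) (chiP _) Cht_hcind //=; last by rewrite addn0.
by rewrite peaks1 Kn_set0.
Qed.

(** Peak is not free on the Q_n, so the two maps are compared on products of Q_k, which span it; the
    empty product and the factors Q_0 = 1 are settled by preservation of the unit. *)
Lemma cartan_charE x : cartan_char x = forgetful (spval x).
Proof.
have [[_ [_ _ [lT MT oT _ _] _]] _] := ChtP.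
have [[_ [_ _ [lC MC oC _ _] _]] _] := ChtsP.
have lc : linear cartan_char.
  by move=> a y z; rewrite /cartan_char lC linearP lT spval_linear.
have cM y z t : spval t = spval y * spval z -> cartan_char t = qmul (cartan_char y) (cartan_char z).
  move=> yzt; exact: (MT _ _ _ (chi_bmul chiP (MC y z t yzt))).
have c1 t : spval t = 1 -> cartan_char t = qone K.
  move=> t1; exact: (oT _ (chi_bone chiP (oC t t1))).
have cgen s t : spval t = \prod_(k <- s) Qn K k -> cartan_char t = forgetful (spval t).
  move=> ts; rewrite ts; elim: s t ts => [|k s IH] t.
    rewrite big_nil => /c1 ->; apply: functional_extensionality_dep => N.
    by rewrite forgetful1.
  rewrite big_cons => ts.
  have sp : \prod_(k <- s) Qn K k \in spanb (@peak_gen K) by apply/spanbP/span_gen; exists s.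
  rewrite (cM (SubSpan _ (peak_gen_Qn K k)) (SubSpan _ sp) t ts) (IH (SubSpan _ sp)) //.
  apply: functional_extensionality_dep => N; rewrite /qmul forgetfulM; congr (_ * _).
  case: k {ts} => [|k]; last by rewrite (@cartan_char_Qn k) // forgetful_Q.
  rewrite (c1 (SubSpan _ (peak_gen_Qn K 0)) (Qn0 K)) Qn0; exact: esym (forgetful1 K N).
have lF : linear (fun x : peak K => forgetful (spval x)).
  move=> a y z; apply: functional_extensionality_dep => N.
  by rewrite spval_linear forgetful_linear.
suff H v : Defs.span (@peak_gen K) v -> forall t, spval t = v -> cartan_char t = forgetful (spval t).
  exact: (H (spval x) (elimT (spanbP _ _) (valP x))).
elim=> [|a u w [s us] /spanbP sw IH] t tv.
  have -> : t = 0 by apply: val_inj; rewrite -![val _]/(spval _) tv (linear_map0 (@spval_linear _ _ _)).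
  by rewrite (linear_map0 lc) (linear_map0 lF).
have su : u \in spanb (@peak_gen K) by apply/spanbP/span_gen; exists s.
have -> : t = a *: SubSpan u su + SubSpan w sw.
  by apply: val_inj; rewrite -![val _]/(spval _) tv spval_linear.
by rewrite lc lF (cgen s) // IH.
Qed.

Lemma forgetful_hopf :
  hopf_morph (peak_bialg K) (qsym_bialg K) (fun x => forgetful (spval x)).
Proof.
split=> [a x y|x y z|x|x s xs N M|x a].
- by apply: functional_extensionality_dep => N; rewrite spval_linear forgetful_linear.
- move=> xyz; apply: functional_extensionality_dep => N.
  by rewrite (xyz : spval z = _) forgetfulM.
- move=> x1; apply: functional_extensionality_dep => N.
  by rewrite (x1 : spval x = 1) forgetful1.
- have /nsym_bcomulE sx := xs.
  by rewrite (forgetful_comul _ _ sx) !big_map.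
by move=> xa; rewrite /= forgetful_counit -(xa : a = ncoef mone (spval x)).
Qed.

Lemma chi_hopf : hopf_morph (K0s_bialg K) (G0s_bialg K) chi.
Proof.
have [[Chti [ChtK _ _ hChti]] _] := ChtP; have [[Chtsi [_ ChtsiK _ hChtsi]] _] := ChtsP.
have -> : (chi : K0s K -> G0s K) = Chti \o ((Cht \o chi \o Chts) \o Chtsi).
  by apply: funext => u; rewrite /= ChtsiK ChtK.
apply: hopf_comp hChti; apply: hopf_comp hChtsi _.
have [lF MF oF cF eF] := forgetful_hopf.
have E x : spval ((Cht \o chi \o Chts) x) = forgetful (spval x) by apply: cartan_charE.
split=> [a x y|x y z /MF|x /oF|x s /cF|x a /eF].
- by apply: val_inj; rewrite -![val _]/(spval _) spval_linear !E lF.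
- by rewrite -!E.
- by rewrite -E.
- rewrite -E => h; rewrite /= in h *; rewrite tmap_comp.
  by rewrite (_ : spval \o _ = (fun x => forgetful (spval x))) //; apply: funext => t; apply: E.
by rewrite -E.
Qed.

Lemma prod_qn s : foldr (@qmul K) (qone K) (map (qn K) s) = forgetful (\prod_(k <- s) Qn K k).
Proof.
elim: s => [|k s IH]; apply: functional_extensionality_dep => N.
  by rewrite big_nil forgetful1.
by rewrite big_cons forgetfulM -IH forgetful_Q.
Qed.

(** As [Chts] is onto, the image is that of the forgetful map on Peak, which carries the spanning
    products of Q_k to the products of q_k. *)
Lemma cartan_image f : (exists y, spval (Cht (chi y)) = f) <-> omega f.
Proof.
have [[Chtsi [_ ChtsiK _ _]] _] := ChtsP.
have imE : (exists y, spval (Cht (chi y)) = f) <-> exists x : peak K, forgetful (spval x) = f.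
  split=> [[y <-]|[x <-]]; last by exists (Chts x); exact: cartan_charE.
  by exists (Chtsi y); rewrite -cartan_charE /cartan_char ChtsiK.
have [lF _ _ _ _] := forgetful_hopf.
rewrite imE; split=> [[x <-]|].
  suff H v : Defs.span (@peak_gen K) v -> omega (forgetful v).
    exact: (H (spval x) (elimT (spanbP _ _) (valP x))).
  elim=> [|a u w [s us] _ IH].
    rewrite (_ : forgetful 0 = 0); first exact: span0.
    by apply: functional_extensionality_dep => N; apply: (linear_map0 (@forgetful_linear K N)).
  rewrite (_ : forgetful _ = a *: forgetful u + forgetful w); last first.
    by apply: functional_extensionality_dep => N; apply: forgetful_linear.
  by apply: spanS => //; exists s; rewrite prod_qn us.
elim=> [|a u w [s us] _ [x xw]]; first by exists 0; rewrite (linear_map0 lF).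
have su : \prod_(k <- s) Qn K k \in spanb (@peak_gen K) by apply/spanbP/span_gen; exists s.
by exists (a *: SubSpan _ su + x); rewrite lF xw us prod_qn.
Qed.

End Characteristics.

Theorem theorem4p1p1 (K : closedFieldType) (charK : [pchar K] =i pred0)
  (bP : peak K -> peakd K -> K^o) (bG : K0s K -> G0s K -> K^o)
  (Chs : nsym K -> K0 K) (Cht : G0s K -> peakd K) (Chts : peak K -> K0s K)
  (Ind : {linear K0 K -> K0s K}) (chi : {linear K0s K -> G0s K}) :
  is_peak_pairing bP -> is_hom_pairing bG ->
  is_Chs Chs -> is_Cht Cht -> is_Chts bP bG Cht Chts ->
  is_Ind Ind -> is_Cartan chi ->
  [/\ forall al, is_comp al ->
      forall (P : smod K (hecke (sumn al))) (N : smod K (heckeC (sumn al)))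
        (hN : spmod_class N),
        pmod_class P -> proj_cover (simple_mod K _ al) P ->
        induced (@hincl _) P N ->
        Chts (theta (Rn K al)) = spcls hN,
      [/\ hopf_morph (nsym_bialg K) (peak_bialg K) (@theta K),
          hopf_morph (K0_bialg K) (K0s_bialg K) Ind
        & forall x, Ind (Chs x) = Chts (theta x)],
      [/\ hopf_morph (peak_bialg K) (qsym_bialg K) (fun x => forgetful (spval x)),
          hopf_morph (K0s_bialg K) (G0s_bialg K) chi
        & forall x, spval (Cht (chi (Chts x))) = forgetful (spval x)]
    & forall f : qseries K, (exists y, spval (Cht (chi y)) = f) <-> omega f].
Proof.
move=> bPP bGP ChsP ChtP ChtsP IndP chiP.
have char2 : 2 != 0 :> K by apply/negP => c2; have := charK 2; rewrite !inE /= c2.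
have comm := induced_Rn char2 bPP bGP ChsP ChtP ChtsP IndP.
split.
- move=> al cal P N hN hP cP iN.
  by rewrite -comm (ChsP.2 al cal P hP cP) (IndP _ P hP N hN iN).
- split; [exact: theta_hopf| |exact: comm].
  exact: (Ind_hopf char2 bPP bGP ChsP ChtP ChtsP IndP).
- split; first exact: forgetful_hopf.
    exact: (chi_hopf char2 bPP bGP ChtP ChtsP chiP).
  exact: (cartan_charE char2 bPP bGP ChtP ChtsP chiP).
exact: (cartan_image char2 bPP bGP ChtP ChtsP chiP).
Qed.
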